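(* Let $D$ be a domain in $\mathbb{C}^n$, let $\mathcal{F}$ be a family of holomorphic functions on $D$, and let $a,b$ be two distinct complex numbers. If for each $f\in\mathcal{F}$ we have $f(z)\neq a$ for all $z\in D$ and, for each $\alpha\in D$ with $f(\alpha)=b$, the zero multiplicity of $f-b$ at $\alpha$ is at least two, then $\mathcal{F}$ is normal in $D$.
   Context: For a holomorphic function $h$ near $p\in\mathbb{C}^n$, write $h(z)=\sum_{i\ge 0}P_i(z-p)$ with each $P_i$ either a homogeneous polynomial of degree $i$ or identically zero; the zero multiplicity of $h$ at $p$ is $\min\{i:P_i\not\equiv 0\}$. A family of holomorphic functions on $D$ is normal in $D$ if every sequence in it has a subsequence converging locally uniformly in $D$.
   Formalization: Normality is taken in the extended sense: each sequence has a subsequence that converges locally uniformly in D to a function or diverges locally uniformly to infinity; with finite limits only, the constants f_m = m (omitting a and b) would be a counterexample. *)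

(* Defs.v *)
From HB Require Import structures.
From mathcomp Require Import all_boot all_order all_algebra.
From mathcomp Require Import all_classical all_reals.
From mathcomp Require Import complex.
Set Implicit Arguments. Unset Strict Implicit. Unset Printing Implicit Defensive.
Import Order.TTheory GRing.Theory Num.Theory.
Local Open Scope ring_scope.
Local Open Scope classical_set_scope.

Section SCV.
Variables (R : realType) (n : nat).
Local Notation C := R[i].

Definition pt := 'I_n -> C.

Definition nrm (z : C) : R := complex.Re `|z|.

Definition supn (h : pt) : R := \big[Num.max/0]_(j < n) nrm (h j).

Definition ptadd (p h : pt) : pt := fun j => p j + h j.

Definition polydisc (p : pt) (r : R) : set pt :=
  [set z | forall j, nrm (z j - p j) < r].

Definition is_open (D : set pt) : Prop :=
  forall p, D p -> exists2 r : R, 0 < r & polydisc p r `<=` D.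

Definition is_domain (D : set pt) : Prop :=
  [/\ is_open D, D !=set0 &
   forall U V : set pt, is_open U -> is_open V -> D `<=` U `|` V ->
     D `&` U `&` V = set0 -> D `<=` U \/ D `<=` V].

Definition holomorphic (D : set pt) (f : pt -> C) : Prop :=
  forall p, D p -> exists c : 'I_n -> C,
    forall e : R, 0 < e -> exists2 d : R, 0 < d &
      forall h : pt, supn h < d ->
        nrm (f (ptadd p h) - f p - \sum_(j < n) c j * h j) <= e * supn h.

Definition hpart (c : ('I_n -> nat) -> C) (i : nat) (w : pt) : C :=
  \sum_(k : {ffun 'I_n -> 'I_i.+1} | (\sum_(j < n) (k j : nat) == i)%N)
     c (fun j => (k j : nat)) * \prod_(j < n) w j ^+ k j.

Definition hexpansion (h : pt -> C) (p : pt) (c : ('I_n -> nat) -> C) : Prop :=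
  exists2 r : R, 0 < r & forall w : pt, supn w < r ->
    forall e : R, 0 < e -> exists N0 : nat, forall N : nat, (N0 <= N)%N ->
      nrm (\sum_(i < N) hpart c i w - h (ptadd p w)) < e.

Definition zero_mult (h : pt -> C) (p : pt) (k : nat) : Prop :=
  exists c, [/\ hexpansion h p c,
    (forall i, (i < k)%N -> forall w, hpart c i w = 0) &
    ~ (forall w, hpart c k w = 0)].

Definition cvg_loc_unif (D : set pt) (u : nat -> pt -> C) (g : pt -> C) : Prop :=
  forall p, D p -> exists2 r : R, 0 < r &
    forall e : R, 0 < e -> exists N : nat, forall m, (N <= m)%N ->
      forall z, D z -> polydisc p r z -> nrm (u m z - g z) < e.

Definition div_loc_unif (D : set pt) (u : nat -> pt -> C) : Prop :=
  forall p, D p -> exists2 r : R, 0 < r &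
    forall M : R, exists N : nat, forall m, (N <= m)%N ->
      forall z, D z -> polydisc p r z -> M < nrm (u m z).

Definition normal_in (D : set pt) (F : set (pt -> C)) : Prop :=
  forall u : nat -> pt -> C, (forall m, F (u m)) ->
    exists phi : nat -> nat, (forall m, (phi m < phi m.+1)%N) /\
      ((exists g : pt -> C, cvg_loc_unif D (fun m => u (phi m)) g) \/
       div_loc_unif D (fun m => u (phi m))).

End SCV.

(* Main.v *)
(** Normality is local and can be tested on complex lines, so everything rests on a Schottky
    bound for a function [f] on the unit disc that omits [0] and takes the value [1] only with
    zero derivative.  Write [f = exp (2 i pi u)]; then [D u = 0] wherever [u] is an integer, so
    [Q = (D u)^2 / (u^2 - 1)] is holomorphic.  A Bloch-type argument bounds [Q]: at a point where
    [(1/2 - |z|)^2 |Q z|] nearly attains its supremum, [Q] is, after rescaling, nearly constant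
    on a large disc, where [u = cosh (V + c)] with [V] a primitive of [sqrt Q] close to the
    identity.  The points at which [cosh] is an integer [n > 1] form a net in the plane, so [u]
    takes such a value with nonzero derivative, a contradiction.  The bound on [Q] makes
    [|D u|] at most linear in [|u|], whence the Schottky bound.  In [n] variables the
    multiplicity hypothesis gives the vanishing of the gradient at the [b]-points, because a
    homogeneous expansion exists there; connectedness and a Montel argument finish the proof. *)

Require Import Defs.
From HB Require Import structures.
From mathcomp Require Import all_boot all_order all_algebra.
From mathcomp Require Import all_classical all_reals all_analysis.
From mathcomp Require Import complex ring lra qpoly.
Import Order.TTheory GRing.Theory Num.Theory.
Import numFieldNormedType.Exports.
Local Open Scope ring_scope.
Local Open Scope classical_set_scope.
Set Implicit Arguments. Unset Strict Implicit. Unset Printing Implicit Defensive.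

(** The shape of [Q] comes from [u = cosh V]: then [(D u)^2 / (u^2 - 1) = (D V)^2], which is single
    valued even where [V] is not. Where [u - 1] or [u + 1] has a zero of order [m >= 2], the
    numerator has order [2 m - 2 >= m], so no pole appears. Under [z -> z0 + b z] the quotient is
    multiplied by [b^2]; this is why the weight in the extremal argument is squared. Integers serve
    twice: they are the points where [exp (2 i pi u) = 1], and the numbers [n + sqrt (n^2 - 1)] have
    bounded successive ratios, which with the period [2 i pi] of [exp] gives the net its finite
    covering radius. Two obstacles shape the rest. A small value of [f] at the centre makes [u]
    large there, so the bound is proved for [|f 0| >= 1] and then transported from a point where
    [|f| = 1]. And the hypothesis constrains only multiplicities of expansions that exist, so it
    yields nothing until an expansion in all variables has been built; separate Taylor expansions
    along lines must be shown to have polynomial coefficients. *)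

Local Notation "x %:K" := (real_complex _ x) (at level 2, format "x %:K").

(** * The real-valued modulus of a complex number *)

Section Modulus.
Variable R : realType.
Local Notation C := R[i].
Implicit Types (x y : R) (z w : C).

Lemma normcE z : `|z| = (nrm z)%:K.
Proof. by rewrite /nrm normc_def. Qed.

Lemma nrm_ge0 z : 0 <= nrm z.
Proof. by have := normr_ge0 z; rewrite normcE lecR. Qed.

Lemma nrmM z w : nrm (z * w) = nrm z * nrm w.
Proof. by apply: (@complexI R); rewrite rmorphM /= -!normcE normrM. Qed.

Lemma nrmD z w : nrm (z + w) <= nrm z + nrm w.
Proof. by have := ler_normD z w; rewrite !normcE -rmorphD lecR. Qed.

Lemma nrmN z : nrm (- z) = nrm z.
Proof. by rewrite /nrm normrN. Qed.

Lemma nrmBC z w : nrm (z - w) = nrm (w - z).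
Proof. by rewrite -nrmN opprB. Qed.

Lemma nrmB z w : nrm (z - w) <= nrm z + nrm w.
Proof. by rewrite -(nrmN w); apply: nrmD. Qed.

Lemma nrm_triB z w : nrm z - nrm w <= nrm (z - w).
Proof. by have := nrmD (z - w) w; rewrite subrK; lra. Qed.

Lemma nrm_tri3 w z u : nrm (z - u) <= nrm (z - w) + nrm (w - u).
Proof. by have := nrmD (z - w) (w - u); rewrite addrA subrK. Qed.

Lemma nrm0 : nrm (0 : C) = 0.
Proof. by rewrite /nrm normr0. Qed.

Lemma nrm1 : nrm (1 : C) = 1.
Proof. by rewrite /nrm normr1. Qed.

Lemma nrm_eq0 z : (nrm z == 0) = (z == 0).
Proof.
apply/eqP/eqP => [h|->]; last exact: nrm0.
by apply/normr0_eq0; rewrite normcE h.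
Qed.

Lemma nrm_gt0 z : (0 < nrm z) = (z != 0).
Proof. by rewrite lt_neqAle nrm_ge0 andbT eq_sym nrm_eq0. Qed.

Lemma nrmK x : nrm (x%:K : C) = `|x|.
Proof. by rewrite /nrm normc_def /= expr0n /= addr0 sqrtr_sqr. Qed.

Lemma nrmV z : nrm z^-1 = (nrm z)^-1.
Proof.
have [->|z0] := eqVneq z 0; first by rewrite invr0 nrm0 invr0.
have n0 : nrm z != 0 by rewrite nrm_eq0.
by apply: (mulfI n0); rewrite divff // -nrmM divff // nrm1.
Qed.

Lemma nrmX z n : nrm (z ^+ n) = nrm z ^+ n.
Proof. by elim: n => [|n IH]; rewrite ?expr0 ?nrm1 // !exprS nrmM IH. Qed.

Lemma nrm_nat n : nrm (n%:R : C) = n%:R.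
Proof. by rewrite -(rmorph_nat (real_complex R)) nrmK normr_nat. Qed.

Lemma nrmi : nrm ('i%C : C) = 1.
Proof. by rewrite /nrm normc_def /= expr0n /= add0r expr1n sqrtr1. Qed.

Lemma Re_le_nrm z : `|complex.Re z| <= nrm z.
Proof. by have := normc_ge_Re z; rewrite normcE lecR. Qed.

Lemma Im_le_nrm z : `|complex.Im z| <= nrm z.
Proof.
have := Re_le_nrm ('i%C * z); rewrite nrmM nrmi mul1r.
by case: z => a b /=; rewrite mul0r mul1r sub0r normrN.
Qed.

Lemma nrm_le_ReIm z : nrm z <= `|complex.Re z| + `|complex.Im z|.
Proof.
rewrite {1}[z]complexE; apply: le_trans (nrmD _ _) _.
by rewrite nrmM nrmi mul1r !nrmK.
Qed.

Lemma nrm_sum n (F : 'I_n -> C) : nrm (\sum_i F i) <= \sum_i nrm (F i).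
Proof.
elim/big_ind2: _ => [|z a w b h1 h2|//]; first by rewrite nrm0.
by apply: le_trans (nrmD _ _) _; lra.
Qed.

Lemma nrm_small z : (forall e, 0 < e -> nrm z <= e) -> z = 0.
Proof.
move=> h; apply/eqP; rewrite -nrm_eq0 eq_le nrm_ge0 andbT.
by apply/ler_addgt0Pr => e /h; rewrite add0r.
Qed.

Lemma Re_mul_conj z : complex.Re (z^*%C * z) = nrm z ^+ 2.
Proof.
rewrite /nrm normc_def /= sqr_sqrtr; first by case: z => a b /=; ring.
by rewrite addr_ge0 ?sqr_ge0.
Qed.

Lemma nrmC z : nrm z^*%C = nrm z.
Proof. by case: z => a b; rewrite /nrm !normc_def /= sqrrN. Qed.

Lemma ReK_mul x z : complex.Re (x%:K * z) = x * complex.Re z.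
Proof. by case: z => a b /=; ring. Qed.

End Modulus.

(** * Compactness by repeated bisection *)

Section Bisection.
Variable R : realType.

Definition quarter (q : R * R * R * R) (b1 b2 : bool) : R * R * R * R :=
  let: (x1, x2, y1, y2) := q in
  let xm := (x1 + x2) / 2 in let ym := (y1 + y2) / 2 in
  (if b1 then x1 else xm, if b1 then xm else x2,
   if b2 then y1 else ym, if b2 then ym else y2).

(* Compactness of a closed rectangle, in Cousin's form. *)
Lemma bisection (P : R -> R -> R -> R -> Prop) x1 x2 y1 y2 :
  x1 <= x2 -> y1 <= y2 ->
  (forall a b c d, a <= b -> c <= d ->
     P a ((a + b) / 2) c ((c + d) / 2) -> P a ((a + b) / 2) ((c + d) / 2) d ->
     P ((a + b) / 2) b c ((c + d) / 2) -> P ((a + b) / 2) b ((c + d) / 2) d ->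
     P a b c d) ->
  (forall p q, x1 <= p <= x2 -> y1 <= q <= y2 ->
     exists2 e, 0 < e & forall a b c d, x1 <= a -> a <= p -> p <= b -> b <= x2 ->
       y1 <= c -> c <= q -> q <= d -> d <= y2 -> b - a < e -> d - c < e ->
       P a b c d) ->
  P x1 x2 y1 y2.
Proof.
move=> hx hy split local; apply: contrapT => nP.
pose PP (q : R * R * R * R) := let: (a, b, c, d) := q in P a b c d.
pose ok (q : R * R * R * R) := let: (a, b, c, d) := q in a <= b /\ c <= d.
(* The implications stand under the existential so that [choice] returns a total function; only its
   values on bad rectangles matter. *)
have step q : exists q', (ok q -> ~ PP q -> ~ PP q' /\ exists b1 b2, q' = quarter q b1 b2).
  apply/not_existsP => H.
  case: q H => [[[a b] c] d] H.
  have [] := H (a,b,c,d); case=> hab hcd nPq; exfalso; apply: nPq.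
  have Q b1 b2 : PP (quarter (a, b, c, d) b1 b2).
    apply: contrapT => nQ; have := H (quarter (a, b, c, d) b1 b2); apply => _ _.
    by split=> //; exists b1, b2.
  exact: split (Q true true) (Q true false) (Q false true) (Q false false).
have [f hf] := choice step.
pose s := fix s k := if k is k'.+1 then f (s k') else (x1, x2, y1, y2).
have hs k : ok (s k) /\ ~ PP (s k).
  elim: k => [|k [h1 h2]] //=.
  have [h3 [b1 [b2 h4]]] := hf _ h1 h2; split=> //.
  rewrite h4; case: (s k) h1 => [[[a b] c] d] [hab hcd].
  by case: b1 {h4}; case: b2 => /=; split; lra.
have hq k : exists b1 b2, s k.+1 = quarter (s k) b1 b2.
  by have [h1 h2] := hs k; have [] := hf _ h1 h2.
pose X1 k := (s k).1.1.1; pose X2 k := (s k).1.1.2.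
pose Y1 k := (s k).1.2; pose Y2 k := (s k).2.
have key k : [/\ X1 k <= X1 k.+1, X1 k.+1 <= X2 k.+1, X2 k.+1 <= X2 k &
                 X2 k.+1 - X1 k.+1 = (X2 k - X1 k) / 2] /\
             [/\ Y1 k <= Y1 k.+1, Y1 k.+1 <= Y2 k.+1, Y2 k.+1 <= Y2 k &
                 Y2 k.+1 - Y1 k.+1 = (Y2 k - Y1 k) / 2].
  rewrite /X1 /X2 /Y1 /Y2; have [b1 [b2 ->]] := hq k.
  have [+ _] := hs k; case: (s k) => [[[a b] c] d] /= [hab hcd].
  by case: b1; case: b2; split; split; lra.
have lim (U V : nat -> R) : U 0%N <= V 0%N ->
    (forall k, [/\ U k <= U k.+1, U k.+1 <= V k.+1, V k.+1 <= V k &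
       V k.+1 - U k.+1 = (V k - U k) / 2]) ->
    exists p, (forall k, U k <= p <= V k) /\
      forall e, 0 < e -> exists K, forall k, (K <= k)%N -> V k - U k < e.
  move=> h0 h.
  have hUV k : U k <= V k by case: k => // k; have [] := h k.
  have mU m n : (m <= n)%N -> U m <= U n.
    by elim: n => [|n IH]; [rewrite leqn0 => /eqP->|rewrite leq_eqVlt => /orP[/eqP->//|/IH];
       have [] := h n; lra].
  have mV m n : (m <= n)%N -> V n <= V m.
    by elim: n => [|n IH]; [rewrite leqn0 => /eqP->|rewrite leq_eqVlt => /orP[/eqP->//|/IH];
       have [] := h n; lra].
  have UV m n : U m <= V n.
    by have [l|/ltnW l] := leqP m n; [have := mU _ _ l; have := hUV n; lra|
       have := mV _ _ l; have := hUV m; lra].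
  have hU : has_sup [set U k | k in [set: nat]].
    by split; [exists (U 0%N), 0%N | exists (V 0%N) => _ [k _ <-]; apply: UV].
  exists (sup [set U k | k in [set: nat]]); split=> [k|e e0].
    apply/andP; split; first by apply: ub_le_sup; [case: hU|exists k].
    by apply: ge_sup; [case: hU|move=> _ [m _ <-]; apply: UV].
  have geo k : V k - U k = (V 0%N - U 0%N) / 2 ^+ k.
    elim: k => [|k IH]; first by rewrite expr0 divr1.
    by have [_ _ _ ->] := h k; rewrite IH exprSr invfM mulrA.
  have [K hK] : exists K : nat, (V 0%N - U 0%N) / e < K%:R.
    by exists (Num.truncn ((V 0%N - U 0%N) / e)).+1; apply: truncnS_gt.
  exists K => k Kk; rewrite geo ltr_pdivrMr ?exprn_gt0 //.
  rewrite ltr_pdivrMr // in hK; apply: lt_le_trans hK _.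
  rewrite mulrC ler_wpM2l //; first exact: ltW.
  by rewrite -natrX ler_nat (leq_trans Kk) // ltnW // ltn_expl.
have [p [hp hpe]] := lim X1 X2 hx (fun k => (key k).1).
have [q [hq' hqe]] := lim Y1 Y2 hy (fun k => (key k).2).
have [e e0 He] := local p q (hp 0%N) (hq' 0%N).
have [K1 h1] := hpe _ e0; have [K2 h2] := hqe _ e0.
pose k := maxn K1 K2.
have [_] := hs k; apply.
have h1' := h1 k (leq_maxl _ _); have h2' := h2 k (leq_maxr _ _).
have b : [/\ x1 <= X1 k, X2 k <= x2, y1 <= Y1 k & Y2 k <= y2].
  elim: (k) => [|j [a1 a2 a3 a4]]; first by rewrite /X1 /X2 /Y1 /Y2.
  by have [[b1 b2 b3 _] [c1 c2 c3 _]] := key j; split; lra.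
case: b => b1 b2 b3 b4.
have /andP[p1 p2] := hp k; have /andP[q1 q2] := hq' k.
move: h1' h2' b1 b2 b3 b4 p1 p2 q1 q2; rewrite /X1 /X2 /Y1 /Y2.
case: (s k) => [[[a b] c] d] /= *; exact: He.
Qed.

Lemma bisection1 (P : R -> R -> Prop) a b : a <= b ->
  (forall x y, x <= y -> P x ((x + y) / 2) -> P ((x + y) / 2) y -> P x y) ->
  (forall p, a <= p <= b -> exists2 e, 0 < e &
     forall x y, a <= x -> x <= p -> p <= y -> y <= b -> y - x < e -> P x y) ->
  P a b.
Proof.
move=> ab split local.
apply: (@bisection (fun x y _ _ => P x y) a b 0 1) => //.
  by move=> x y _ _ h _ h1 _ h2 _; apply: split.
move=> p q hp _; have [e e0 h] := local p hp; exists e => // x y *; exact: h.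
Qed.

End Bisection.

(** * Complex differentiability *)

Section ComplexDerivative.
Variable R : realType.
Local Notation C := R[i].
Implicit Types (f g : C -> C) (z w c : C).

Definition near_pt z (P : C -> Prop) :=
  exists2 d : R, 0 < d & forall w, nrm (w - z) < d -> P w.

Lemma near_and z P Q : near_pt z P -> near_pt z Q -> near_pt z (fun w => P w /\ Q w).
Proof.
move=> [d d0 hd] [e e0 he]; exists (Num.min d e); first by rewrite lt_min d0 e0.
by move=> w; rewrite lt_min => /andP[/hd ? /he].
Qed.

Lemma near_imp z (P Q : C -> Prop) : (forall w, P w -> Q w) -> near_pt z P -> near_pt z Q.
Proof. by move=> PQ [d d0 hd]; exists d => // w /hd /PQ. Qed.

Lemma near_self z P : near_pt z P -> P z.
Proof. by move=> [d d0]; apply; rewrite subrr nrm0. Qed.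

Lemma near_disc p (r : R) z : nrm (z - p) < r -> near_pt z (fun w => nrm (w - p) < r).
Proof.
move=> h; exists (r - nrm (z - p)); first by rewrite subr_gt0.
by move=> w hw; apply: le_lt_trans (nrm_tri3 z _ _) _; lra.
Qed.

Definition cont f z := forall e : R, 0 < e -> near_pt z (fun w => nrm (f w - f z) < e).

(* Caratheodory's form of differentiability. *)
Definition cder f z c := exists psi,
  [/\ cont psi z, psi z = c & forall w, f w - f z = psi w * (w - z)].

Definition holo (p : C) (r : R) f := forall z, nrm (z - p) < r -> exists c, cder f z c.

Definition D f z : C := xget 0 [set c | cder f z c].

Lemma cont_near f g z : near_pt z (fun w => f w = g w) -> cont f z -> cont g z.
Proof.
move=> fg cf e /cf fe; have fgz := near_self fg.
by apply: near_imp (near_and fg fe) => w [<-]; rewrite fgz.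
Qed.

Lemma cont_cst c z : cont (fun=> c) z.
Proof. by move=> e e0; exists 1 => // w _; rewrite subrr nrm0. Qed.

Lemma cont_id z : cont id z.
Proof. by move=> e e0; exists e. Qed.

Lemma contD f g z : cont f z -> cont g z -> cont (fun w => f w + g w) z.
Proof.
move=> cf cg e e0.
have e2 : 0 < e / 2 by lra.
apply: near_imp (near_and (cf _ e2) (cg _ e2)) => w [h1 h2].
rewrite opprD addrACA; apply: le_lt_trans (nrmD _ _) _; lra.
Qed.

Lemma contM f g z : cont f z -> cont g z -> cont (fun w => f w * g w) z.
Proof.
move=> cf cg e e0.
have F := nrm_ge0 (f z); have G := nrm_ge0 (g z).
have e1 : 0 < e / 2 / (nrm (g z) + 1) by rewrite !divr_gt0 //; lra.
have e2 : 0 < e / 2 / (nrm (f z) + 1) by rewrite !divr_gt0 //; lra.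
apply: near_imp (near_and (cf _ e1) (near_and (cg _ e2) (cg _ ltr01))) => w [h1 [h2 h3]].
have -> : f w * g w - f z * g z = (f w - f z) * g w + f z * (g w - g z) by ring.
apply: le_lt_trans (nrmD _ _) _; rewrite !nrmM.
rewrite ltr_pdivlMr in h1; last lra.
rewrite ltr_pdivlMr in h2; last lra.
have h4 : nrm (g w) <= nrm (g z) + 1 by have := nrm_triB (g w) (g z); lra.
have h5 : nrm (f w - f z) * nrm (g w) <= nrm (f w - f z) * (nrm (g z) + 1).
  by rewrite ler_wpM2l ?nrm_ge0.
have h6 : nrm (f z) * nrm (g w - g z) <= nrm (g w - g z) * (nrm (f z) + 1).
  by rewrite mulrC ler_wpM2l ?nrm_ge0 //; lra.
lra.
Qed.

Lemma cont_near0 f z : cont f z -> f z != 0 -> near_pt z (fun w => nrm (f z) / 2 < nrm (f w)).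
Proof.
rewrite -nrm_gt0 => cf f0; have e0 : 0 < nrm (f z) / 2 by lra.
by apply: near_imp (cf _ e0) => w; rewrite nrmBC => h; have := nrm_triB (f z) (f w); lra.
Qed.

Lemma contV f z : cont f z -> f z != 0 -> cont (fun w => (f w)^-1) z.
Proof.
move=> cf f0 e e0; have n0 : 0 < nrm (f z) by rewrite nrm_gt0.
have d0 : 0 < e * (nrm (f z) * nrm (f z) / 2) by rewrite mulr_gt0 // divr_gt0 // mulr_gt0.
apply: near_imp (near_and (cont_near0 cf f0) (cf _ d0)) => w [h1 h2].
have w0 : f w != 0 by rewrite -nrm_gt0; lra.
have -> : (f w)^-1 - (f z)^-1 = (f z - f w) / (f w * f z) by field; apply/andP; split.
rewrite nrmM nrmV nrmM nrmBC ltr_pdivrMr; last by rewrite mulr_gt0 ?nrm_gt0.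
apply: lt_le_trans h2 _; rewrite ler_wpM2l ?(ltW e0) //.
rewrite mulrAC; apply: ler_wpM2r; lra.
Qed.

Lemma cont_comp f g z : cont f z -> cont g (f z) -> cont (fun w => g (f w)) z.
Proof.
move=> cf cg e /cg[d d0 hd]; by apply: near_imp (cf _ d0) => w /hd.
Qed.

Lemma contN f z : cont f z -> cont (fun w => - f w) z.
Proof.
by move=> cf e /cf; apply: near_imp => w; rewrite -opprD nrmN.
Qed.

Lemma contB f g z : cont f z -> cont g z -> cont (fun w => f w - g w) z.
Proof. by move=> cf cg; apply: contD cf (contN cg). Qed.

Lemma contX f n z : cont f z -> cont (fun w => f w ^+ n) z.
Proof.
move=> cf; elim: n => [|n IH]; first exact: cont_cst.
apply: cont_near (contM cf IH).
by exists 1 => // w _; rewrite exprS.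
Qed.

Lemma cont_uniq f g z : cont f z -> cont g z ->
  (exists2 d : R, 0 < d & forall w, w != z -> nrm (w - z) < d -> f w = g w) -> f z = g z.
Proof.
move=> cf cg [d d0 h]; apply/subr0_eq/nrm_small => e e0.
have e2 : 0 < e / 2 by lra.
have [d' d'0 H] := near_and (cf _ e2) (cg _ e2).
pose t := Num.min d d' / 2.
have t0 : 0 < t by rewrite divr_gt0 // lt_min d0 d'0.
have [td td'] : t < d /\ t < d'.
  by rewrite /t; case: (ltP d d') => ?; split; lra.
have tz : nrm (z + t%:K - z) = t by rewrite addrC addKr nrmK gtr0_norm.
have [h1 h2] : nrm (f (z + t%:K) - f z) < e / 2 /\ nrm (g (z + t%:K) - g z) < e / 2.
  by apply: H; rewrite tz.
have E : f (z + t%:K) = g (z + t%:K).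
  apply: h; last by rewrite tz.
  by rewrite -subr_eq0 -nrm_eq0 tz gt_eqF.
apply: le_trans (nrm_tri3 (f (z + t%:K)) _ _) _.
by rewrite nrmBC {2}E; lra.
Qed.

Lemma cder_uniq f z c c' : cder f z c -> cder f z c' -> c = c'.
Proof.
move=> [p [cp <- hp]] [q [cq <- hq]]; apply: cont_uniq => //.
exists 1 => // w wz _; apply: (@mulIf _ (w - z)); first by rewrite subr_eq0.
by rewrite -hp hq.
Qed.

Lemma DE f z c : cder f z c -> D f z = c.
Proof. by move=> h; apply: cder_uniq (h); apply: (xgetI _ h). Qed.

Lemma holoD p r f z : holo p r f -> nrm (z - p) < r -> cder f z (D f z).
Proof. by move=> h /h[c hc]; rewrite (DE hc). Qed.

Lemma cderP f z c :
  (forall e : R, 0 < e -> near_pt z (fun w => nrm (f w - f z - c * (w - z)) <= e * nrm (w - z)))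
  <-> cder f z c.
Proof.
split=> [h|[psi [cp <- hp]] e e0].
  pose psi w := if w == z then c else (f w - f z) / (w - z).
  have pz : psi z = c by rewrite /psi eqxx.
  exists psi; split=> // [e e0|w].
    have e2 : 0 < e / 2 by lra.
    apply: near_imp (h _ e2) => w; rewrite pz /psi; case: eqP => [->|/eqP wz].
      by rewrite !subrr nrm0.
    have wz0 : w - z != 0 by rewrite subr_eq0.
    have -> : (f w - f z) / (w - z) - c = (f w - f z - c * (w - z)) / (w - z) by field.
    rewrite nrmM nrmV -ler_pdivrMr ?nrm_gt0 //; lra.
  rewrite /psi; case: eqP => [->|/eqP wz]; first by rewrite !subrr mulr0.
  by rewrite divfK // subr_eq0.
apply: near_imp (cp _ e0) => w h.
by rewrite hp -mulrBl nrmM ler_wpM2r ?nrm_ge0 // ltW.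
Qed.

Lemma cder_near f g z c : near_pt z (fun w => f w = g w) -> cder f z c -> cder g z c.
Proof.
move=> fg /cderP h; apply/cderP => e /h fe.
by apply: near_imp (near_and fg fe) => w [<-]; rewrite (near_self fg).
Qed.

Lemma cder_eq f z c c' : cder f z c -> c = c' -> cder f z c'.
Proof. by move=> h <-. Qed.

Lemma cder_cont f z c : cder f z c -> cont f z.
Proof.
move=> [psi [cp _ hp]].
apply: (@cont_near (fun w => f z + psi w * (w - z))).
  by exists 1 => // w _; rewrite -hp addrC subrK.
apply: contD; first exact: cont_cst.
by apply: contM => //; apply: contB; [apply: cont_id|apply: cont_cst].
Qed.

Lemma cder_cst a z : cder (fun=> a) z 0.
Proof. by exists (fun=> 0); split=> [|//|w]; [apply: cont_cst|rewrite subrr mul0r]. Qed.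

Lemma cder_id z : cder id z 1.
Proof. by exists (fun=> 1); split=> [|//|w]; [apply: cont_cst|rewrite mul1r]. Qed.

Lemma cderDD f g z c d : cder f z c -> cder g z d -> cder (fun w => f w + g w) z (c + d).
Proof.
move=> [p [cp <- hp]] [q [cq <- hq]]; exists (fun w => p w + q w); split=> // [|w].
  exact: contD.
by rewrite opprD addrACA hp hq mulrDl.
Qed.

Lemma cderM f g z c d : cder f z c -> cder g z d ->
  cder (fun w => f w * g w) z (c * g z + f z * d).
Proof.
move=> hf hg; have cg := cder_cont hg.
case: hf hg => [p [cp <- hp]] [q [cq <- hq]].
exists (fun w => p w * g w + f z * q w); split=> // [|w].
  by apply: contD; apply: contM => //; apply: cont_cst.
have -> : f w * g w - f z * g z = (f w - f z) * g w + f z * (g w - g z) by ring.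
by rewrite hp hq; ring.
Qed.

Lemma cderZ a f z c : cder f z c -> cder (fun w => a * f w) z (a * c).
Proof. by move=> h; apply: cder_eq (cderM (cder_cst a z) h) _; rewrite mul0r add0r. Qed.

Lemma cderN f z c : cder f z c -> cder (fun w => - f w) z (- c).
Proof.
move=> h; apply: cder_near (cder_eq (cderZ (-1) h) (mulN1r c)).
by exists 1 => // w _; rewrite mulN1r.
Qed.

Lemma cderB f g z c d : cder f z c -> cder g z d -> cder (fun w => f w - g w) z (c - d).
Proof. by move=> hf hg; apply: cderDD hf (cderN hg). Qed.

Lemma cder_comp f g z c d : cder f z c -> cder g (f z) d -> cder (fun w => g (f w)) z (d * c).
Proof.
move=> hf; have cf := cder_cont hf.
case: hf => [p [cp <- hp]] [q [cq <- hq]].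
exists (fun w => q (f w) * p w); split=> // [|w]; last by rewrite hq hp mulrA.
by apply: contM => //; apply: cont_comp.
Qed.

Lemma cderV f z c : cder f z c -> f z != 0 ->
  cder (fun w => (f w)^-1) z (- c / f z ^+ 2).
Proof.
move=> hf f0; have cf := cder_cont hf.
have nf : near_pt z (fun w => f w != 0).
  by apply: near_imp (cont_near0 cf f0) => w h; rewrite -nrm_gt0; have := nrm_ge0 (f z); lra.
case: hf => [p [cp <- hp]]; apply/cderP.
(* Caratheodory's identity must hold for every [w], also at the zeros of [f], where the inverse is
   [0]. The inverse is therefore redefined there; near [z] nothing changes, as [f] does not
   vanish. *)
suff : cder (fun w => if f w == 0 then (f z)^-1 - p w / (f w * f z) * (w - z) else (f w)^-1)
          z (- p z / f z ^+ 2).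
  move/(@cder_near _ (fun w => (f w)^-1)) => H; apply/cderP/H.
  by apply: near_imp nf => w /negPf ->.
exists (fun w => - p w * (f w * f z)^-1); split=> [|//|w].
- apply: contM; first exact: contN.
  apply: contV; last by rewrite mulf_neq0.
  by apply: contM => //; apply: cont_cst.
- rewrite (negPf f0); case: eqP => [_|/eqP fw]; first by ring.
  have -> : (f w)^-1 - (f z)^-1 = - (f w - f z) / (f w * f z) by field; apply/andP; split.
  by rewrite hp; field; apply/andP; split.
Qed.

Lemma cderXn n z : cder (fun w => w ^+ n) z (n%:R * z ^+ n.-1).
Proof.
elim: n => [|n IH]; first by rewrite mul0r; apply: cder_cst.
apply: cder_near (cder_eq (cderM (cder_id z) IH) _).
  by exists 1 => // w _; rewrite exprS.
case: n {IH} => [|n] /=; first by rewrite expr0; ring.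
by rewrite -[n.+2%:R]natr1 exprS; ring.
Qed.

Lemma cder_affine a b z : cder (fun w => a + b * w) z b.
Proof.
apply: cder_eq (cderDD (cder_cst a z) (cderZ b (cder_id z))) _.
by rewrite mulr1 add0r.
Qed.

End ComplexDerivative.

(** * Line integrals *)

Section LineIntegral.
Variable R : realType.
Local Notation C := R[i].
Implicit Types (G g : R -> C).

Definition rder G (t : R) (c : C) := forall e : R, 0 < e ->
  exists2 d : R, 0 < d & forall s, `|s - t| < d ->
    nrm (G s - G t - c * (s - t)%:K) <= e * `|s - t|.

Definition rcont g := forall t e : R, 0 < e ->
  exists2 d : R, 0 < d & forall s, `|s - t| < d -> nrm (g s - g t) < e.

(** A mean value inequality by bisection: near each point the increment is the derivative times the
    length up to a small multiple of the length, and such estimates add up over subintervals. The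
    bounds on integrals and the uniqueness of primitives all come from it. *)
Lemma rder_Re_le G g (a b : R) (l : C) (m : R) : a <= b ->
  (forall t, a <= t <= b -> rder G t (g t)) ->
  (forall t, a <= t <= b -> complex.Re (l * g t) <= m) ->
  complex.Re (l * (G b - G a)) <= m * (b - a).
Proof.
move=> ab dG gm; apply/ler_addgt0Pr => e0 e00.
pose e := e0 / (b - a + 1).
have e_gt0 : 0 < e by rewrite divr_gt0 //; lra.
suff : complex.Re (l * (G b - G a)) <= (m + e) * (b - a).
  have : e * (b - a) <= e0.
    by rewrite /e mulrAC ler_pdivrMr ?ler_wpM2l //; [exact: ltW|lra|lra].
  lra.
apply: (bisection1 (P := fun x y => complex.Re (l * (G y - G x)) <= (m + e) * (y - x))) => //.
  move=> x y xy h1 h2.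
  have -> : l * (G y - G x) = l * (G y - G ((x + y) / 2)) + l * (G ((x + y) / 2) - G x) by ring.
  by rewrite raddfD /=; lra.
move=> p hp; have l0 : 0 < nrm l + 1 by have := nrm_ge0 l; lra.
have e'0 : 0 < e / (nrm l + 1) by rewrite divr_gt0.
have [d d0 hd] := dG p hp _ e'0; exists d => // x y ax xp py yb yx.
have := hd x; rewrite ler0_norm; last lra.
have := hd y; rewrite ger0_norm; last lra.
move=> /(_ ltac:(lra)) h1 /(_ ltac:(lra)) h2.
set u := _ - _ - _ in h1; set v := _ - _ - _ in h2.
have -> : l * (G y - G x) = l * (u - v) + (y - x)%:K * (l * g p).
  by rewrite /u /v !rmorphB; ring.
rewrite raddfD /= ReK_mul.
have h3 : complex.Re (l * (u - v)) <= nrm l * (e / (nrm l + 1) * (y - x)).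
  apply: le_trans (ler_norm _) _; apply: le_trans (Re_le_nrm _) _.
  rewrite nrmM ler_wpM2l ?nrm_ge0 //; apply: le_trans (nrmB _ _) _; lra.
have h4 : nrm l * (e / (nrm l + 1) * (y - x)) <= e * (y - x).
  rewrite mulrA ler_wpM2r //; first lra.
  by rewrite mulrCA ler_piMr ?(ltW e_gt0) // ler_pdivrMr //; lra.
have h5 := gm p hp.
have h6 : (y - x) * complex.Re (l * g p) <= (y - x) * m by rewrite ler_wpM2l //; lra.
lra.
Qed.

Lemma rder_nrm_le G g (a b m : R) : a <= b ->
  (forall t, a <= t <= b -> rder G t (g t)) ->
  (forall t, a <= t <= b -> nrm (g t) <= m) ->
  nrm (G b - G a) <= m * (b - a).
Proof.
move=> ab dG gm.
have [z0|n0] := eqVneq (G b - G a) 0.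
  rewrite z0 nrm0 mulr_ge0 ?subr_ge0 //.
  by apply: le_trans (gm a _); rewrite ?nrm_ge0 // lexx.
set z := G b - G a in n0 *; have nz : 0 < nrm z by rewrite nrm_gt0.
(* Testing the increment against its own conjugate turns the bound on a real part into a bound on a
   modulus. *)
have : complex.Re (z^*%C * z) <= nrm z * m * (b - a).
  apply: (@rder_Re_le G g) => // t ht.
  apply: le_trans (ler_norm _) _; apply: le_trans (Re_le_nrm _) _.
  by rewrite nrmM nrmC ler_wpM2l ?nrm_ge0 // gm.
by rewrite Re_mul_conj expr2 -mulrA ler_pM2l.
Qed.

Lemma rder0_const G (a b : R) : a <= b -> (forall t, a <= t <= b -> rder G t 0) -> G b = G a.
Proof.
move=> ab h; apply/subr0_eq/nrm_small => e e0.
have := @rder_nrm_le G (fun=> 0) a b 0 ab h; rewrite mul0r => H.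
by apply: le_trans (H _) (ltW e0) => t _; rewrite nrm0.
Qed.

Lemma rderD G H t c d : rder G t c -> rder H t d -> rder (fun s => G s + H s) t (c + d).
Proof.
move=> hG hH e e0; have e2 : 0 < e / 2 by lra.
have [d1 d10 h1] := hG _ e2; have [d2 d20 h2] := hH _ e2.
exists (Num.min d1 d2) => [|s]; rewrite lt_min ?d10 // => /andP[/h1 k1 /h2 k2].
have -> : G s + H s - (G t + H t) - (c + d) * (s - t)%:K =
  (G s - G t - c * (s - t)%:K) + (H s - H t - d * (s - t)%:K) by ring.
by apply: le_trans (nrmD _ _) _; lra.
Qed.

Lemma rderZ a G t c : rder G t c -> rder (fun s => a * G s) t (a * c).
Proof.
move=> hG e e0; have l0 : 0 < nrm a + 1 by have := nrm_ge0 a; lra.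
have e1 : 0 < e / (nrm a + 1) by rewrite divr_gt0.
have [d d0 h] := hG _ e1; exists d => // s /h {}h.
have -> : a * G s - a * G t - a * c * (s - t)%:K = a * (G s - G t - c * (s - t)%:K) by ring.
rewrite nrmM; apply: le_trans (ler_wpM2l (nrm_ge0 a) h) _.
rewrite mulrA ler_wpM2r //.
by rewrite mulrCA ler_piMr ?(ltW e0) // ler_pdivrMr //; lra.
Qed.

Lemma rderB G H t c d : rder G t c -> rder H t d -> rder (fun s => G s - H s) t (c - d).
Proof.
move=> hG hH e e0; have [d0 d00 h] := rderD hG (rderZ (-1) hH) e0.
by exists d0 => // s /h; rewrite !mulN1r.
Qed.

Lemma rder_line (F : C -> C) p v (t : R) c :
  cder F (p + t%:K * v) c -> rder (fun s => F (p + s%:K * v)) t (v * c).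
Proof.
move/cderP => hF e e0; have l0 : 0 < nrm v + 1 by have := nrm_ge0 v; lra.
have e1 : 0 < e / (nrm v + 1) by rewrite divr_gt0.
have [d d0 h] := hF _ e1; exists (d / (nrm v + 1)) => [|s]; first by rewrite divr_gt0.
rewrite ltr_pdivlMr // => hs.
have E : p + s%:K * v - (p + t%:K * v) = (s - t)%:K * v by rewrite rmorphB; ring.
have := h (p + s%:K * v); rewrite E nrmM nrmK.
have hv : `|s - t| * nrm v <= `|s - t| * (nrm v + 1) by rewrite ler_wpM2l //; lra.
move=> /(_ (le_lt_trans hv hs)).
have -> : v * c * (s - t)%:K = c * ((s - t)%:K * v) by ring.
move=> H; apply: le_trans H _.
rewrite mulrCA [leRHS]mulrC ler_wpM2l // mulrAC.
by rewrite ler_pdivrMr // ler_wpM2l ?(ltW e0) //; lra.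
Qed.

Lemma rcont_line (F : C -> C) p v : (forall t : R, cont F (p + t%:K * v)) ->
  rcont (fun s => F (p + s%:K * v)).
Proof.
move=> cF t e e0; have l0 : 0 < nrm v + 1 by have := nrm_ge0 v; lra.
have [d d0 h] := cF t e e0; exists (d / (nrm v + 1)) => [|s]; first by rewrite divr_gt0.
rewrite ltr_pdivlMr // => hs; apply: h.
have -> : p + s%:K * v - (p + t%:K * v) = (s - t)%:K * v by rewrite rmorphB; ring.
rewrite nrmM nrmK; apply: le_lt_trans hs.
by rewrite ler_wpM2l //; lra.
Qed.

Let dero (F : R -> R) (t c : R) := forall e : R, 0 < e ->
  exists2 d : R, 0 < d & forall s, `|s - t| < d ->
    `|F s - F t - c * (s - t)| <= e * `|s - t|.

Lemma real_primitive_right (f : R -> R) : continuous f ->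
  exists F : R -> R, forall t, -1 < t -> dero F t (f t).
Proof.
move=> cf; exists (fun x => \int[lebesgue_measure]_(t in `[-1, x]) f t) => t ht e e0.
have tu : t < t + 1 by lra.
have intf : lebesgue_measure.-integrable `[-1, t + 1] (EFin \o f).
  apply: continuous_compact_integrable; first exact: segment_compact.
  exact: continuous_subspaceT.
have [dF FE] := continuous_FTC1_closed tu intf ht (cf t).
rewrite -FE derive1E.
set F := (fun x0 : R => _) in dF FE *.
move: dF; rewrite /derivable => /cvgrPdist_le /(_ e e0).
rewrite -/(derive F t 1).
move/nbhs_ballP => [d /= d0 hd]; exists d => // s hs.
have [->|st] := eqVneq s t; first by rewrite !subrr mulr0 subr0 !normr0 mulr0.
have st0 : s - t != 0 by rewrite subr_eq0.
have bs : ball 0 d (s - t) by rewrite /ball /= sub0r normrN.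
have := hd _ bs st0; rewrite /GRing.scale /= mulr1 subrK => h.
have -> : F s - F t - 'D_1 F t * (s - t) = - ('D_1 F t - (s - t)^-1 * (F s - F t)) * (s - t).
  by field.
by rewrite normrM normrN ler_wpM2r.
Qed.

(** Integration from [-1] gives a primitive to the right of [-1], and the reflected function gives
    one to the left of [1]. The overlap around [0] lets the two halves, both vanishing at [0], be
    glued differentiably. *)
Lemma real_primitive (f : R -> R) : continuous f ->
  exists F : R -> R, forall t, dero F t (f t).
Proof.
move=> cf.
have [F hF] := real_primitive_right cf.
have [H hH] : exists H : R -> R, forall t, -1 < t -> dero H t (f (- t)).
  apply: (@real_primitive_right (fun t => f (- t))) => t.
  apply: continuous_comp; [exact: opp_continuous|exact: cf].
pose G t := if 0 <= t then F t - F 0 else H 0 - H (- t).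
exists G => t e e0.
have hH' s : s < 1 -> dero (fun s => H 0 - H (- s)) s (f s).
  move=> s1 e1 e10; have [|d d0 h] := hH (- s) _ e1 e10; first lra.
  exists d => // u us; have := h (- u).
  have -> : - u - - s = - (u - s) by ring.
  rewrite opprK [X in X < d]normrN [X in _ <= e1 * X]normrN => /(_ us) {}h.
  have -> : H 0 - H (- u) - (H 0 - H (- s)) - f s * (u - s) =
    - (H (- u) - H (- s) - f s * - (u - s)) by ring.
  by rewrite normrN.
have hF' s : -1 < s -> dero (fun s => F s - F 0) s (f s).
  move=> s1 e1 e10; have [d d0 h] := hF s s1 _ e10.
  exists d => // u /h.
  by have -> : F u - F 0 - (F s - F 0) - f s * (u - s) = F u - F s - f s * (u - s) by ring.
have [t0|t0|t0] := ltgtP t 0.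
- have [|d d0 h] := hH' t _ e e0; first lra.
  exists (Num.min d (- t)) => [|s]; first by rewrite lt_min d0; lra.
  rewrite lt_min => /andP[/h {}h hs].
  have s0 : s < 0 by have := ler_norm (s - t); lra.
  by rewrite /G (lt_geF s0) (lt_geF t0).
- have [|d d0 h] := hF' t _ e e0; first lra.
  exists (Num.min d t) => [|s]; first by rewrite lt_min d0; lra.
  rewrite lt_min => /andP[/h {}h hs].
  have s0 : 0 <= s by have := ler_norm (- (s - t)); rewrite normrN; lra.
  by rewrite /G s0 (ltW t0).
have [|d1 d10 h1] := hF' t _ e e0; first lra.
have [|d2 d20 h2] := hH' t _ e e0; first lra.
exists (Num.min d1 d2) => [|s]; first by rewrite lt_min d10.
rewrite lt_min => /andP[/h1 {}h1 /h2 {}h2].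
move: h1 h2; rewrite /G {}t0 lexx oppr0 !subrr.
by case: (leP 0 s).
Qed.

Lemma primitive g : rcont g -> exists G, forall t, rder G t (g t).
Proof.
move=> cg.
have cRe : continuous (fun t => complex.Re (g t)).
  move=> t; apply/cvgrPdist_lt => e e0; have [d d0 h] := cg t e e0.
  apply/nbhs_ballP; exists d => // s; rewrite /ball /= distrC => /h hs.
  rewrite distrC -raddfB; exact: le_lt_trans (Re_le_nrm _) hs.
have cIm : continuous (fun t => complex.Im (g t)).
  move=> t; apply/cvgrPdist_lt => e e0; have [d d0 h] := cg t e e0.
  apply/nbhs_ballP; exists d => // s; rewrite /ball /= distrC => /h hs.
  rewrite distrC -raddfB; exact: le_lt_trans (Im_le_nrm _) hs.
have [F hF] := real_primitive cRe; have [H hH] := real_primitive cIm.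
exists (fun t => (F t)%:K + 'i%C * (H t)%:K) => t.
have emb (A : R -> R) c : dero A t c -> rder (fun s => (A s)%:K) t (c%:K).
  move=> hA e /hA[d d0 h]; exists d => // s /h.
  by rewrite -!rmorphB -rmorphM -rmorphB nrmK.
by rewrite [g t]complexE; apply: rderD; [apply/emb|apply/rderZ/emb].
Qed.

(* Defined through an arbitrary primitive, hence oriented and additive by construction. *)
Definition integ g (a b : R) : C :=
  let G := xget (fun=> 0) [set G | forall t, rder G t (g t)] in G b - G a.

Lemma integP g : rcont g -> exists2 G, (forall t, rder G t (g t)) &
  forall a b, integ g a b = G b - G a.
Proof.
move=> /primitive[G hG]; exists (xget (fun=> 0) [set G | forall t, rder G t (g t)]) => //.
exact: (xgetI (fun=> 0) (hG : [set G | forall t, rder G t (g t)] G)).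
Qed.

Lemma integ_FTC g G a b : rcont g -> a <= b -> (forall t, a <= t <= b -> rder G t (g t)) ->
  integ g a b = G b - G a.
Proof.
move=> /integP[H hH ->] ab hG.
suff : H b - G b = H a - G a by move=> h; rewrite -[H b](subrK (G b)) h; ring.
apply: (@rder0_const (fun t => H t - G t)) => // t ht.
by rewrite -(subrr (g t)); apply: rderB; [apply: hH|apply: hG].
Qed.

Lemma integ_le g a b m : rcont g -> a <= b -> (forall t, a <= t <= b -> nrm (g t) <= m) ->
  nrm (integ g a b) <= m * (b - a).
Proof.
by move=> /integP[H hH ->] ab; apply: rder_nrm_le.
Qed.

Lemma integ_Im_ge g a b m : rcont g -> a <= b ->
  (forall t, a <= t <= b -> m <= complex.Im (g t)) -> m * (b - a) <= complex.Im (integ g a b).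
Proof.
move=> /integP[H hH ->] ab hm.
have iE (z : C) : complex.Re ('i%C * z) = - complex.Im z by case: z => x y /=; ring.
have := @rder_Re_le H g a b 'i%C (- m) ab (fun t _ => hH t); rewrite iE => h.
suff : - complex.Im (H b - H a) <= - m * (b - a) by lra.
by apply: h => t /hm; rewrite iE; lra.
Qed.

Lemma integD g h a b : rcont g -> rcont h -> a <= b ->
  integ (fun t => g t + h t) a b = integ g a b + integ h a b.
Proof.
move=> cg ch ab; have [G hG ->] := integP cg; have [H hH ->] := integP ch.
rewrite (@integ_FTC _ (fun t => G t + H t)) //; first by ring.
  move=> t e e0; have e2 : 0 < e / 2 by lra.
  have [d1 d10 h1] := cg t _ e2; have [d2 d20 h2] := ch t _ e2.
  exists (Num.min d1 d2) => [|s]; rewrite lt_min ?d10 // => /andP[/h1 k1 /h2 k2].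
  by rewrite opprD addrACA; apply: le_lt_trans (nrmD _ _) _; lra.
by move=> t _; apply: rderD.
Qed.

Lemma integZ c g a b : rcont g -> a <= b ->
  integ (fun t => c * g t) a b = c * integ g a b.
Proof.
move=> cg ab; have [G hG ->] := integP cg.
rewrite (@integ_FTC _ (fun t => c * G t)) //; first by ring.
  move=> t e e0; have l0 : 0 < nrm c + 1 by have := nrm_ge0 c; lra.
  have e2 : 0 < e / (nrm c + 1) by rewrite divr_gt0.
  have [d d0 h1] := cg t _ e2; exists d => // s /h1.
  rewrite -mulrBr nrmM ltr_pdivlMr // => h; apply: le_lt_trans h.
  by rewrite mulrC ler_wpM2l ?nrm_ge0 //; lra.
by move=> t _; apply: rderZ.
Qed.

End LineIntegral.

(** * Goursat's theorem *)

Section Rectangles.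
Variable R : realType.
Local Notation C := R[i].
Implicit Types (F G : C -> C) (w z : C).

(** The factor [1] puts the segment in the form [p + s * v] of [rder_line] and [rcont_line]. *)
Definition hseg F (y a b : R) : C := integ (fun s => F ('i%C * y%:K + s%:K * 1)) a b.
Definition vseg F (x a b : R) : C := 'i%C * integ (fun s => F (x%:K + s%:K * 'i%C)) a b.
Definition rect F (x1 x2 y1 y2 : R) : C :=
  hseg F y1 x1 x2 + vseg F x2 y1 y2 - hseg F y2 x1 x2 - vseg F x1 y1 y2.

(** The full lines carrying the sides, not the sides alone: [integ] is specified for integrands
    continuous on all of [R]. *)
Definition on_lines (x1 x2 y1 y2 : R) w :=
  [\/ complex.Re w = x1, complex.Re w = x2, complex.Im w = y1 | complex.Im w = y2].
Definition in_rect (x1 x2 y1 y2 : R) w :=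
  x1 <= complex.Re w <= x2 /\ y1 <= complex.Im w <= y2.

Lemma Re_h (y s : R) : complex.Re ('i%C * y%:K + s%:K * 1) = s. Proof. by rewrite /=; ring. Qed.
Lemma Im_h (y s : R) : complex.Im ('i%C * y%:K + s%:K * 1) = y. Proof. by rewrite /=; ring. Qed.
Lemma Re_v (x s : R) : complex.Re (x%:K + s%:K * 'i%C) = x. Proof. by rewrite /=; ring. Qed.
Lemma Im_v (x s : R) : complex.Im (x%:K + s%:K * 'i%C) = s. Proof. by rewrite /=; ring. Qed.

Lemma rect_splitx F x1 x x2 y1 y2 : rect F x1 x2 y1 y2 = rect F x1 x y1 y2 + rect F x x2 y1 y2.
Proof. by rewrite /rect /hseg /vseg /integ /=; ring. Qed.

Lemma rect_splity F x1 x2 y1 y y2 : rect F x1 x2 y1 y2 = rect F x1 x2 y1 y + rect F x1 x2 y y2.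
Proof. by rewrite /rect /hseg /vseg /integ /=; ring. Qed.

Lemma rect_swapx F x1 x2 y1 y2 : rect F x2 x1 y1 y2 = - rect F x1 x2 y1 y2.
Proof. by rewrite /rect /hseg /vseg /integ /=; ring. Qed.

Lemma rect_swapy F x1 x2 y1 y2 : rect F x1 x2 y2 y1 = - rect F x1 x2 y1 y2.
Proof. by rewrite /rect /hseg /vseg /integ /=; ring. Qed.

Section FixedRectangle.
Variables x1 x2 y1 y2 : R.
Hypotheses (hx : x1 <= x2) (hy : y1 <= y2).
Let onl := on_lines x1 x2 y1 y2.
Let inr := in_rect x1 x2 y1 y2.

Lemma onl_rcont F : (forall w, onl w -> cont F w) ->
  [/\ rcont (fun s => F ('i%C * y1%:K + s%:K * 1)), rcont (fun s => F ('i%C * y2%:K + s%:K * 1)),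
      rcont (fun s => F (x1%:K + s%:K * 'i%C)) & rcont (fun s => F (x2%:K + s%:K * 'i%C))].
Proof.
move=> cF; split; apply: rcont_line => t; apply: cF.
- by apply: Or43; rewrite Im_h.
- by apply: Or44; rewrite Im_h.
- by apply: Or41; rewrite Re_v.
- by apply: Or42; rewrite Re_v.
Qed.

Lemma rectD F G : (forall w, onl w -> cont F w) -> (forall w, onl w -> cont G w) ->
  rect (fun w => F w + G w) x1 x2 y1 y2 = rect F x1 x2 y1 y2 + rect G x1 x2 y1 y2.
Proof.
move=> /onl_rcont[a1 a2 a3 a4] /onl_rcont[b1 b2 b3 b4].
by rewrite /rect /hseg /vseg !integD //; ring.
Qed.

Lemma rectZ c F : (forall w, onl w -> cont F w) ->
  rect (fun w => c * F w) x1 x2 y1 y2 = c * rect F x1 x2 y1 y2.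
Proof.
move=> /onl_rcont[a1 a2 a3 a4].
by rewrite /rect /hseg /vseg !integZ //; ring.
Qed.

Lemma onl_inr : [/\ (forall s, x1 <= s <= x2 -> onl ('i%C * y1%:K + s%:K * 1) /\ inr ('i%C * y1%:K + s%:K * 1)),
  (forall s, x1 <= s <= x2 -> onl ('i%C * y2%:K + s%:K * 1) /\ inr ('i%C * y2%:K + s%:K * 1)),
  (forall s, y1 <= s <= y2 -> onl (x1%:K + s%:K * 'i%C) /\ inr (x1%:K + s%:K * 'i%C)) &
  (forall s, y1 <= s <= y2 -> onl (x2%:K + s%:K * 'i%C) /\ inr (x2%:K + s%:K * 'i%C))].
Proof.
split=> s hs; rewrite /onl /inr /on_lines /in_rect ?Re_h ?Im_h ?Re_v ?Im_v ?lexx ?hx ?hy ?hs.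
- by split=> //; apply: Or43.
- by split=> //; apply: Or44.
- by split=> //; apply: Or41.
- by split=> //; apply: Or42.
Qed.

Lemma rect_le F M : (forall w, onl w -> cont F w) ->
  (forall w, onl w -> inr w -> nrm (F w) <= M) ->
  nrm (rect F x1 x2 y1 y2) <= M * (2 * (x2 - x1) + 2 * (y2 - y1)).
Proof.
move=> /onl_rcont[a1 a2 a3 a4] hM; have [b1 b2 b3 b4] := onl_inr.
have k1 := integ_le a1 hx (fun t ht => hM _ (b1 t ht).1 (b1 t ht).2).
have k2 := integ_le a2 hx (fun t ht => hM _ (b2 t ht).1 (b2 t ht).2).
have k3 := integ_le a3 hy (fun t ht => hM _ (b3 t ht).1 (b3 t ht).2).
have k4 := integ_le a4 hy (fun t ht => hM _ (b4 t ht).1 (b4 t ht).2).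
rewrite /rect /hseg /vseg; apply: le_trans (nrmB _ _) _.
have := nrmB (integ (fun s => F ('i%C * y1%:K + s%:K * 1)) x1 x2 +
  'i%C * integ (fun s => F (x2%:K + s%:K * 'i%C)) y1 y2)
  (integ (fun s => F ('i%C * y2%:K + s%:K * 1)) x1 x2).
have := nrmD (integ (fun s => F ('i%C * y1%:K + s%:K * 1)) x1 x2)
  ('i%C * integ (fun s => F (x2%:K + s%:K * 'i%C)) y1 y2).
rewrite !nrmM !nrmi !mul1r; lra.
Qed.

Lemma rect_FTC F G : (forall w, onl w -> cont F w) ->
  (forall w, onl w -> inr w -> cder G w (F w)) -> rect F x1 x2 y1 y2 = 0.
Proof.
move=> /onl_rcont[a1 a2 a3 a4] hG; have [b1 b2 b3 b4] := onl_inr.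
have hh y : rcont (fun s => F ('i%C * y%:K + s%:K * 1)) ->
   (forall s, x1 <= s <= x2 -> onl ('i%C * y%:K + s%:K * 1) /\ inr ('i%C * y%:K + s%:K * 1)) ->
   hseg F y x1 x2 = G (x2%:K + 'i%C * y%:K) - G (x1%:K + 'i%C * y%:K).
  move=> a b; rewrite /hseg (integ_FTC (G := fun s => G ('i%C * y%:K + s%:K * 1)) a hx).
    by rewrite !mulr1 ![_ * y%:K + _]addrC.
  by move=> t ht; rewrite -[F _]mul1r; apply/rder_line/hG; have [] := b t ht.
have vv x : rcont (fun s => F (x%:K + s%:K * 'i%C)) ->
   (forall s, y1 <= s <= y2 -> onl (x%:K + s%:K * 'i%C) /\ inr (x%:K + s%:K * 'i%C)) ->
   vseg F x y1 y2 = G (x%:K + 'i%C * y2%:K) - G (x%:K + 'i%C * y1%:K).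
  move=> a b; rewrite /vseg -integZ // (integ_FTC (G := fun s => G (x%:K + s%:K * 'i%C)) _ hy).
  - by rewrite ![_ * 'i%C]mulrC.
  - move=> t e e0; have [d d0 h] := a t e e0; exists d => // s /h.
    by rewrite -mulrBr nrmM nrmi mul1r.
  by move=> t ht; apply/rder_line/hG; have [] := b t ht.
rewrite /rect !hh // !vv //; ring.
Qed.

Lemma rect_ext F G : (forall w, onl w -> cont F w) -> (forall w, onl w -> cont G w) ->
  (forall w, onl w -> inr w -> F w = G w) -> rect F x1 x2 y1 y2 = rect G x1 x2 y1 y2.
Proof.
move=> cF cG FG; have cG' w : onl w -> cont (fun w => -1 * G w) w.
  by move=> /cG; apply: contM; apply: cont_cst.
apply/subr0_eq; rewrite -mulN1r -rectZ // -rectD //; apply: nrm_small => e e0.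
apply: le_trans (ltW e0); rewrite -[leRHS](mul0r (2 * (x2 - x1) + 2 * (y2 - y1))).
apply: rect_le => w hw; first by apply: contD; [apply: cF|apply: cG'].
by move=> /(FG w hw) ->; rewrite mulN1r subrr nrm0.
Qed.

End FixedRectangle.

Lemma dist_in_rect a b c d p w : in_rect a b c d p -> in_rect a b c d w ->
  nrm (w - p) <= (b - a) + (d - c).
Proof.
move=> [/andP[h1 h2] /andP[h3 h4]] [/andP[k1 k2] /andP[k3 k4]].
apply: le_trans (nrm_le_ReIm _) _; rewrite !raddfB /=.
by apply: lerD; rewrite ler_norml; lra.
Qed.

(** The bound [e * S^2], with [S] the half perimeter, passes from the four quarters to the whole
    because each quarter has half the value of [S]. Locally [F] is an affine function, whose
    integral vanishes since it has a primitive, plus an error of at most [e / 2 * S] on a contour of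
    length [2 * S]. *)
Lemma goursat F x1 x2 y1 y2 : x1 <= x2 -> y1 <= y2 -> (forall w, cont F w) ->
  (forall w, in_rect x1 x2 y1 y2 w -> exists c, cder F w c) -> rect F x1 x2 y1 y2 = 0.
Proof.
move=> hx hy cF dF; apply: nrm_small => e0 e00.
pose S := (x2 - x1) + (y2 - y1).
have [e e_gt0 he] : exists2 e : R, 0 < e & e * S ^+ 2 <= e0.
  have S2 : 0 <= S ^+ 2 by apply: sqr_ge0.
  exists (e0 / (S ^+ 2 + 1)); first by rewrite divr_gt0 //; lra.
  by rewrite mulrAC ler_pdivrMr ?ler_wpM2l ?(ltW e00) //; lra.
suff : nrm (rect F x1 x2 y1 y2) <= e * S ^+ 2 by move=> h; apply: le_trans h he.
rewrite /S; clear S he.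
apply: (@bisection R (fun a b c d => nrm (rect F a b c d) <= e * ((b - a) + (d - c)) ^+ 2)) => //.
  move=> a b c d ab cd h1 h2 h3 h4.
  rewrite (rect_splitx F a ((a + b) / 2)) !(rect_splity F _ _ c ((c + d) / 2) d).
  apply: le_trans (nrmD _ _) _.
  apply: le_trans (lerD (nrmD _ _) (nrmD _ _)) _.
  apply: le_trans (lerD (lerD h1 h2) (lerD h3 h4)) _.
  have -> : e * (b - a + (d - c)) ^+ 2 = e * ((b - a + (d - c)) / 2) ^+ 2 * 4 by field.
  have -> : (a + b) / 2 - a + ((c + d) / 2 - c) = (b - a + (d - c)) / 2 by field.
  have -> : (a + b) / 2 - a + (d - (c + d) / 2) = (b - a + (d - c)) / 2 by field.
  have -> : b - (a + b) / 2 + ((c + d) / 2 - c) = (b - a + (d - c)) / 2 by field.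
  have -> : b - (a + b) / 2 + (d - (c + d) / 2) = (b - a + (d - c)) / 2 by field.
  lra.
move=> p q hp hq; pose z : C := p%:K + q%:K * 'i%C.
have hz : in_rect x1 x2 y1 y2 z by split; rewrite ?Re_v ?Im_v.
have [c0 hc0] := dF z hz.
have e2 : 0 < e / 2 by lra.
have /cderP/(_ _ e2)[d0 d00 hd0] := hc0.
exists (d0 / 2) => [|a b c d ax ap pb bx cy cq qd dy ba dc]; first lra.
have ab : a <= b by lra. have cd : c <= d by lra.
have zin : in_rect a b c d z by split; rewrite ?Re_v ?Im_v; lra.
pose L w := F z + c0 * (w - z).
have cL w : cont L w.
  by apply: contD; [apply: cont_cst|apply: contM; [apply: cont_cst|apply: contB;
   [apply: cont_id|apply: cont_cst]]].
have dL w : cder (fun w => F z * w + c0 / 2 * (w - z) ^+ 2) w (L w).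
  have h1 := cderZ (F z) (cder_id w).
  have h2 : cder (fun w => w - z) w 1 by rewrite -[1]subr0; apply: cderB (cder_id w) (cder_cst z w).
  have h3 := cderZ (c0 / 2) (cder_comp h2 (cderXn 2 (w - z))).
  by apply: cder_eq (cderDD h1 h3) _; rewrite /L /= expr1; field.
have -> : rect F a b c d = rect (fun w => F w + -1 * L w) a b c d.
  rewrite rectD // ?rectZ //.
    by rewrite (@rect_FTC a b c d ab cd L _ (fun w _ => cL w) (fun w _ _ => dL w)) mulr0 addr0.
  by move=> w _; apply: contM => //; apply: cont_cst.
pose s := (b - a) + (d - c).
have : nrm (rect (fun w => F w + -1 * L w) a b c d) <= e / 2 * s * (2 * (b - a) + 2 * (d - c)).
  apply: rect_le => // [w _|w _ hw].
    by apply: contD => //; apply: contM => //; apply: cont_cst.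
  have hs := dist_in_rect zin hw.
  have := hd0 w; move=> /(_ ltac:(lra)) h.
  have -> : F w + -1 * L w = F w - F z - c0 * (w - z) by rewrite /L; ring.
  by apply: le_trans h _; rewrite ler_wpM2l // ltW.
move=> h; apply: le_trans h _.
have -> : 2 * (b - a) + 2 * (d - c) = 2 * s by rewrite /s; ring.
by rewrite -/s expr2; lra.
Qed.

(** Four rectangles around a small central square avoid [z] and contribute nothing. The square has
    perimeter [8 * t], and continuity at [z] bounds [F] on it by [M]. *)
Lemma goursat_punctured F x1 x2 y1 y2 z :
  x1 < complex.Re z < x2 -> y1 < complex.Im z < y2 -> (forall w, cont F w) ->
  (forall w, in_rect x1 x2 y1 y2 w -> w != z -> exists c, cder F w c) ->
  rect F x1 x2 y1 y2 = 0.
Proof.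
move=> /andP[xz zx] /andP[yz zy] cF dF; apply: nrm_small => e e0.
have [d d0 hd] := cF z 1 ltr01.
pose M := nrm (F z) + 1; have M0 : 0 < M by rewrite /M; have := nrm_ge0 (F z); lra.
set a := complex.Re z in xz zx *; set b := complex.Im z in yz zy *.
have [t [t0 [ta tb] [tc td] [tde tee]]] : exists t : R, [/\ 0 < t, x1 <= a - t /\ a + t <= x2,
    y1 <= b - t /\ b + t <= y2 & 4 * t < d /\ M * (8 * t) <= e].
  pose t := Num.min (Num.min (a - x1) (x2 - a)) (Num.min (Num.min (b - y1) (y2 - b))
     (Num.min (d / 5) (e / (M * 8)))).
  have t0 : 0 < t by rewrite !lt_min !subr_gt0 xz zx yz zy !divr_gt0 // mulr_gt0.
  exists t; have : t <= t by []; rewrite {2}/t !le_min.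
  case/andP => /andP[h1 h2] /andP[/andP[h3 h4] /andP[h5 h6]].
  split=> //; split; try lra.
  by move: h6; rewrite ler_pdivlMr ?mulr_gt0 //; lra.
have G u1 u2 v1 v2 : u1 <= u2 -> v1 <= v2 -> x1 <= u1 -> u2 <= x2 -> y1 <= v1 -> v2 <= y2 ->
   [\/ u2 < a, a < u1, v2 < b | b < v1] -> rect F u1 u2 v1 v2 = 0.
  move=> hu hv k1 k2 k3 k4 k5; apply: goursat => // w [/andP[w1 w2] /andP[w3 w4]].
  apply: dF; first by split; lra.
  apply: contraPneq k5 => wz; rewrite -[a]/(complex.Re z) -[b]/(complex.Im z) -wz.
  by case; lra.
rewrite (rect_splitx F x1 (a - t)) (rect_splitx F (a - t) (a + t)).
rewrite (rect_splity F (a - t) (a + t) y1 (b - t)) (rect_splity F _ _ (b - t) (b + t)).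
rewrite (G x1 (a - t)); [|try lra..]; last by apply: Or41; lra.
rewrite (G (a + t) x2); [|try lra..]; last by apply: Or42; lra.
rewrite (G (a - t) (a + t) y1 (b - t)); [|try lra..]; last by apply: Or43; lra.
rewrite (G (a - t) (a + t) (b + t) y2); [|try lra..]; last by apply: Or44; lra.
rewrite add0r addr0 add0r addr0.
have : nrm (rect F (a - t) (a + t) (b - t) (b + t)) <=
    M * (2 * (a + t - (a - t)) + 2 * (b + t - (b - t))).
  apply: rect_le; [lra|lra|by []|] => w _ hw.
  have zin : in_rect (a - t) (a + t) (b - t) (b + t) z by split; lra.
  have := hd w; have := dist_in_rect zin hw => h1 /(_ ltac:(lra)).
  have := nrm_triB (F w) (F z); rewrite /M; lra.
lra.
Qed.

End Rectangles.

(** * Cauchy's formula and Taylor expansions *)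

Section CauchyTaylor.
Variable R : realType.
Local Notation C := R[i].
Implicit Types (F f : C -> C) (w z p : C).

Lemma geo_small (q K e : R) : 0 <= q -> q < 1 -> 0 < e ->
  exists N0, forall N, (N0 <= N)%N -> K * q ^+ N < e.
Proof.
move=> q0 q1 e0.
have h : (fun N => K * q ^+ N) @ \oo --> K * 0.
  by apply: cvgM; [apply: cvg_cst|apply: cvg_expr; rewrite ger0_norm].
have /cvgrPdist_lt/(_ e e0)[N0 _ hN] := h.
exists N0 => N NN; have := hN N NN; rewrite mulr0 sub0r normrN.
by apply: le_lt_trans; apply: ler_norm.
Qed.

Lemma cder_subc z w : cder (fun u => u - z) w 1.
Proof. by rewrite -[1]subr0; apply: cderB (cder_id w) (cder_cst z w). Qed.

Definition cint F (r : R) : C := rect F (- r) r (- r) r.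

Lemma eq_cint F G (r : R) : (forall w, F w = G w) -> cint F r = cint G r.
Proof. by move=> /funext ->. Qed.

Section Square.
Variables (r : R) (r0 : 0 < r).

Let rr : - r <= r. Proof. by move: r0 => hr; lra. Qed.
Let onl := on_lines (- r) r (- r) r.
Let inr := in_rect (- r) r (- r) r.

Lemma onl_ge w : onl w -> r <= nrm w.
Proof.
have h (x : R) : x = - r \/ x = r -> `|x| = r.
  by case=> ->; rewrite ?normrN gtr0_norm.
case=> h1; [apply: le_trans _ (Re_le_nrm w)|apply: le_trans _ (Re_le_nrm w)|
  apply: le_trans _ (Im_le_nrm w)|apply: le_trans _ (Im_le_nrm w)];
  by rewrite h //; auto.
Qed.

Lemma onl_far w z : onl w -> nrm z < r -> r - nrm z <= nrm (w - z).
Proof. have hr := r0. by move=> /onl_ge h1 h2; have := nrm_triB w z; lra. Qed.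

Lemma onl_neq w z : onl w -> nrm z < r -> w - z != 0.
Proof. have hr := r0. by move=> h1 h2; rewrite -nrm_gt0; have := onl_far h1 h2; lra. Qed.

Lemma onl_neq0 w : onl w -> w != 0.
Proof. have hr := r0. by move=> h1; rewrite -nrm_gt0; have := onl_ge h1; lra. Qed.

Lemma cont_inv_pow z n w : onl w -> nrm z < r -> cont (fun w => (w ^+ n * (w - z))^-1) w.
Proof.
move=> h1 h2; apply: contV.
  apply: contM; first exact/contX/cont_id.
  by apply: contB; [apply: cont_id|apply: cont_cst].
by rewrite mulf_neq0 ?expf_neq0 ?(onl_neq0 h1) ?(onl_neq h1 h2).
Qed.

Lemma cont_invX n w : onl w -> cont (fun w => (w ^+ n)^-1) w.
Proof.
by move=> h1; apply: contV; [exact/contX/cont_id|rewrite expf_neq0 ?(onl_neq0 h1)].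
Qed.

(** The finite geometric series of [1 / (w - z)] in powers of [z / w]. Keeping the remainder as an
    integral avoids any interchange of limit and integral. *)
Lemma cint_remainder F z N : (forall w, onl w -> cont F w) -> nrm z < r ->
  cint (fun w => F w * (w - z)^-1) r =
  \sum_(k < N) z ^+ k * cint (fun w => F w * (w ^+ k.+1)^-1) r +
  z ^+ N * cint (fun w => F w * (w ^+ N * (w - z))^-1) r.
Proof.
move=> cF hz; elim: N => [|N IH].
  rewrite big_ord0 add0r expr0 mul1r; apply: eq_cint => w.
  by rewrite expr0 mul1r.
rewrite IH big_ord_recr /= -addrA; congr (_ + _).
have cA w : onl w -> cont (fun w => F w * (w ^+ N.+1)^-1) w.
  by move=> hw; apply: contM; [apply: cF|apply: cont_invX].
have cB w : onl w -> cont (fun w => F w * (w ^+ N.+1 * (w - z))^-1) w.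
  by move=> hw; apply: contM; [apply: cF|apply: cont_inv_pow].
have cB' w : onl w -> cont (fun w => z * (F w * (w ^+ N.+1 * (w - z))^-1)) w.
  by move=> hw; apply: contM; [apply: cont_cst|apply: cB].
rewrite exprSr -mulrA -mulrDr; congr (_ * _).
rewrite /cint -rectZ // -rectD //; apply: rect_ext => // w hw.
- by apply: contM; [apply: cF|apply: cont_inv_pow].
- by apply: contD; [apply: cA|apply: cB'].
move=> _; rewrite exprSr; have w0 := onl_neq0 hw; have wz := onl_neq hw hz.
have wN : w ^+ N != 0 by rewrite expf_neq0.
by field; rewrite w0 wz.
Qed.

Lemma cint_remainder_le F z N M : (forall w, onl w -> cont F w) -> nrm z < r ->
  (forall w, onl w -> inr w -> nrm (F w) <= M) ->
  nrm (z ^+ N * cint (fun w => F w * (w ^+ N * (w - z))^-1) r) <=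
  8 * M * (nrm z / r) ^+ N * (r / (r - nrm z)).
Proof. have hr := r0.
move=> cF hz hM; have z0 := nrm_ge0 z.
have rz : 0 < r - nrm z by lra.
have rN : 0 < r ^+ N by rewrite exprn_gt0.
have zN : 0 <= nrm z ^+ N by rewrite exprn_ge0.
have : nrm (cint (fun w => F w * (w ^+ N * (w - z))^-1) r) <=
    M / (r ^+ N * (r - nrm z)) * (2 * (r - - r) + 2 * (r - - r)).
  apply: rect_le => // w hw.
    by apply: contM; [apply: cF|apply: cont_inv_pow].
  move=> hi; rewrite nrmM nrmV nrmM nrmX.
  have h0 := hM w hw hi; have M0 := le_trans (nrm_ge0 _) h0.
  apply: ler_pM => //; rewrite ?nrm_ge0 ?invr_ge0 ?mulr_ge0 ?exprn_ge0 ?nrm_ge0 //.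
  rewrite lef_pV2 ?posrE ?mulr_gt0 //.
  - apply: ler_pM; rewrite ?(ltW rN) ?(ltW rz) ?onl_far //.
    by rewrite lerXn2r ?nnegrE ?nrm_ge0 ?(ltW r0) ?onl_ge.
  - by rewrite exprn_gt0 // nrm_gt0 onl_neq0.
  - by rewrite nrm_gt0 onl_neq.
move=> h; rewrite nrmM nrmX; apply: le_trans (ler_wpM2l zN h) _.
rewrite le_eqVlt; apply/orP; left; apply/eqP; rewrite expr_div_n; field.
by rewrite !gt_eqF.
Qed.

Definition kappa : C := cint (fun w => w^-1) r.

(* [kappa] is [2 i pi], but only a lower bound is needed: each side contributes at least [1]. *)
Lemma kappa_ge : 4 <= nrm kappa.
Proof. have hr := r0.
suff h : 4 <= complex.Im kappa by apply: le_trans h (le_trans (ler_norm _) (Im_le_nrm _)).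
have cV w : onl w -> cont (fun w => w^-1) w.
  by move=> hw; apply: contV; [apply: cont_id|apply: onl_neq0].
have [c1 c2 c3 c4] := onl_rcont cV.
have ImV w : complex.Im w^-1 = - complex.Im w / (complex.Re w ^+ 2 + complex.Im w ^+ 2).
  by case: w => a b /=; rewrite mulNr.
have ReV w : complex.Re w^-1 = complex.Re w / (complex.Re w ^+ 2 + complex.Im w ^+ 2).
  by case: w.
have main (x : R) : - r <= x <= r -> (2 * r)^-1 <= r / (r ^+ 2 + x ^+ 2).
  move=> hx; have r2 : 0 < r ^+ 2 by rewrite exprn_gt0.
  have x2 : 0 <= x ^+ 2 by rewrite sqr_ge0.
  have xr : x ^+ 2 <= r ^+ 2 by rewrite !expr2; nra.
  rewrite ler_pdivlMr; last lra.
  rewrite ler_pdivrMl; last lra.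
  by move: xr; rewrite !expr2; lra.
have E : (2 * r)^-1 * (r - - r) = 1 by field; rewrite gt_eqF.
have ImJ (z : C) : complex.Im ('i%C * z) = complex.Re z by case: z => a b /=; ring.
have ImN (z : C) : complex.Im (-1 * z) = - complex.Im z by case: z => a b /=; ring.
have cm (c : C) (g : R -> C) : rcont g -> rcont (fun t => c * g t).
  move=> cg t e e0; have l0 : 0 < nrm c + 1 by have := nrm_ge0 c; lra.
  have e2 : 0 < e / (nrm c + 1) by rewrite divr_gt0.
  have [d d0 h1] := cg t _ e2; exists d => // s /h1.
  rewrite -mulrBr nrmM ltr_pdivlMr // => h; apply: le_lt_trans h.
  by rewrite mulrC ler_wpM2l ?nrm_ge0 //; lra.
have k1 := integ_Im_ge c1 rr (m := (2 * r)^-1).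
have k2 := integ_Im_ge (cm (-1) _ c2) rr (m := (2 * r)^-1).
have k3 := integ_Im_ge (cm (- 'i%C) _ c3) rr (m := (2 * r)^-1).
have k4 := integ_Im_ge (cm 'i%C _ c4) rr (m := (2 * r)^-1).
rewrite E !integZ // in k1 k2 k3 k4.
have {}k1 : 1 <= complex.Im (integ (fun t => ('i%C * (- r)%:K + t%:K * 1)^-1) (- r) r).
  by apply: k1 => t ht; rewrite ImV Re_h Im_h opprK sqrrN [_ + r ^+ 2]addrC; apply: main.
have {}k2 : 1 <= complex.Im (-1 * integ (fun t => ('i%C * r%:K + t%:K * 1)^-1) (- r) r).
  by apply: k2 => t ht; rewrite ImN ImV Re_h Im_h mulNr opprK [_ + r ^+ 2]addrC; apply: main.
have {}k3 : 1 <= complex.Im (- 'i%C * integ (fun t => ((- r)%:K + t%:K * 'i%C)^-1) (- r) r).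
  apply: k3 => t ht; rewrite mulNr -mulN1r ImN ImJ ReV Re_v Im_v.
  by rewrite mulNr opprK sqrrN; apply: main.
have {}k4 : 1 <= complex.Im ('i%C * integ (fun t => (r%:K + t%:K * 'i%C)^-1) (- r) r).
  by apply: k4 => t ht; rewrite ImJ ReV Re_v Im_v; apply: main.
have ImB (y z : C) : complex.Im (y - z) = complex.Im y - complex.Im z by rewrite raddfB.
have ImD (y z : C) : complex.Im (y + z) = complex.Im y + complex.Im z by rewrite raddfD.
rewrite /kappa /cint /rect /hseg /vseg ImB (ImB (_ + _)) ImD.
rewrite ImN in k2; rewrite mulNr -mulN1r ImN in k3.
move: k1 k2 k3 k4; rewrite !ImJ; lra.
Qed.

Lemma kappa_neq0 : kappa != 0.
Proof. have hr := r0. by rewrite -nrm_gt0; have := kappa_ge; lra. Qed.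

Lemma cint_invX k : cint (fun w => 1 * (w ^+ k.+2)^-1) r = 0.
Proof.
apply: (rect_FTC rr rr (G := fun w => - (k.+1%:R)^-1 * (w ^+ k.+1)^-1)) => w hw.
  by apply: contM; [apply: cont_cst|apply: cont_invX].
move=> _; have w0 := onl_neq0 hw; have wX : w ^+ k != 0 by rewrite expf_neq0.
apply: cder_eq (cderZ _ (cderV (cderXn k.+1 w) _)) _; first by rewrite expf_neq0.
rewrite /= !exprS; field; rewrite w0 wX /=.
by rewrite -(natrD _ 1%N) pnatr_eq0.
Qed.

(** In the expansion of the constant function [1], every power [w^-k] with [k >= 2] has a primitive
    and integrates to [0]; only [w^-1] survives, and the remainder tends to [0]. *)
Lemma cint_pole z : nrm z < r -> cint (fun w => 1 * (w - z)^-1) r = kappa.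
Proof.
move=> hz; have c1 w : onl w -> cont (fun=> 1 : C) w by move=> _; apply: cont_cst.
have q0 : 0 <= nrm z / r by rewrite divr_ge0 ?nrm_ge0 ?ltW.
have q1 : nrm z / r < 1 by rewrite ltr_pdivrMr // mul1r.
apply/subr0_eq/nrm_small => e e0.
have [N0 h] := geo_small (8 * 1 * (r / (r - nrm z))) q0 q1 e0.
rewrite (cint_remainder N0.+1 c1 hz).
rewrite big_ord_recl /= big1 => [|k _]; last by rewrite cint_invX mulr0.
rewrite expr0 mul1r addr0 [X in nrm (X + _ - _)](_ : _ = kappa); last first.
  by apply: eq_cint => w; rewrite mul1r expr1.
rewrite [X in nrm (X - _)]addrC addrK.
apply: le_trans (cint_remainder_le N0.+1 (M := 1) c1 hz _) _.
  by move=> w _ _; rewrite nrm1.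
by rewrite mulrAC ltW // h.
Qed.

(** The difference quotient of [F] at [z] extends continuously to [z], by Caratheodory's form, and
    is differentiable elsewhere on the square. Its integral vanishes by the punctured theorem, and
    the remaining term is the pole integral. *)
Lemma cauchy_formula F z : (forall w, cont F w) ->
  (forall w, inr w -> exists c, cder F w c) -> nrm z < r ->
  cint (fun w => F w * (w - z)^-1) r = F z * kappa.
Proof. have hr := r0.
move=> cF dF hz.
have hR := le_lt_trans (Re_le_nrm z) hz; have hI := le_lt_trans (Im_le_nrm z) hz.
move: hR hI; rewrite !ltr_norml => hR hI.
have [c hc] : exists c, cder F z c.
  by apply: dF; split; lra.
have [psi [cpsi pz hpsi]] := hc.
pose g w := if w == z then psi z else (F w - F z) * (w - z)^-1.
have gpsi w : g w = psi w.
  rewrite /g; case: eqP => [->//|/eqP wz]; rewrite hpsi mulfK //.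
  by rewrite subr_eq0.
have gE w : w != z -> near_pt w (fun u => (F u - F z) * (u - z)^-1 = g u).
  move=> wz; exists (nrm (w - z)); first by rewrite nrm_gt0 subr_eq0.
  by move=> u; rewrite /g; case: eqP => // ->; rewrite nrmBC ltxx.
have cg w : cont g w.
  have [->|wz] := eqVneq w z.
    by apply: cont_near cpsi; exists 1 => // u _; rewrite gpsi.
  apply: cont_near (gE w wz) _; apply: contM.
    by apply: contB => //; apply: cont_cst.
  by apply: contV; [apply: contB; [apply: cont_id|apply: cont_cst]|rewrite subr_eq0].
have G0 : cint g r = 0.
  apply: (goursat_punctured (z := z)) => // w hw wz; have [d hd] := dF w hw.
  have wz0 : w - z != 0 by rewrite subr_eq0.
  eexists; apply: cder_near (gE w wz) _; apply: cderM.
    exact: cderB hd (cder_cst _ _).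
  exact: (cderV (cder_subc z w) wz0).
have cK w : onl w -> cont (fun w => 1 * (w - z)^-1) w.
  move=> hw; apply: contM; first exact: cont_cst.
  by apply: contV; [apply: contB; [apply: cont_id|apply: cont_cst]|apply: onl_neq].
have cK2 w : onl w -> cont (fun w => F z * (1 * (w - z)^-1)) w.
  by move=> hw; apply: contM; [apply: cont_cst|apply: cK].
rewrite -(cint_pole hz) /cint -rectZ // -[RHS]add0r -[X in X + _]G0 /cint -rectD //.
apply: rect_ext => // w hw.
- by apply: contM => //; apply: contV; [apply: contB; [apply: cont_id|apply: cont_cst]|apply: onl_neq].
- by apply: contD => //; apply: cK2.
move=> _; rewrite /g; case: eqP => [wz|_]; last by ring.
by have := onl_neq hw hz; rewrite wz subrr eqxx.
Qed.

(** The constant [2 * M] is [8 * M], coming from the perimeter [8 * r], divided by the lower bound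
    [4] for the modulus of [kappa]. *)
Lemma taylor_square F M : (forall w, cont F w) ->
  (forall w, inr w -> exists c, cder F w c) -> (forall w, inr w -> nrm (F w) <= M) ->
  exists a : nat -> C, (forall n, nrm (a n) <= 2 * M / r ^+ n) /\
   forall z, nrm z < r -> forall N, nrm (F z - \sum_(k < N) a k * z ^+ k) <=
     2 * M * (nrm z / r) ^+ N * (r / (r - nrm z)).
Proof. have hr := r0.
move=> cF dF hM.
have k0 := kappa_neq0; have kge := kappa_ge.
have nk : nrm kappa^-1 <= 4^-1 by rewrite nrmV lef_pV2 // posrE; lra.
exists (fun k => kappa^-1 * cint (fun w => F w * (w ^+ k.+1)^-1) r); split=> [n|z hz N].
  have rN : 0 < r ^+ n by rewrite exprn_gt0.
  have : nrm (cint (fun w => F w * (w ^+ n.+1)^-1) r) <=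
     M / r ^+ n.+1 * (2 * (r - - r) + 2 * (r - - r)).
    apply: rect_le => // w hw.
      by apply: contM => //; apply: cont_invX.
    move=> hi; rewrite nrmM nrmV nrmX.
    have h0 := hM w hi; have M0 := le_trans (nrm_ge0 _) h0.
    apply: ler_pM => //; rewrite ?nrm_ge0 ?invr_ge0 ?exprn_ge0 ?nrm_ge0 //.
    rewrite lef_pV2 ?posrE ?exprn_gt0 ?nrm_gt0 ?onl_neq0 //.
    by rewrite lerXn2r ?nnegrE ?nrm_ge0 ?(ltW r0) ?onl_ge.
  move=> h; rewrite nrmM; apply: le_trans (ler_pM (nrm_ge0 _) (nrm_ge0 _) nk h) _.
  rewrite le_eqVlt exprS; apply/orP; left; apply/eqP; field.
  by rewrite !gt_eqF.
have -> : F z - \sum_(k < N) kappa^-1 * cint (fun w => F w * (w ^+ k.+1)^-1) r * z ^+ k =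
   kappa^-1 * (z ^+ N * cint (fun w => F w * (w ^+ N * (w - z))^-1) r).
  have := cauchy_formula cF dF hz; rewrite (cint_remainder N (fun w _ => cF w) hz) => h.
  have -> : z ^+ N * cint (fun w => F w * (w ^+ N * (w - z))^-1) r = F z * kappa -
     \sum_(k < N) z ^+ k * cint (fun w => F w * (w ^+ k.+1)^-1) r by rewrite -h addrC addKr.
  rewrite mulrBr mulrCA mulVf // mulr1 mulr_sumr; congr (_ - _).
  by apply: eq_bigr => k _; ring.
have h := cint_remainder_le N (M := M) (fun w _ => cF w) hz (fun w _ => hM w).
rewrite nrmM; apply: le_trans (ler_pM (nrm_ge0 _) (nrm_ge0 _) nk h) _.
rewrite le_eqVlt; apply/orP; left; apply/eqP; field.
by rewrite subr_eq0 gt_eqF // gt_eqF.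
Qed.

Lemma integ_dev g (c : C) (a b m : R) : rcont g ->
  (forall t, a <= t <= b \/ b <= t <= a -> nrm (g t - c) <= m) ->
  nrm (integ g a b - c * (b - a)%:K) <= m * `|b - a|.
Proof.
move=> cg; have [G hG ->] := integP cg.
have main (u v : R) : u <= v -> (forall t, u <= t <= v -> nrm (g t - c) <= m) ->
    nrm (G v - G u - c * (v - u)%:K) <= m * (v - u).
  move=> uv h; have d t : rder (fun s => G s - c * s%:K) t (g t - c).
    apply: rderB => // e e0; exists 1 => // s _.
    by rewrite rmorphB -mulrBr subrr nrm0 mulr_ge0 ?normr_ge0 ?(ltW e0).
  have -> : G v - G u - c * (v - u)%:K = G v - c * v%:K - (G u - c * u%:K).
    by rewrite rmorphB; ring.
  exact: (rder_nrm_le uv (fun t _ => d t) h).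
move=> h; have [ab|/ltW ba] := leP a b.
  by rewrite ger0_norm ?subr_ge0 //; apply: main => // t ht; apply: h; left.
rewrite ler0_norm ?subr_le0 // opprB -nrmN.
have -> : - (G b - G a - c * (b - a)%:K) = G a - G b - c * (a - b)%:K.
  by rewrite !rmorphB; ring.
by apply: main => // t ht; apply: h; right.
Qed.

Lemma rect_oriented0 F x x' y y' : (forall w, cont F w) ->
  (forall w, inr w -> exists c, cder F w c) ->
  - r < x < r -> - r < x' < r -> - r < y < r -> - r < y' < r -> rect F x x' y y' = 0.
Proof.
move=> cF dF.
have ord u u' v v' : - r < u < r -> - r < u' < r -> - r < v < r -> - r < v' < r ->
    u <= u' -> v <= v' -> rect F u u' v v' = 0.
  move=> h1 h2 h3 h4 uu vv; apply: goursat => // w [/andP[w1 w2] /andP[w3 w4]].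
  by apply: dF; split; lra.
have ordx u u' v v' : - r < u < r -> - r < u' < r -> - r < v < r -> - r < v' < r ->
    u <= u' -> rect F u u' v v' = 0.
  move=> h1 h2 h3 h4 uu; have [vv|/ltW vv] := leP v v'; first exact: ord.
  by rewrite rect_swapy ord ?oppr0.
move=> h1 h2 h3 h4; have [xx|/ltW xx] := leP x x'; first exact: ordx.
by rewrite rect_swapx ordx ?oppr0.
Qed.

Lemma primitive_square F : (forall w, cont F w) ->
  (forall w, inr w -> exists c, cder F w c) ->
  exists P, forall z, nrm z < r -> cder P z (F z).
Proof.
move=> cF dF.
pose P z := hseg F 0 0 (complex.Re z) + vseg F (complex.Re z) 0 (complex.Im z).
exists P => z hz; apply/cderP => e e0.
have e2 : 0 < e / 2 by lra.
have [d d0 hd] := cF z _ e2.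
have nz : near_pt z (fun w => nrm w < r).
  have /near_disc : nrm (z - 0) < r by rewrite subr0.
  by apply: near_imp => w; rewrite subr0.
have nd : near_pt z (fun w => nrm (w - z) < d / 2).
  by exists (d / 2) => //; lra.
apply: near_imp (near_and nz nd) => w [wr wd].
set x := complex.Re z; set y := complex.Im z; set x' := complex.Re w; set y' := complex.Im w.
have bd (u : C) : nrm u < r -> - r < complex.Re u < r /\ - r < complex.Im u < r.
  move=> hu; have := le_lt_trans (Re_le_nrm u) hu; have := le_lt_trans (Im_le_nrm u) hu.
  by rewrite !ltr_norml.
have [bx by_] := bd z hz; have [bx' by'] := bd w wr.
have xx : `|x' - x| <= nrm (w - z) by rewrite -raddfB; apply: Re_le_nrm.
have yy : `|y' - y| <= nrm (w - z) by rewrite -raddfB; apply: Im_le_nrm.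
have zr : - r < 0 < r by move: r0 => hr; lra.
(* The two paths from the origin differ from the short path from [z] to [w] by the boundary of a
   rectangle between the heights [0] and [y]. Its corners may come in any order, which
   [rect_oriented0] allows. *)
have PE : P w - P z = hseg F y x x' + vseg F x' y y'.
  apply: subr0_eq; rewrite -[RHS](rect_oriented0 cF dF bx bx' zr by_).
  by rewrite /P /rect /hseg /vseg /integ /= -/x -/y -/x' -/y'; ring.
have wz : w - z = (x' - x)%:K + 'i%C * (y' - y)%:K.
  by rewrite [w]complexE [z]complexE !rmorphB /=; ring.
rewrite PE {1}wz.
have -> : hseg F y x x' + vseg F x' y y' - F z * ((x' - x)%:K + 'i%C * (y' - y)%:K) =
  (hseg F y x x' - F z * (x' - x)%:K) +
  'i%C * (integ (fun s => F (x'%:K + s%:K * 'i%C)) y y' - F z * (y' - y)%:K).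
  by rewrite /vseg; ring.
have zE : z = x%:K + 'i%C * y%:K by rewrite {1}[z]complexE.
apply: le_trans (nrmD _ _) _; rewrite nrmM nrmi mul1r.
have h1 : nrm (hseg F y x x' - F z * (x' - x)%:K) <= e / 2 * `|x' - x|.
  apply: integ_dev => [|t ht]; first by apply: rcont_line.
  apply/ltW/hd; have -> : 'i%C * y%:K + t%:K * 1 - z = (t - x)%:K.
    by rewrite zE rmorphB; ring.
  rewrite nrmK; apply: (@le_lt_trans _ _ `|x' - x|); last lra.
  by case: ht => ht; rewrite ler_norml; have := ler_norm (x' - x);
    have := ler_norm (- (x' - x)); rewrite normrN; lra.
have h2 : nrm (integ (fun s => F (x'%:K + s%:K * 'i%C)) y y' - F z * (y' - y)%:K) <= e / 2 * `|y' - y|.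
  apply: integ_dev => [|t ht]; first by apply: rcont_line.
  apply/ltW/hd; have -> : x'%:K + t%:K * 'i%C - z = (x' - x)%:K + 'i%C * (t - y)%:K.
    by rewrite zE !rmorphB; ring.
  apply: le_lt_trans (nrmD _ _) _; rewrite nrmM nrmi mul1r !nrmK.
  have : `|t - y| <= `|y' - y|; last lra.
  by case: ht => ht; rewrite ler_norml; have := ler_norm (y' - y);
    have := ler_norm (- (y' - y)); rewrite normrN; lra.
have h3 : e / 2 * `|x' - x| <= e / 2 * nrm (w - z) by rewrite ler_wpM2l ?(ltW e2).
have h4 : e / 2 * `|y' - y| <= e / 2 * nrm (w - z) by rewrite ler_wpM2l ?(ltW e2).
lra.
Qed.

End Square.

(* Composing with the retraction onto a closed square turns a function holomorphic
   near the square into one continuous on the whole plane. *)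
Let cl (s x : R) : R := Num.max (- s) (Num.min s x).
Let clC (s : R) (z : C) : C := (cl s (complex.Re z))%:K + 'i%C * (cl s (complex.Im z))%:K.

Lemma cl_dist s x y : `|cl s x - cl s y| <= `|x - y|.
Proof.
have A (m a b : R) : `|Num.min m a - Num.min m b| <= `|a - b|.
  have := ler_norm (a - b); have := ler_norm (- (a - b)); rewrite normrN => h1 h2.
  by rewrite ler_norml; case: (leP m a) => ?; case: (leP m b) => ?; lra.
have B (m a b : R) : `|Num.max m a - Num.max m b| <= `|a - b|.
  have := ler_norm (a - b); have := ler_norm (- (a - b)); rewrite normrN => h1 h2.
  by rewrite ler_norml; case: (leP m a) => ?; case: (leP m b) => ?; lra.
exact: le_trans (B _ _ _) (A _ _ _).
Qed.

Lemma square_extension p (s r0 : R) f : 0 < s -> 2 * s < r0 -> holo p r0 f ->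
  exists F, [/\ forall w, cont F w,
    forall w, `|complex.Re w| <= s -> `|complex.Im w| <= s -> F w = f (p + w),
    forall w, `|complex.Re w| < s -> `|complex.Im w| < s -> exists c, cder F w c &
    forall w, exists2 u, nrm (u - p) < r0 & F w = f u].
Proof.
move=> s0 sr hf; exists (fun w => f (p + clC s w)).
have clle x : `|cl s x| <= s.
  by rewrite ler_norml /cl le_max lexx ge_max ge_min lexx /= andbT; lra.
have clC2 w : nrm (clC s w) <= 2 * s.
  apply: le_trans (nrmD _ _) _; rewrite nrmM nrmi mul1r !nrmK.
  by have := clle (complex.Re w); have := clle (complex.Im w); lra.
have clin w : nrm (p + clC s w - p) < r0.
  by rewrite addrC addKr; apply: le_lt_trans (clC2 w) sr.
have clid w : `|complex.Re w| <= s -> `|complex.Im w| <= s -> clC s w = w.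
  have clx x : `|x| <= s -> cl s x = x.
    by rewrite ler_norml /cl => /andP[h1 h2]; rewrite (min_idPr h2) (max_idPr h1).
  by move=> h1 h2; rewrite /clC !clx // -complexE.
split.
- move=> w; apply: (@cont_comp _ (fun w => p + clC s w) f).
    move=> e e0; exists (e / 2) => [|u hu]; first lra.
    have -> : p + clC s u - (p + clC s w) = (cl s (complex.Re u) - cl s (complex.Re w))%:K +
        'i%C * (cl s (complex.Im u) - cl s (complex.Im w))%:K.
      by rewrite /clC !rmorphB; ring.
    apply: le_lt_trans (nrmD _ _) _; rewrite nrmM nrmi mul1r !nrmK.
    have := cl_dist s (complex.Re u) (complex.Re w); have := cl_dist s (complex.Im u) (complex.Im w).
    have := Re_le_nrm (u - w); have := Im_le_nrm (u - w); rewrite !raddfB; lra.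
  by have [c /cder_cont] := hf _ (clin w).
- by move=> w h1 h2; rewrite clid.
- move=> w h1 h2.
  have wp : nrm (p + w - p) < r0 by have := clin w; rewrite clid // ltW.
  have [c hc] := hf _ wp; exists (c * 1).
  have sub : cder (fun u => p + u) w 1.
    by rewrite -[1]add0r; apply: cderDD (cder_cst _ _) (cder_id _).
  apply: cder_near (cder_comp sub hc).
  pose d := Num.min (s - `|complex.Re w|) (s - `|complex.Im w|).
  exists d => [|u]; first by rewrite lt_min !subr_gt0 h1.
  rewrite lt_min => /andP[k1 k2]; rewrite clid //.
    have := Re_le_nrm (u - w); rewrite raddfB /=.
    by have := ler_normD (complex.Re u - complex.Re w) (complex.Re w); rewrite subrK; lra.
  have := Im_le_nrm (u - w); rewrite raddfB /=.
  by have := ler_normD (complex.Im u - complex.Im w) (complex.Im w); rewrite subrK; lra.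
by move=> w; exists (p + clC s w).
Qed.

Theorem taylor p (r : R) f M : 0 < r -> holo p (4 * r) f ->
  (forall z, nrm (z - p) < 4 * r -> nrm (f z) <= M) ->
  exists a : nat -> C, (forall n, nrm (a n) <= 2 * M / r ^+ n) /\
   forall z, nrm (z - p) < r -> forall N, nrm (f z - \sum_(k < N) a k * (z - p) ^+ k) <=
     2 * M * (nrm (z - p) / r) ^+ N * (r / (r - nrm (z - p))).
Proof.
move=> r0 hf hM.
(* The half-side [3 / 2 * r] exceeds [r], so the extension is differentiable on the closed square of
   half-side [r]; the retracted points stay within [3 * r] of the centre, inside the given disc. *)
have s0 : 0 < 3 / 2 * r by lra. have sr : 2 * (3 / 2 * r) < 4 * r by lra.
have [F [cF FE dF FM]] := square_extension s0 sr hf.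
have dF' w : in_rect (- r) r (- r) r w -> exists c, cder F w c.
  by move=> [h1 h2]; apply: dF; rewrite ltr_norml; lra.
have FM' w : in_rect (- r) r (- r) r w -> nrm (F w) <= M.
  by move=> _; have [u hu ->] := FM w; apply: hM.
have [a [ha h]] := taylor_square r0 cF dF' FM'.
exists a; split=> // z hz N; have := h _ hz N.
rewrite FE; first by rewrite [p + _]addrC subrK.
  by apply: le_trans (Re_le_nrm _) _; lra.
by apply: le_trans (Im_le_nrm _) _; lra.
Qed.

Theorem primitive_disc p (r : R) f : 0 < r -> holo p (4 * r) f ->
  exists P, forall z, nrm (z - p) < r -> cder P z (f z).
Proof.
move=> r0 hf.
have s0 : 0 < 3 / 2 * r by lra. have sr : 2 * (3 / 2 * r) < 4 * r by lra.
have [F [cF FE dF _]] := square_extension s0 sr hf.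
have dF' w : in_rect (- r) r (- r) r w -> exists c, cder F w c.
  by move=> [h1 h2]; apply: dF; rewrite ltr_norml; lra.
have [P hP] := primitive_square r0 cF dF'.
exists (fun z => P (z - p)) => z hz.
have := cder_comp (cder_subc p z) (hP _ hz); rewrite mulr1 FE; first by rewrite [p + _]addrC subrK.
  by apply: le_trans (Re_le_nrm _) _; lra.
by apply: le_trans (Im_le_nrm _) _; lra.
Qed.

End CauchyTaylor.

(** * Local theory of holomorphic functions *)

Section LocalTheory.
Variable R : realType.
Local Notation C := R[i].
Implicit Types (f g : C -> C) (w z p : C).

Lemma cder_O2 f z c (K d : R) : 0 < d ->
  (forall w, nrm (w - z) < d -> nrm (f w - f z - c * (w - z)) <= K * nrm (w - z) ^+ 2) ->
  cder f z c.
Proof.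
move=> d0 h; apply/cderP => e e0.
have K0 : 0 < `|K| + 1 by have := normr_ge0 K; lra.
exists (Num.min d (e / (`|K| + 1))) => [|w]; first by rewrite lt_min d0 divr_gt0.
rewrite lt_min ltr_pdivlMr // => /andP[/h h1 h2]; apply: le_trans h1 _.
rewrite expr2 mulrA ler_wpM2r ?nrm_ge0 //.
apply: le_trans (ltW h2); rewrite mulrC ler_wpM2l ?nrm_ge0 //.
by have := ler_norm K; lra.
Qed.

Lemma cder_nrm_le f g (z w : C) (M : R) :
  (forall t : R, 0 <= t <= 1 -> cder f (z + t%:K * (w - z)) (g (z + t%:K * (w - z)))) ->
  (forall t : R, 0 <= t <= 1 -> nrm (g (z + t%:K * (w - z))) <= M) ->
  nrm (f w - f z) <= M * nrm (w - z).
Proof.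
move=> df hM.
have := @rder_nrm_le R (fun t => f (z + t%:K * (w - z))) (fun t => (w - z) * g (z + t%:K * (w - z)))
  0 1 (M * nrm (w - z)) ler01.
rewrite mul1r mul0r addr0 [z + _]addrC subrK subr0 mulr1; apply.
- by move=> t /df; apply: rder_line.
by move=> t /hM h; rewrite nrmM mulrC ler_wpM2r ?nrm_ge0.
Qed.

Lemma disc_convex p (r : R) z w (t : R) : nrm (z - p) < r -> nrm (w - p) < r -> 0 <= t <= 1 ->
  nrm (z + t%:K * (w - z) - p) < r.
Proof.
move=> hz hw /andP[t0 t1].
have -> : z + t%:K * (w - z) - p = (1 - t)%:K * (z - p) + t%:K * (w - p).
  by rewrite rmorphB; ring.
apply: le_lt_trans (nrmD _ _) _; rewrite !nrmM !nrmK !ger0_norm //; last lra.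
have [->|t1'] := eqVneq t 1; first by rewrite subrr mul0r add0r mul1r.
have h1 : (1 - t) * nrm (z - p) < (1 - t) * r by rewrite ltr_pM2l // subr_gt0 lt_neqAle t1'.
have h2 : t * nrm (w - p) <= t * r by rewrite ler_wpM2l // ltW.
lra.
Qed.

Lemma disc_lipschitz p (r : R) f g M z w :
  (forall u, nrm (u - p) < r -> cder f u (g u)) ->
  (forall u, nrm (u - p) < r -> nrm (g u) <= M) ->
  nrm (z - p) < r -> nrm (w - p) < r -> nrm (f w - f z) <= M * nrm (w - z).
Proof.
move=> df hM hz hw; apply: cder_nrm_le => t ht; [apply: df|apply: hM]; exact: disc_convex.
Qed.

Lemma disc_const p (r : R) f z : (forall u, nrm (u - p) < r -> cder f u 0) ->
  nrm (z - p) < r -> f z = f p.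
Proof.
move=> df hz; apply/subr0_eq/nrm_small => e e0; apply: le_trans (ltW e0).
have r0 : 0 < r by apply: le_lt_trans hz; apply: nrm_ge0.
rewrite -[leRHS](mul0r (nrm (z - p))).
apply: (disc_lipschitz (g := fun=> 0) df) => //; first by rewrite nrm0.
by rewrite subrr nrm0.
Qed.

(** On the half disc the factor [r / (r - |z - p|)] is at most [2], whence [4 * M]. The estimates
    for one and two terms identify the first two coefficients. *)
Lemma taylor' p (r : R) f M : 0 < r -> holo p (4 * r) f ->
  (forall z, nrm (z - p) < 4 * r -> nrm (f z) <= M) ->
  exists a : nat -> C, [/\ a 0%N = f p, a 1%N = D f p,
    forall n, nrm (a n) <= 2 * M / r ^+ n &
    forall z, nrm (z - p) <= r / 2 -> forall N, nrm (f z - \sum_(k < N) a k * (z - p) ^+ k) <=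
     4 * M * (nrm (z - p) / r) ^+ N].
Proof.
move=> r0 hf hM; have [a [ha h]] := taylor r0 hf hM.
have M0 : 0 <= M.
  by apply: le_trans (nrm_ge0 _) (hM p _); rewrite subrr nrm0; lra.
have h' z : nrm (z - p) <= r / 2 -> forall N, nrm (f z - \sum_(k < N) a k * (z - p) ^+ k) <=
     4 * M * (nrm (z - p) / r) ^+ N.
  move=> hz N; have hz' : nrm (z - p) < r by lra.
  apply: le_trans (h z hz' N) _.
  have q : 0 <= (nrm (z - p) / r) ^+ N by rewrite exprn_ge0 // divr_ge0 ?nrm_ge0 // ltW.
  have k : r / (r - nrm (z - p)) <= 2 by rewrite ler_pdivrMr; lra.
  have X : 0 <= 2 * M * (nrm (z - p) / r) ^+ N by rewrite mulr_ge0 //; lra.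
  by apply: le_trans (ler_wpM2l X k) _; lra.
have a0 : a 0%N = f p.
  apply/esym/subr0_eq/nrm_small => e e0; apply: le_trans (ltW e0).
  have := h' p; rewrite subrr nrm0 mul0r => /(_ ltac:(lra) 1%N).
  by rewrite big_ord1 expr0 expr1 mulr0 mulr1.
exists a; split; [exact: a0| |exact: ha|exact: h'].
apply: esym; apply: DE.
apply: (@cder_O2 _ _ _ (4 * M / r ^+ 2) (r / 2)) => [|w hw]; first lra.
have := h' w (ltW hw) 2%N; rewrite big_ord_recl big_ord1 /= expr0 mulr1 expr1 a0 opprD addrA.
have -> : 4 * M / r ^+ 2 * nrm (w - p) ^+ 2 = 4 * M * (nrm (w - p) / r) ^+ 2.
  by rewrite expr_div_n; ring.
by [].
Qed.

Lemma cauchy_estimate p (r : R) f M : 0 < r -> holo p r f ->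
  (forall z, nrm (z - p) < r -> nrm (f z) <= M) -> nrm (D f p) <= 8 * M / r.
Proof.
move=> r0 hf hM.
have r4 : 4 * (r / 4) = r by field.
have rr : 0 < r / 4 by lra.
have [||a [_ <- ha _]] := @taylor' p (r / 4) f M rr; rewrite ?r4 //.
apply: le_trans (ha 1%N) _; rewrite expr1 le_eqVlt; apply/orP; left; apply/eqP.
by field; rewrite gt_eqF.
Qed.

Lemma holo_sub p (r : R) f z (s : R) : holo p r f -> nrm (z - p) + s <= r -> holo z s f.
Proof.
move=> hf hs w hw; apply: hf; apply: le_lt_trans (nrm_tri3 z _ _) _; lra.
Qed.

Lemma holo_local p (r : R) f z : holo p r f -> nrm (z - p) < r ->
  exists s M, [/\ 0 < s, 4 * s <= r - nrm (z - p), holo z (4 * s) f &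
    forall w, nrm (w - z) < 4 * s -> nrm (f w) <= M].
Proof.
move=> hf hz; have [c /cder_cont cf] := hf z hz.
have [d d0 hd] := cf 1 ltr01.
pose s := Num.min (d / 4) ((r - nrm (z - p)) / 4).
have s0 : 0 < s by rewrite lt_min !divr_gt0 // subr_gt0.
have [s1 s2] : 4 * s <= d /\ 4 * s <= r - nrm (z - p).
  have : s <= s by []; rewrite {2}/s le_min => /andP[]; lra.
exists s, (nrm (f z) + 1); split=> //; first by apply: holo_sub hf _; lra.
by move=> w hw; have := hd w (lt_le_trans hw s1); have := nrm_triB (f w) (f z); lra.
Qed.

(** Let [T] be the Taylor polynomial of degree two at [z]. Cauchy's estimate for [f - T] on the disc
    about [w] of radius [|w - z|] divides a cubic bound by the radius, so [D f] agrees with [D T],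
    which is affine, up to [O (|w - z|^2)]. *)
Lemma D_cder_second p (r : R) f z : holo p r f -> nrm (z - p) < r ->
  exists c, cder (D f) z c.
Proof.
move=> hf hz; have [s [M [s0 sr hs hM]]] := holo_local hf hz.
have [a [a0 a1 ha h]] := taylor' s0 hs hM.
have M0 : 0 <= M by apply: le_trans (nrm_ge0 _) (hM z _); rewrite subrr nrm0; lra.
pose K := 4 * M / s ^+ 3.
have K0 : 0 <= K by rewrite divr_ge0 ?exprn_ge0 //; lra.
exists (2 * a 2%N); apply: (@cder_O2 _ _ _ (64 * K) (s / 4)) => [|w hw]; first lra.
have [->|wz] := eqVneq w z; first by rewrite !subrr mulr0 subr0 nrm0 expr0n mulr0.
have n0 : 0 < nrm (w - z) by rewrite nrm_gt0 subr_eq0.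
pose T u := a 0%N + a 1%N * (u - z) + a 2%N * (u - z) ^+ 2.
have dT u : cder T u (a 1%N + a 2%N * (2 * (u - z))).
  have e1 := cderZ (a 1%N) (cder_subc z u).
  have e2 := cderZ (a 2%N) (cder_comp (cder_subc z u) (cderXn 2 (u - z))).
  apply: cder_eq (cderDD (cderDD (cder_cst (a 0%N) u) e1) e2) _.
  by rewrite /= expr1; ring.
have hR : holo w (nrm (w - z)) (fun u => f u - T u).
  move=> u hu; have [c hc] : exists c, cder f u c.
    by apply: hs; apply: le_lt_trans (nrm_tri3 w _ _) _; lra.
  by eexists; apply: cderB hc (dT u).
have bR u : nrm (u - w) < nrm (w - z) -> nrm (f u - T u) <= 8 * K * nrm (w - z) ^+ 3.
  move=> hu; have hu' : nrm (u - z) <= 2 * nrm (w - z).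
    by apply: le_trans (nrm_tri3 w _ _) _; lra.
  have := h u; move=> /(_ ltac:(lra) 3%N).
  rewrite !big_ord_recr big_ord0 /= add0r expr0 mulr1 expr1 -/(T u) => hT.
  apply: le_trans hT _.
  have -> : 4 * M * (nrm (u - z) / s) ^+ 3 = K * nrm (u - z) ^+ 3.
    by rewrite /K expr_div_n; ring.
  have -> : 8 * K * nrm (w - z) ^+ 3 = K * (2 * nrm (w - z)) ^+ 3 by ring.
  by rewrite ler_wpM2l // lerXn2r ?nnegrE ?nrm_ge0 // mulr_ge0 ?nrm_ge0.
have := cauchy_estimate n0 hR bR.
have wp : nrm (w - p) < r by apply: le_lt_trans (nrm_tri3 z _ _) _; lra.
have -> : D (fun u => f u - T u) w = D f w - D f z - 2 * a 2%N * (w - z).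
  by rewrite (DE (cderB (holoD hf wp) (dT w))) a1; ring.
move=> H; apply: le_trans H _; rewrite le_eqVlt; apply/orP; left; apply/eqP.
by field; rewrite gt_eqF.
Qed.

Lemma holo_D p (r : R) f : holo p r f -> holo p r (D f).
Proof. by move=> hf z; apply: D_cder_second. Qed.

Lemma zero_order p (r : R) f : 0 < r -> holo p r f ->
  (near_pt p (fun z => f z = 0)) \/
  exists m (s : R) g, [/\ 0 < s <= r, holo p s g &
    forall z, nrm (z - p) < s -> f z = (z - p) ^+ m * g z /\ g z != 0].
Proof.
move=> r0 hf.
have pp : nrm (p - p) < r by rewrite subrr nrm0.
have [s [M [s0 sr hs hM]]] := holo_local hf pp.
rewrite subrr nrm0 subr0 in sr.
have [a [_ _ ha h]] := taylor' s0 hs hM.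
have M0 : 0 <= M by apply: le_trans (nrm_ge0 _) (hM p _); rewrite subrr nrm0; lra.
have [all0|] := pselect (forall n, a n = 0).
  left; exists (s / 2) => [|w hw]; first lra.
  apply: nrm_small => e e0.
  have q0 : 0 <= nrm (w - p) / s by rewrite divr_ge0 ?nrm_ge0 // ltW.
  have q1 : nrm (w - p) / s < 1 by rewrite ltr_pdivrMr //; lra.
  have [N hN] := geo_small (4 * M) q0 q1 e0.
  have := h w (ltW hw) N; rewrite big1 ?subr0 => [h'|k _]; last by rewrite all0 mul0r.
  by apply: le_trans h' (ltW (hN _ _)).
move=> /existsNP[n0 /eqP an0]; right.
have ex : exists n, a n != 0 by exists n0.
pose m := ex_minn ex.
have [am amin] : a m != 0 /\ forall k, (k < m)%N -> a k = 0.
  rewrite /m; case: ex_minnP => j h1 h2; split=> // k kj.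
  by apply/eqP; apply: contraTT kj => /h2; rewrite leqNgt.
(* With [a m] the first nonzero coefficient, [g] takes the value [a m] at [p], and the next
   coefficient is its derivative there. *)
pose g w := if w == p then a m else f w / (w - p) ^+ m.
have gp : g p = a m by rewrite /g eqxx.
have fp w : w != p -> f w = (w - p) ^+ m * g w.
  by move=> wp; rewrite /g (negPf wp) mulrC divfK // expf_neq0 // subr_eq0.
have cg : cder g p (a m.+1).
  apply: (@cder_O2 _ _ _ (4 * M / s ^+ m.+2) (s / 2)) => [|w hw]; first lra.
  have [->|wp] := eqVneq w p; first by rewrite !subrr mulr0 subr0 nrm0 expr0n mulr0.
  have wp0 : (w - p) ^+ m != 0 by rewrite expf_neq0 // subr_eq0.
  have n0' : 0 < nrm (w - p) ^+ m by rewrite -nrmX nrm_gt0.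
  have := h w (ltW hw) m.+2; rewrite 2!big_ord_recr /= big1 ?add0r => [|k _]; last first.
    by rewrite amin ?mul0r.
  rewrite (fp w wp) gp => H.
  have E : (w - p) ^+ m * g w - (a m * (w - p) ^+ m + a m.+1 * (w - p) ^+ m.+1) =
     (w - p) ^+ m * (g w - a m - a m.+1 * (w - p)) by rewrite exprS; ring.
  rewrite E nrmM nrmX in H; rewrite -(ler_pM2l n0'); apply: le_trans H _.
  rewrite le_eqVlt; apply/orP; left; apply/eqP; rewrite expr_div_n [nrm _ ^+ m.+2]exprS.
  by rewrite [nrm _ ^+ m.+1]exprS; ring.
have [|d d0 hd] := cont_near0 (cder_cont cg); first by rewrite gp.
exists m, (Num.min d s), g; split.
- by rewrite lt_min d0 s0 ge_min; apply/orP; right; lra.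
- move=> z; rewrite lt_min => /andP[_ zs].
  have [->|zp] := eqVneq z p; first by exists (a m.+1).
  have zr : nrm (z - p) < r by lra.
  have [c hc] := hf z zr.
  have zpm : (z - p) ^+ m != 0 by rewrite expf_neq0 // subr_eq0.
  have dm := cder_comp (cder_subc p z) (cderXn m (z - p)).
  eexists; apply: cder_near (cderM hc (cderV dm zpm)).
  exists (nrm (z - p)) => [|u]; first by rewrite nrm_gt0 subr_eq0.
  by rewrite /g; case: eqP => // ->; rewrite nrmBC ltxx.
move=> z; rewrite lt_min => /andP[/hd zd zs]; split; last first.
  by rewrite -nrm_gt0; have := nrm_ge0 (g p); lra.
have [->|zp] := eqVneq z p; last exact: fp.
rewrite gp subrr.
have := h p; rewrite subrr nrm0 mul0r => /(_ ltac:(lra) m.+1).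
rewrite big_ord_recr /= big1 ?add0r => [|k _]; last by rewrite amin ?mul0r.
by rewrite [X in _ <= _ * X]expr0n mulr0 => h'; apply/subr0_eq/nrm_small => e e0; rewrite mulrC; lra.
Qed.

(** Local boundedness alone suffices. The bisection runs over the circumscribed square, and a point
    outside the closed disc has a neighbourhood on which the condition is vacuous. *)
Lemma bounded_disc p (r : R) (q : C -> R) :
  (forall z, nrm (z - p) <= r -> exists B, near_pt z (fun w => nrm (w - p) <= r -> q w <= B)) ->
  exists B, forall z, nrm (z - p) <= r -> q z <= B.
Proof.
move=> h.
have [r0|r0] := ltP r 0.
  by exists 0 => z hz; have := nrm_ge0 (z - p); lra.
pose x := complex.Re p; pose y := complex.Im p.
pose P a b c d := exists B, forall z, in_rect a b c d z -> nrm (z - p) <= r -> q z <= B.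
have [B hB] : P (x - r) (x + r) (y - r) (y + r).
  apply: (@bisection R P); [lra|lra| |].
    move=> a b c d ab cd [B1 h1] [B2 h2] [B3 h3] [B4 h4].
    exists (Num.max (Num.max B1 B2) (Num.max B3 B4)) => z [/andP[k1 k2] /andP[k3 k4]] hz.
    rewrite !le_max; have [k5|k5] := leP (complex.Re z) ((a + b) / 2);
    have [k6|k6] := leP (complex.Im z) ((c + d) / 2).
    - by rewrite h1 //; split; lra.
    - by rewrite h2 ?orbT //; split; lra.
    - by rewrite h3 ?orbT //; split; lra.
    - by rewrite h4 ?orbT //; split; lra.
  move=> u v hu hv; pose z : C := u%:K + v%:K * 'i%C.
  have [B [d d0 hd]] : exists B, near_pt z (fun w => nrm (w - p) <= r -> q w <= B).
    have [zr|zr] := leP (nrm (z - p)) r; first exact: h.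
    exists 0; exists (nrm (z - p) - r) => [|w hw wr]; first lra.
    by have := nrm_tri3 w z p; rewrite [nrm (z - w)]nrmBC; lra.
  exists (d / 2) => [|a b c e0 _ au ub _ _ cv ve _ ba ec]; first lra.
  exists B => w hw; apply: hd.
  have hz : in_rect a b c e0 z by split; rewrite ?Re_v ?Im_v; lra.
  by have := dist_in_rect hz hw; lra.
exists B => z hz; apply: hB => //.
have := le_trans (Re_le_nrm _) hz; have := le_trans (Im_le_nrm _) hz.
by rewrite !raddfB /= -/x -/y !ler_norml => h1 h2; split; lra.
Qed.

End LocalTheory.

(** * The complex exponential and logarithms *)

Section Exponential.
Variable R : realType.
Local Notation C := R[i].
Implicit Types (f : C -> C) (w z p : C).

Definition Cexp z : C :=
  (expR (complex.Re z))%:K * ((cos (complex.Im z))%:K + 'i%C * (sin (complex.Im z))%:K).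

Lemma is_derive_o (f : R -> R) (x c : R) : is_derive x 1 f c -> forall e : R, 0 < e ->
  exists2 d : R, 0 < d & forall s, `|s| < d -> `|f (x + s) - f x - c * s| <= e * `|s|.
Proof.
move=> [dF FE] e e0; rewrite -FE.
move: dF; rewrite /derivable => /cvgrPdist_le /(_ e e0).
rewrite -/(derive f x 1); move/nbhs_ballP => [d /= d0 hd]; exists d => // s hs.
have [->|s0] := eqVneq s 0; first by rewrite addr0 subrr mulr0 subr0 !normr0 mulr0.
have bs : ball 0 d s by rewrite /ball /= sub0r normrN.
have := hd _ bs s0; rewrite /GRing.scale /= mulr1 => h.
have -> : f (x + s) - f x - 'D_1 f x * s = - ('D_1 f x - s^-1 * (f (s + x) - f x)) * s.
  by rewrite [s + x]addrC; field.
by rewrite normrM normrN ler_wpM2r.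
Qed.

Lemma CexpD z w : Cexp (z + w) = Cexp z * Cexp w.
Proof.
rewrite /Cexp !raddfD expRD cosD sinD.
by apply/eqP; rewrite eq_complex /=; apply/andP; split; apply/eqP; ring.
Qed.

Lemma Cexp0 : Cexp 0 = 1.
Proof. by rewrite /Cexp /= expR0 cos0 sin0 mulr0 addr0 mulr1. Qed.

Lemma CexpN z : Cexp (- z) = (Cexp z)^-1.
Proof.
have h : Cexp (- z) * Cexp z = 1 by rewrite -CexpD addNr Cexp0.
have z0 : Cexp z != 0 by apply: contra_eq_neq h => ->; rewrite mulr0 eq_sym oner_neq0.
by apply: (mulIf z0); rewrite h mulVf.
Qed.

Lemma Cexp_neq0 z : Cexp z != 0.
Proof.
apply/eqP => h; have := Cexp0; rewrite -(subrr z) CexpD h mul0r => /eqP.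
by rewrite eq_sym oner_eq0.
Qed.

Lemma nrm_cis (y : R) : nrm ((cos y)%:K + 'i%C * (sin y)%:K : C) = 1.
Proof.
rewrite /nrm normc_def /=.
have -> : (cos y + (0 * sin y - 1 * 0)) ^+ 2 + (0 + (0 * 0 + 1 * sin y)) ^+ 2 = 1.
  by transitivity (cos y ^+ 2 + sin y ^+ 2); [ring|exact: cos2Dsin2].
by rewrite sqrtr1.
Qed.

Lemma nrm_Cexp z : nrm (Cexp z) = expR (complex.Re z).
Proof. by rewrite nrmM nrmK nrm_cis mulr1 ger0_norm // expR_ge0. Qed.

Lemma cder_Cexp z : cder Cexp z (Cexp z).
Proof.
suff h : cder Cexp 0 1.
  have h' : cder (fun w => Cexp z * Cexp (w - z)) z (Cexp z * (1 * 1)).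
    by apply/cderZ/cder_comp; [apply: cder_subc|rewrite subrr].
  apply: cder_near (cder_eq h' _); last by rewrite !mulr1.
  by exists 1 => // w _; rewrite -CexpD addrC subrK.
(* The decomposition below has three terms, bounded by [a], [4 * a] and [a] times the modulus of the
   increment; hence the [6]. *)
apply/cderP => e e0; pose a := Num.min 1 (e / 6).
have a0 : 0 < a by rewrite lt_min ltr01 divr_gt0.
have [a1 a6] : a <= 1 /\ 6 * a <= e.
  by have : a <= a by []; rewrite {2}/a le_min => /andP[]; lra.
clearbody a.
have [d1 d10 h1] := is_derive_o (is_derive_expR (0 : R)) a0.
have [d2 d20 h2] := is_derive_o (is_derive_cos (0 : R)) a0.
have [d3 d30 h3] := is_derive_o (is_derive_sin (0 : R)) a0.
exists (Num.min (Num.min d1 d2) (Num.min d3 a)) => [|h].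
  by rewrite !lt_min d10 d20 d30 a0.
rewrite subr0 Cexp0 !lt_min => /andP[/andP[k1 k2] /andP[k3 k4]].
set x := complex.Re h; set y := complex.Im h.
have hx : `|x| <= nrm h by apply: Re_le_nrm.
have hy : `|y| <= nrm h by apply: Im_le_nrm.
have {}h1 := h1 x (le_lt_trans hx k1).
have {}h2 := h2 y (le_lt_trans hy k2).
have {}h3 := h3 y (le_lt_trans hy k3).
rewrite !add0r expR0 sin0 cos0 ?oppr0 ?mul0r ?mul1r ?subr0 ?addr0 in h1 h2 h3.
pose E : C := (cos y)%:K + 'i%C * (sin y)%:K.
have nE : nrm E = 1 by apply: nrm_cis.
have -> : Cexp h - 1 - 1 * h = (expR x - 1 - x)%:K * E +
    ((1 + x)%:K * (E - 1 - 'i%C * y%:K) + 'i%C * (x * y)%:K).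
  rewrite /Cexp -/x -/y -/E [X in _ - 1 * X]complexE -/x -/y.
  by rewrite !rmorphB !rmorphD rmorphM rmorph1; ring.
apply: le_trans (nrmD _ _) _.
apply: le_trans (lerD (lexx _) (nrmD _ _)) _.
rewrite !nrmM nE nrmi mul1r mulr1 !nrmK.
have t1 : nrm (E - 1 - 'i%C * y%:K) <= 2 * a * nrm h.
  have -> : E - 1 - 'i%C * y%:K = (cos y - 1)%:K + 'i%C * (sin y - y)%:K.
    by rewrite /E !rmorphB rmorph1; ring.
  apply: le_trans (nrmD _ _) _; rewrite nrmM nrmi mul1r !nrmK.
  have := ler_wpM2l (ltW a0) hy; lra.
have t2 : `|1 + x| <= 2.
  apply: le_trans (ler_normD _ _) _; rewrite normr1; lra.
have t3 : `|x * y| <= a * nrm h.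
  by rewrite normrM; apply: ler_pM => //; lra.
have t4 := ler_wpM2l (ltW a0) hx.
have t5 : `|1 + x| * nrm (E - 1 - 'i%C * y%:K) <= 2 * (2 * a * nrm h).
  by apply: ler_pM => //; apply: nrm_ge0.
have t6 := ler_wpM2r (nrm_ge0 h) a6.
lra.
Qed.

Lemma Clog_exists z : z != 0 ->
  exists2 t, Cexp t = z & complex.Re t = ln (nrm z) /\ `|complex.Im t| <= pi.
Proof.
move=> z0; have n0 : 0 < nrm z by rewrite nrm_gt0.
pose a := complex.Re z / nrm z; pose b := complex.Im z / nrm z.
have ab : a ^+ 2 + b ^+ 2 = 1.
  have h : complex.Re z ^+ 2 + complex.Im z ^+ 2 = nrm z ^+ 2.
    by rewrite -Re_mul_conj; case: (z) => u v /=; ring.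
  by rewrite /a /b !expr_div_n -mulrDl h divff // expf_neq0 // gt_eqF.
have a1 : -1 <= a <= 1.
  have := sqr_ge0 b; rewrite -ler_norml => b0.
  rewrite -(@ler_sqr _ _ 1) ?nnegrE // expr1n real_normK ?num_real //; lra.
have [th [thpi [cth sth]]] : exists th : R, `|th| <= pi /\ (cos th = a /\ sin th = b).
  have /acos_def[/andP[h1 h2] h3] := a1.
  have h4 := sin_acos a1.
  have E : 1 - a ^+ 2 = b ^+ 2 by lra.
  rewrite E sqrtr_sqr in h4.
  have [b0|b0] := leP 0 b.
    by exists (acos a); rewrite ger0_norm // h4 ger0_norm.
  by exists (- acos a); rewrite normrN ger0_norm // cosN sinN h4 ltr0_norm // opprK.
exists ((ln (nrm z))%:K + 'i%C * th%:K) => /=; last first.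
  by rewrite !(mul0r, mul1r, mulr0, subr0, addr0, add0r).
rewrite /Cexp /= !(mul0r, mul1r, mulr0, subr0, addr0, add0r) lnK ?posrE //.
rewrite cth sth [RHS]complexE mulrDr mulrCA -!rmorphM /a /b.
by rewrite ![nrm z * _]mulrC !divfK ?gt_eqF.
Qed.

Lemma Cexp_2pi_nat (n : nat) : Cexp (n%:R * ((2 * pi)%:K * 'i%C)) = 1.
Proof.
elim: n => [|n IH]; first by rewrite mul0r Cexp0.
rewrite -natr1 mulrDl CexpD IH !mul1r /Cexp /=.
have -> : 2 * pi * 0 - 0 * 1 = 0 :> R by ring.
have -> : 2 * pi * 1 + 0 * 0 = pi *+ 2 :> R by rewrite mulr2n; ring.
by rewrite expR0 cos2pi sin2pi mulr0 addr0 mul1r.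
Qed.

(** [l] is the primitive of [D f / f] with value [l0] at [p], and [f * Cexp (- l)] has zero
    derivative. The primitive costs a factor [4] in the radius. *)
Lemma log_disc p (r : R) f (l0 : C) : 0 < r -> holo p (4 * r) f ->
  (forall z, nrm (z - p) < 4 * r -> f z != 0) -> Cexp l0 = f p ->
  exists l : C -> C, l p = l0 /\ forall z, nrm (z - p) < r ->
    cder l z (D f z / f z) /\ Cexp (l z) = f z.
Proof.
move=> r0 hf f0 hl0.
have hg : holo p (4 * r) (fun z => D f z / f z).
  move=> z hz; have [c hc] := holo_D hf hz.
  by eexists; apply: cderM hc (cderV (holoD hf hz) (f0 z hz)).
have [P hP] := primitive_disc r0 hg.
pose l z := l0 + (P z - P p); exists l; split; first by rewrite /l subrr addr0.
have dl z : nrm (z - p) < r -> cder l z (D f z / f z).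
  move=> hz; apply: cder_eq (cderDD (cder_cst l0 z) (cderB (hP z hz) (cder_cst (P p) z))) _.
  by rewrite subr0 add0r.
move=> z hz; split; first exact: dl.
have k : f z * Cexp (- l z) = f p * Cexp (- l p).
  apply: (@disc_const _ p r (fun z => f z * Cexp (- l z))) => // u hu.
  have hu4 : nrm (u - p) < 4 * r by lra.
  have fu := f0 u hu4.
  apply: cder_eq (cderM (holoD hf hu4) (cder_comp (cderN (dl u hu)) (cder_Cexp _))) _.
  by field.
have lp : l p = l0 by rewrite /l subrr addr0.
move: k; rewrite lp !CexpN hl0 mulfV; last first.
  by apply: f0; rewrite subrr nrm0; lra.
by move=> k; rewrite -[LHS]mul1r -k divfK // Cexp_neq0.
Qed.

End Exponential.

(** * The Landau-Bloch argument *)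

Section CoveringArgument.
Variable R : realType.
Local Notation C := R[i].
Implicit Types (f g V W Q : C -> C) (w z p : C).

(** [V - id] is contracting with factor [1 / 2], so [h -> h - (V h - t)] halves the error and maps
    the disc of radius [2 * T] to itself. No limit of the iteration is taken: if [V] missed [t],
    then [1 / |V - t|] would be bounded on that disc, contradicting errors as small as desired. *)
Lemma near_id_onto V W (T : R) (t : C) : 0 < T -> V 0 = 0 ->
  (forall z, nrm z < 3 * T -> cder V z (W z)) ->
  (forall z, nrm z < 3 * T -> nrm (W z - 1) <= 2^-1) ->
  nrm t <= T -> exists2 h, nrm h <= 2 * T & V h = t.
Proof.
move=> T0 V0 dV hW tT; apply: contrapT => noh.
have no z : nrm z <= 2 * T -> V z - t != 0.
  by move=> hz; rewrite subr_eq0; apply/eqP => h; apply: noh; exists z.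
have [B hB] : exists B, forall z, nrm (z - 0) <= 2 * T -> (nrm (V z - t))^-1 <= B.
  apply: bounded_disc => z; rewrite subr0 => hz; have hz3 : nrm z < 3 * T by lra.
  have n0 : 0 < nrm (V z - t) by rewrite nrm_gt0 no.
  have cV : cont (fun z => V z - t) z.
    by apply: contB; [apply: cder_cont (dV z hz3)|apply: cont_cst].
  exists (nrm (V z - t) / 2)^-1; apply: near_imp (cont_near0 cV (no z hz)) => w h _.
  by rewrite lef_pV2 ?posrE; lra.
have lip z w : nrm z < 3 * T -> nrm w < 3 * T -> nrm ((V w - w) - (V z - z)) <= 2^-1 * nrm (w - z).
  move=> hz hw; have := @disc_lipschitz R 0 (3 * T) (fun u => V u - u) (fun u => W u - 1) (2^-1) z w.
  rewrite !subr0; apply=> //.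
  - by move=> u; rewrite subr0 => hu; apply: cderB (dV u hu) (cder_id u).
  - by move=> u; rewrite subr0; apply: hW.
have it k : exists h, nrm h <= 2 * T /\ nrm (V h - t) <= nrm t * 2^-1 ^+ k.
  elim: k => [|k [h [h1 h2]]].
    by exists 0; rewrite nrm0 V0 sub0r nrmN expr0 mulr1; split=> //; lra.
  have h3 : nrm h < 3 * T by lra.
  have Z : nrm (0 : C) < 3 * T by rewrite nrm0; lra.
  pose h' := h - (V h - t).
  have l0 := lip _ _ Z h3; rewrite V0 !subr0 in l0.
  have hh' : nrm h' <= 2 * T.
    have -> : h' = t - (V h - h) by rewrite /h'; ring.
    by apply: le_trans (nrmB _ _) _; lra.
  have h3' : nrm h' < 3 * T by lra.
  exists h'; split=> //; have := lip _ _ h3 h3'.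
  have -> : V h' - h' - (V h - h) = V h' - t by rewrite /h'; ring.
  have -> : h' - h = - (V h - t) by rewrite /h'; ring.
  by rewrite nrmN exprS; lra.
have Bp : 0 < B.
  by apply: lt_le_trans (hB 0 _); rewrite ?subrr ?nrm0 ?invr_gt0 ?nrm_gt0 ?no ?nrm0 //; lra.
have iB : 0 < B^-1 by rewrite invr_gt0.
have [|||N hN] := @geo_small R 2^-1 (nrm t) B^-1; [lra|lra|exact: iB|].
have [h [h1 h2]] := it N; have := hN N (leqnn _).
have := hB h; rewrite subr0 => /(_ h1) h3 h4.
have n0 : 0 < nrm (V h - t) by rewrite nrm_gt0 no.
have : B^-1 <= nrm (V h - t) by rewrite -[leRHS]invrK lef_pV2 ?posrE ?invr_gt0.
lra.
Qed.

(** For [x >= 1] put [n = floor x + 2] and [b = n + sqrt (n^2 - 1)]: then [x <= n <= b <= 2 * n <= 2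
    * x + 4 <= 6 * x]. Values [a < 1] are handled through [1 / a], as [b + 1 / b] is symmetric. *)
Lemma integer_target (a : R) : 0 < a ->
  exists (n : nat) (b : R), [/\ (1 < n)%N, 0 < b, b + b^-1 = 2 * n%:R & `|ln (b / a)| <= ln 6].
Proof.
have big (x : R) : 1 <= x -> exists (n : nat) (b : R),
    [/\ (1 < n)%N, 0 < b, b + b^-1 = 2 * n%:R, x <= b & b <= 6 * x].
  move=> x1; pose n := (Num.truncn x).+2; exists n.
  have x0 : 0 <= x by lra.
  have /andP[n1 n2] := truncn_itv x0.
  have nE : n%:R = (Num.truncn x)%:R + 2 :> R by rewrite -natrD addn2.
  have n2' : x < (Num.truncn x)%:R + 1 by rewrite natr1.
  have n3 : 2 <= n%:R :> R by rewrite nE; lra.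
  pose s : R := Num.sqrt (n%:R ^+ 2 - 1).
  have s2 : s ^+ 2 = n%:R ^+ 2 - 1 by rewrite sqr_sqrtr // expr2; nra.
  have s0 : 0 <= s by apply: sqrtr_ge0.
  have sn : s <= n%:R.
    by rewrite -(@ler_sqr _ s) ?nnegrE ?ler0n // s2; lra.
  have b0 : 0 < n%:R + s by lra.
  exists (n%:R + s); split=> //; [|lra|lra].
  have h : (n%:R + s) * (n%:R - s) = 1 by rewrite mulrC -subr_sqr s2; ring.
  have -> : (n%:R + s)^-1 = n%:R - s.
    by apply: (mulfI (lt0r_neq0 b0)); rewrite h divff // gt_eqF.
  ring.
have lnb (x : R) : 1 <= x -> x <= 6 -> `|ln x| <= ln 6.
  move=> x1 x6; rewrite ger0_norm ?ln_ge0 //.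
  by rewrite ler_ln ?posrE //; lra.
move=> a0; have [a1|/ltW a1] := leP 1 a.
  have [n [b [n1 b0 bn b1 b2]]] := big a a1; exists n, b; split=> //.
  by apply: lnb; rewrite ?ler_pdivlMr ?ler_pdivrMr ?mul1r.
have a1' : 1 <= a^-1 by rewrite invf_ge1.
have [n [b [n1 b0 bn b1 b2]]] := big _ a1'; exists n, b^-1; split=> //.
- by rewrite invr_gt0.
- by rewrite invrK addrC.
have ba : 0 < b * a by rewrite mulr_gt0.
rewrite -invfM lnV ?posrE // normrN; apply: lnb.
  by move: b1; rewrite -div1r ler_pdivrMr.
by move: b2; rewrite -ler_pdivlMr // invrK.
Qed.

(** The covering radius of the net: [ln 6] for the logarithm of the modulus, [pi] for the
    argument. *)
Definition netR : R := ln 6 + pi.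

Lemma netR_gt0 : 0 < netR.
Proof.
have l6 : 0 <= ln (6 : R) by rewrite ln_ge0 //; lra.
by have := pi_gt0 R; rewrite /netR; lra.
Qed.

Lemma hits_integer (A0 : C) : A0 != 0 -> exists (n : nat) (t : C),
  [/\ (1 < n)%N, nrm t <= netR & A0 * Cexp t + (A0 * Cexp t)^-1 = 2 * n%:R].
Proof.
move=> A00; have n0 : 0 < nrm A0 by rewrite nrm_gt0.
have [n [b [n1 b0 bn lnb]]] := integer_target n0.
have bK : b%:K != 0 :> C by rewrite -nrm_gt0 nrmK normr_gt0 gt_eqF.
have [t et [ret imt]] : exists2 t : C, Cexp t = b%:K / A0 &
    complex.Re t = ln (nrm (b%:K / A0)) /\ `|complex.Im t| <= pi.
  by apply: Clog_exists; rewrite mulf_neq0 ?invr_eq0.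
exists n, t; split=> //.
  apply: le_trans (nrm_le_ReIm t) _; apply: lerD => //.
  by rewrite ret nrmM nrmV nrmK (gtr0_norm b0).
rewrite et [A0 * _]mulrC divfK //.
by rewrite -fmorphV -rmorphD /= bn rmorphM /= !rmorph_nat.
Qed.

(* [6144 = 64 * 96]: on the disc of radius [48 * netR], Cauchy's estimate then gives
   [|D Q| <= 1 / (96 * netR)], so [Q] stays within [1/2] of [1]. *)
Definition bigL : R := 48 * netR + 6144 * netR.

(* With [Q := (D u)^2 / (u^2 - 1)] and [V] a primitive of [sqrt Q], one has [u = cosh (V + c)];
   since [Q] is nearly constant, [V] is nearly the identity, so [u] takes an integer value [n > 1]
   with nonzero derivative. *)
Lemma no_large_cosh_disc u Q :
  holo 0 bigL u -> holo 0 bigL Q -> Q 0 = 1 -> (forall z, nrm z < bigL -> nrm (Q z) <= 8) ->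
  (forall z, nrm z < bigL -> D u z ^+ 2 = (u z ^+ 2 - 1) * Q z) ->
  (forall z, nrm z < bigL -> u z ^+ 2 = 1 -> Q z = u z * D (D u) z) ->
  ~ (forall z (n : nat), nrm z < bigL -> u z = n%:R -> D u z = 0).
Proof.
have T0 := netR_gt0; set T := netR in T0 *; rewrite /bigL -/T.
set L : R := 48 * T + _ => hu hQ Q1 Q8 eQ eQ1 hn.
have L48 : 48 * T < L by rewrite /L; lra.
have inL z : nrm z < 48 * T -> nrm (z - 0) < L by rewrite subr0; lra.
have inL' z : nrm z < 48 * T -> nrm z < L by lra.
have dQ z : nrm z < 48 * T -> nrm (D Q z) <= (96 * T)^-1.
  move=> hz; have s0 : 0 < 6144 * T by lra.
  have hQz : holo z (6144 * T) Q.
    by apply: (holo_sub hQ); rewrite subr0 /L; lra.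
  apply: le_trans (cauchy_estimate s0 hQz (M := 8) _) _.
    move=> w hw; apply: Q8; have := nrmD (w - z) z; rewrite subrK /L; lra.
  by rewrite le_eqVlt; apply/orP; left; apply/eqP; field; rewrite gt_eqF.
have Q12 z : nrm z < 48 * T -> nrm (Q z - 1) <= 2^-1.
  move=> hz; rewrite -Q1.
  apply: le_trans (@disc_lipschitz _ 0 (48 * T) Q (D Q) (96 * T)^-1 0 z _ _ _ _) _.
  - by move=> w; rewrite subr0 => hw; apply: holoD hQ (inL w hw).
  - by move=> w; rewrite subr0; apply: dQ.
  - by rewrite subrr nrm0; lra.
  - by rewrite subr0.
  by rewrite subr0 ler_pdivrMl; lra.
have Qge z : nrm z < 48 * T -> 2^-1 <= nrm (Q z).
  by move=> /Q12; have := nrm_triB 1 (1 - Q z); rewrite nrm1 subKr nrmBC; lra.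
have Qn0 z : nrm z < 48 * T -> Q z != 0 by move=> /Qge; rewrite -nrm_gt0; lra.
(* The logarithm of [Q] and then the primitive of its square root each divide the radius by [4]:
   from [48 * T] to [12 * T] to [3 * T], the radius that [near_id_onto] asks for. *)
have T12 : 0 < 12 * T by lra.
have E48 : 4 * (12 * T) = 48 * T by ring.
have [|||l [l0 hl]] := @log_disc R 0 (12 * T) Q 0 T12.
- by apply: (holo_sub hQ); rewrite subrr nrm0 E48; lra.
- by move=> z; rewrite subr0 E48; apply: Qn0.
- by rewrite Cexp0 Q1.
pose W z := Cexp (2^-1 * l z).
have in12 z : nrm z < 12 * T -> nrm z < 48 * T by lra.
have W2 z : nrm z < 12 * T -> W z ^+ 2 = Q z.
  move=> hz; have [|_ <-] := hl z; first by rewrite subr0.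
  by rewrite /W expr2 -CexpD; congr Cexp; field.
have dW z : nrm z < 12 * T -> cder W z (W z * (D Q z / (2 * Q z))).
  move=> hz; have [|dl _] := hl z; first by rewrite subr0.
  apply: cder_eq (cder_comp (cderZ 2^-1 dl) (cder_Cexp _)) _.
  by rewrite /W; field; apply: Qn0; apply: in12.
have Wge z : nrm z < 12 * T -> 2^-1 <= nrm (W z).
  move=> hz; have := Qge z (in12 z hz); rewrite -W2 // nrmX => h.
  have := nrm_ge0 (W z); rewrite expr2 in h; nra.
have W1 z : nrm z < 12 * T -> nrm (W z - 1) <= 2^-1.
  move=> hz; have -> : 1 = W 0 by rewrite /W l0 mulr0 Cexp0.
  apply: le_trans (@disc_lipschitz _ 0 (12 * T) W _ (96 * T)^-1 0 z _ _ _ _) _.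
  - by move=> w; rewrite subr0; apply: dW.
  - move=> w; rewrite subr0 => hw; have h1 := dQ w (in12 w hw).
    have h2 := Wge w hw; have h3 := Qn0 w (in12 w hw).
    have w0 : W w != 0 by rewrite -nrm_gt0; lra.
    have -> : W w * (D Q w / (2 * Q w)) = D Q w * (2 * W w)^-1.
      by rewrite -W2 //; field.
    rewrite nrmM nrmV nrmM nrm_nat; apply: le_trans (_ : (96 * T)^-1 * 1 <= _); last by rewrite mulr1.
    apply: ler_pM => //; rewrite ?nrm_ge0 ?invr_ge0 ?mulr_ge0 ?nrm_ge0 //.
    by rewrite invf_le1; lra.
  - by rewrite subrr nrm0; lra.
  - by rewrite subr0.
  by rewrite subr0 ler_pdivrMl; lra.
have Wn0 z : nrm z < 12 * T -> W z != 0 by move=> /Wge; rewrite -nrm_gt0; lra.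
have T3 : 0 < 3 * T by lra.
have [|P hP] := @primitive_disc R 0 (3 * T) W T3.
  move=> z; rewrite subr0 => hz; eexists; apply: dW; lra.
pose V z := P z - P 0.
have V0 : V 0 = 0 by rewrite /V subrr.
have in3 z : nrm z < 3 * T -> nrm z < 12 * T by lra.
have dV z : nrm z < 3 * T -> cder V z (W z).
  move=> hz; apply: cder_eq (cderB (hP z _) (cder_cst (P 0) z)) _; last by rewrite subr0.
  by rewrite subr0.
have hDu := holo_D hu.
(* The second-order linear equation satisfied by [u], also valid where [D u] vanishes. *)
have ode z : nrm z < 12 * T ->
    D (D u) z = u z * Q z + D u z * (D Q z / (2 * Q z)).
  move=> hz; have zL := inL _ (in12 _ hz); have Q0 := Qn0 _ (in12 _ hz).
  have d1 := holoD hu zL; have d2 := holoD hDu zL; have d3 := holoD hQ zL.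
  have [u0|u0] := eqVneq (D u z) 0.
    have : (u z ^+ 2 - 1) * Q z = 0 by rewrite -eQ ?u0 ?expr0n // inL' // in12.
    move/eqP; rewrite mulf_eq0 (negPf Q0) orbF subr_eq0 => /eqP u1.
    rewrite u0 mul0r addr0 eQ1 //; last by rewrite inL' // in12.
    by rewrite mulrA -expr2 u1 mul1r.
  have e1 := cder_comp d2 (cderXn 2 (D u z)).
  have e2 := cderM (cderB (cder_comp d1 (cderXn 2 (u z))) (cder_cst 1 z)) d3.
  have e3 : near_pt z (fun w => D u w ^+ 2 = (u w ^+ 2 - 1) * Q w).
    have := near_disc zL; apply: near_imp => w hw; apply: eQ.
    by move: hw; rewrite subr0.
  have E := cder_uniq (cder_near e3 e1) e2; rewrite /= expr1 subr0 in E.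
  have E2 := eQ z (inL' _ (in12 _ hz)).
  have k : 2 * D u z * (D (D u) z * Q z - u z * Q z ^+ 2 - D u z * (D Q z / 2)) = 0.
    have -> : 2 * D u z * (D (D u) z * Q z - u z * Q z ^+ 2 - D u z * (D Q z / 2)) =
       Q z * (2 * D u z * D (D u) z) - 2 * u z * D u z * Q z ^+ 2 - D u z ^+ 2 * D Q z by field.
    by rewrite E E2; ring.
  move/eqP: k; rewrite mulf_eq0 mulf_eq0 pnatr_eq0 /= (negPf u0) /= => /eqP k.
  apply: (mulIf Q0); apply/subr0_eq; rewrite -[RHS]k; field.
  exact: Q0.
(* [A] is [exp (V + c)], the sum of [cosh] and [sinh] of [V + c], and [u - D u / W] is its inverse.
   Working with [A] avoids choosing a branch of the inverse hyperbolic cosine; the differential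
   equation becomes [D A = W * A]. *)
pose A z := u z + D u z / W z.
have dA z : nrm z < 12 * T -> cder A z (W z * A z).
  move=> hz; have zL := inL _ (in12 _ hz); have w0 := Wn0 _ hz.
  have d1 := holoD hu zL; have d2 := holoD hDu zL.
  apply: cder_eq (cderDD d1 (cderM d2 (cderV (dW z hz) w0))) _.
  have Q0 := Qn0 _ (in12 _ hz).
  by rewrite ode // /A -W2 //; field.
have AB z : nrm z < 12 * T -> A z * (u z - D u z / W z) = 1.
  move=> hz; have w0 := Wn0 _ hz.
  have -> : A z * (u z - D u z / W z) = u z ^+ 2 - D u z ^+ 2 / W z ^+ 2 by rewrite /A; field.
  rewrite eQ; last by rewrite inL' // in12.
  by rewrite W2 // mulfK ?Qn0 ?in12 //; ring.
have AE z : nrm z < 3 * T -> A z = A 0 * Cexp (V z).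
  move=> hz; have k : A z * Cexp (- V z) = A 0 * Cexp (- V 0).
    apply: (@disc_const _ 0 (3 * T) (fun z => A z * Cexp (- V z))) => [w|]; rewrite subr0 //.
    move=> hw; apply: cder_eq (cderM (dA w (in3 w hw)) (cder_comp (cderN (dV w hw)) (cder_Cexp _))) _.
    by ring.
  move: k; rewrite V0 oppr0 Cexp0 mulr1 => <-.
  by rewrite CexpN divfK // Cexp_neq0.
have Z12 : nrm (0 : C) < 12 * T by rewrite nrm0; lra.
have A00 : A 0 != 0.
  by apply: contra_eq_neq (AB 0 Z12) => ->; rewrite mul0r eq_sym oner_neq0.
have [n [t [n1 tT hit]]] := hits_integer A00.
have [h hh Vh] := near_id_onto T0 V0 dV (fun z hz => W1 z (in3 z hz)) tT.
have h3 : nrm h < 3 * T by lra.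
have h12 := in3 _ h3.
have uh : u h = n%:R.
  have Ah : A h = A 0 * Cexp t by rewrite AE // Vh.
  have Ah0 : A h != 0 by rewrite Ah mulf_neq0 // Cexp_neq0.
  have B : u h - D u h / W h = (A h)^-1 by apply: (mulfI Ah0); rewrite AB // mulfV.
  have : 2 * u h = 2 * n%:R by rewrite -hit -Ah -B /A; ring.
  by apply: mulfI; rewrite pnatr_eq0.
have hL : nrm h < L by apply: inL'; apply: in12.
(* At [h] the derivative vanishes while [Q] does not, so [n^2 = 1], against [n > 1]. *)
have := eQ h hL; rewrite (hn h n hL uh) uh expr0n /= => /esym/eqP.
rewrite mulf_eq0 (negPf (Qn0 _ (in12 _ h12))) orbF subr_eq0 -natrX.
by rewrite -[1]/(1%:R) eqr_nat; case: n n1 {hit uh} => [|[|n]].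
Qed.

End CoveringArgument.

(** * The derivative bound and Schottky's theorem *)

Section LandauSchottky.
Variable R : realType.
Local Notation C := R[i].
Implicit Types (f g : C -> C) (w z p : C).

Lemma sqr_eq1 z : z ^+ 2 = 1 -> z = 1 \/ z = -1.
Proof. by move/eqP; rewrite sqrf_eq1 => /orP[/eqP|/eqP]; [left|right]. Qed.

Lemma near_D0 f z c : near_pt z (fun w => f w = c) -> near_pt z (fun w => D f w = 0).
Proof.
move=> [d d0 h]; exists d => // w /(near_disc (p := z)) hw; apply: DE.
by apply: cder_near (cder_cst c w); apply: near_imp hw => x /h.
Qed.

(* The first branch is the limit of the quotient at a multiple point of [u = 1] or [u = -1]. *)
Definition cosh_quot (u : C -> C) z : C :=
  if u z ^+ 2 == 1 then u z * D (D u) z else D u z ^+ 2 / (u z ^+ 2 - 1).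

Lemma cosh_quot_holo p (r : R) (u : C -> C) : holo p r u ->
  (forall z, nrm (z - p) < r -> u z ^+ 2 = 1 -> D u z = 0) -> holo p r (cosh_quot u).
Proof.
move=> hu hD z hz.
have du := holoD hu hz; have cu := cder_cont du.
have r0 : 0 < r - nrm (z - p) by lra.
have huz : holo z (r - nrm (z - p)) u by apply: (holo_sub hu); lra.
have [/eqP e1|ne1] := boolP (u z ^+ 2 == 1); last first.
  have n1 : u z ^+ 2 - 1 != 0 by rewrite subr_eq0.
  have c1 : cder (fun w => u w ^+ 2 - 1) z (2 * u z ^+ 1 * D u z - 0).
    exact: (cderB (cder_comp du (cderXn 2 (u z))) (cder_cst 1 z)).
  have c2 := cder_comp (holoD (holo_D hu) hz) (cderXn 2 (D u z)).
  eexists; apply: cder_near (cderM c2 (cderV c1 n1)).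
  apply: near_imp (cont_near0 (cder_cont c1) n1) => w h.
  rewrite /cosh_quot; case: eqP => // h1; move: h.
  by rewrite h1 subrr nrm0 ltNge divr_ge0 ?nrm_ge0.
have e0 : u z != 0.
  by apply: contra_eq_neq e1 => ->; rewrite expr0n eq_sym oner_neq0.
have hf : holo z (r - nrm (z - p)) (fun w => u w - u z).
  by move=> w hw; eexists; apply: cderB (holoD huz hw) (cder_cst (u z) w).
have [nf|[m [s [g [/andP[s0 sr] hg fE]]]]] := zero_order r0 hf.
  have nu : near_pt z (fun w => u w = u z) by apply: near_imp nf => w /subr0_eq.
  exists 0; apply: cder_near (cder_cst 0 z).
  apply: near_imp (near_and nu (near_D0 (near_D0 nu))) => w [h1 h2].
  by rewrite /cosh_quot h1 e1 eqxx h2 mulr0.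
have zz : nrm (z - z) < s by rewrite subrr nrm0.
have [fz gz] := fE z zz.
have uE w : nrm (w - z) < s -> u w = u z + (w - z) ^+ m * g w.
  by move=> hw; have [<- _] := fE w hw; rewrite addrC subrK.
have duE w : nrm (w - z) < s -> D u w = m%:R * (w - z) ^+ m.-1 * g w + (w - z) ^+ m * D g w.
  move=> hw; apply: DE.
  have h1 := cder_comp (cder_subc z w) (cderXn m (w - z)).
  apply: cder_near (cder_eq (cderDD (cder_cst (u z) w) (cderM h1 (holoD hg hw))) _).
    by apply: near_imp (near_disc hw) => v /uE.
  by rewrite add0r mulr1.
(* Order [0] contradicts the vanishing of [u - u z] at [z], and order [1] contradicts [D u z = 0].
   For order [k + 2] one has [D u = (w - z)^(k+1) * h] and [u^2 - 1 = (w - z)^(k+2) * den], so the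
   quotient is [(w - z)^k * h^2 / den]. *)
case: m fz fE uE duE => [|[|k]] fz fE uE duE.
- by move: fz; rewrite subrr expr0 mul1r => /esym/eqP; rewrite (negPf gz).
- have := duE z zz; rewrite (hD z hz e1) subrr expr1 mul0r addr0 expr0 !mul1r.
  by move/esym/eqP; rewrite (negPf gz).
pose h w := k.+2%:R * g w + (w - z) * D g w.
have duE' w : nrm (w - z) < s -> D u w = (w - z) ^+ k.+1 * h w.
  by move=> /duE ->; rewrite /h /= [_ ^+ k.+2]exprS; ring.
pose den w := g w * (u w + u z).
have dh w : nrm (w - z) < s -> exists c, cder h w c.
  move=> hw; eexists; apply: cderDD (cderZ _ (holoD hg hw)) (cderM (cder_subc z w) _).
  exact: holoD (holo_D hg) hw.
have [c0 dden] : exists c, cder den z c.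
  by eexists; apply: cderM (holoD hg zz) (cderDD du (cder_cst _ _)).
have uz2 : u z + u z != 0 by rewrite -mulr2n mulrn_eq0 negb_or.
have den0 : den z != 0 by rewrite mulf_neq0.
have [c1 dhz] := dh z zz.
have hz' : h z = k.+2%:R * g z by rewrite /h subrr mul0r addr0.
have dX := cder_comp (cder_subc z z) (cderXn k (z - z)).
eexists; apply: cder_near (cderM (cderM dX (cder_comp dhz (cderXn 2 (h z)))) (cderV dden den0)).
have nden := cont_near0 (cder_cont dden) den0.
apply: near_imp (near_and nden (near_disc zz)) => w [h1 hw].
have denw : den w != 0 by rewrite -nrm_gt0; have := nrm_ge0 (den z); lra.
(* At [z] itself the formula must agree with the first branch of [cosh_quot]: both are [0] for
   [k > 0], and for [k = 0] they are [2 * g / u] and [2 * g * u], equal since [u^2 = 1]. *)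
have [->|wz] := eqVneq w z.
  rewrite /cosh_quot e1 eqxx subrr.
  have -> : D (D u) z = (k == 0)%:R * h z.
    apply: DE; have h2 := cder_comp (cder_subc z z) (cderXn k.+1 (z - z)).
    apply: cder_near (cder_eq (cderM h2 dhz) _).
      by apply: near_imp (near_disc zz) => v /duE'.
    by rewrite subrr !expr0n /= mul0r addr0 mulr1; case: (k) => [|k'] /=; ring.
  apply: (mulIf den0); rewrite -[LHS]mulrA mulVf // mulr1 expr0n.
  case: (k) hz' => [|k'] hz' /=; last by rewrite !mul0r mulr0 mul0r.
  rewrite !mul1r hz' /den.
  have -> : u z * (2 * g z) * (g z * (u z + u z)) = (2 * g z) ^+ 2 * u z ^+ 2 by ring.
  by rewrite e1 mulr1.
have wz0 : w - z != 0 by rewrite subr_eq0.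
have wk : (w - z) ^+ k != 0 by rewrite expf_neq0.
have E : u w ^+ 2 - 1 = (w - z) ^+ k.+2 * den w.
  by rewrite -e1 subr_sqr (uE w hw) addrC addKr /den (uE w hw); ring.
have En : u w ^+ 2 - 1 != 0 by rewrite E mulf_neq0 // expf_neq0.
rewrite /cosh_quot -subr_eq0 (negPf En) E (duE' w hw) !exprS.
by field; rewrite denw wk.
Qed.

(** The integers are where [exp (2 i pi u)] equals [1]. Among them [1] and [-1] are the zeros of
    [u^2 - 1], and those above [1] are the targets of the covering argument. *)
Definition double_at_integers (p : C) (r : R) (u : C -> C) :=
  forall z (n : nat), nrm (z - p) < r -> u z = n%:R \/ u z = - n%:R -> D u z = 0.

Lemma double_sqr1 p (r : R) u : double_at_integers p r u ->
  forall z, nrm (z - p) < r -> u z ^+ 2 = 1 -> D u z = 0.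
Proof. by move=> h z hz /sqr_eq1[e|e]; apply: (h z 1%N hz); [left|right]. Qed.

Lemma cosh_quotE p (r : R) u z : double_at_integers p r u -> nrm (z - p) < r ->
  D u z ^+ 2 = (u z ^+ 2 - 1) * cosh_quot u z.
Proof.
move=> h hz; rewrite /cosh_quot; case: eqP => [e|/eqP e].
  by rewrite e subrr mul0r (double_sqr1 h hz e) expr0n.
by rewrite mulrC divfK // subr_eq0.
Qed.

Lemma cder_rescale f a b z c : cder f (a + b * z) c -> cder (fun w => f (a + b * w)) z (b * c).
Proof. by move=> h; rewrite mulrC; apply: cder_comp (cder_affine a b z) h. Qed.

Lemma bigL_gt0 : 0 < bigL R.
Proof. by rewrite /bigL; have := netR_gt0 R; lra. Qed.

(** With [b^2 * q = 1], the function [u (z0 + b * w)] has the quotient [b^2 * cosh_quot u], equal to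
    [1] at the origin and bounded by [8]. It lives on a disc of radius [d * sqrt |q|]; were this
    larger than [bigL], [no_large_cosh_disc] would give a contradiction. *)
Lemma cosh_quot_center (u : C -> C) z0 (d : R) : 0 < d ->
  holo z0 d u -> double_at_integers z0 d u ->
  (forall w, nrm (w - z0) < d -> nrm (cosh_quot u w) <= 8 * nrm (cosh_quot u z0)) ->
  d ^+ 2 * nrm (cosh_quot u z0) <= bigL R ^+ 2.
Proof.
move=> d0 hu hd hq; rewrite leNgt; apply/negP => big.
have L0 := bigL_gt0.
set q := cosh_quot u z0 in hq big.
have q0 : q != 0.
  apply: contraTneq big => ->; rewrite nrm0 mulr0 -leNgt; exact: sqr_ge0.
have [b0 eb _] := Clog_exists q0.
pose b := Cexp (- (2^-1 * b0)).
have bq : b ^+ 2 * q = 1.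
  rewrite /b expr2 -CexpD -eb -CexpD.
  by rewrite (_ : _ + _ = 0) ?Cexp0 //; field.
have bL (z : C) : nrm z < bigL R -> nrm (b * z) < d.
  move=> hz; rewrite nrmM.
  have nb : nrm b ^+ 2 * nrm q = 1 by rewrite -nrmX -nrmM bq nrm1.
  have nq : 0 < nrm q by rewrite nrm_gt0.
  have nbE : nrm b ^+ 2 = (nrm q)^-1.
    by apply: (mulIf (lt0r_neq0 nq)); rewrite nb mulVf // gt_eqF.
  rewrite -(@ltr_sqr _ _ d) ?nnegrE ?mulr_ge0 ?nrm_ge0 ?(ltW d0) //.
  rewrite exprMn nbE ltr_pdivrMl // [ltRHS]mulrC; apply: lt_trans big.
  by rewrite ltr_sqr ?nnegrE ?nrm_ge0 ?(ltW L0).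
have bL' z : nrm z < bigL R -> nrm (z0 + b * z - z0) < d by move=> hz; rewrite addrC addKr bL.
have du z : nrm z < bigL R -> cder (fun w => u (z0 + b * w)) z (b * D u (z0 + b * z)).
  by move=> hz; apply/cder_rescale/holoD; [exact: hu|exact: bL'].
have Du z : nrm z < bigL R -> D (fun w => u (z0 + b * w)) z = b * D u (z0 + b * z).
  by move=> /du/DE.
have hQ := cosh_quot_holo hu (double_sqr1 hd).
apply: (@no_large_cosh_disc R (fun w => u (z0 + b * w)) (fun w => b ^+ 2 * cosh_quot u (z0 + b * w))).
- by move=> z; rewrite subr0 => hz; eexists; apply: du.
- move=> z; rewrite subr0 => hz; eexists; apply: cderZ; apply: cder_rescale.
  by apply: holoD hQ _; apply: bL'.
- by rewrite mulr0 addr0.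
- move=> z hz; have nb : nrm b ^+ 2 * nrm q = 1 by rewrite -nrmX -nrmM bq nrm1.
  rewrite nrmM nrmX; apply: le_trans (ler_wpM2l _ (hq _ (bL' z hz))) _.
    by rewrite exprn_ge0 ?nrm_ge0.
  by rewrite mulrCA nb mulr1.
- move=> z hz; rewrite Du // exprMn (cosh_quotE hd (bL' z hz)); ring.
- move=> z hz e; have -> : D (D (fun w => u (z0 + b * w))) z = b * (b * D (D u) (z0 + b * z)).
    apply: DE; apply: cder_near (cderZ b (cder_rescale (holoD (holo_D hu) (bL' z hz)))).
    have hz' : nrm (z - 0) < bigL R by rewrite subr0.
    by apply: near_imp (near_disc hz') => w; rewrite subr0 => /Du.
  by rewrite /cosh_quot e eqxx; ring.
by move=> z n hz e; rewrite Du // (hd _ n (bL' z hz)) ?mulr0 //; left.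
Qed.

Lemma landau : exists2 K : R, 1 <= K & forall u : C -> C, holo 0 1 u ->
  double_at_integers 0 1 u ->
  forall z, nrm z <= 4^-1 -> nrm (D u z) <= K * (1 + nrm (u z)).
Proof.
have L0 := bigL_gt0; have L2 : 0 < bigL R ^+ 2 by rewrite exprn_gt0.
pose K0 := 8 * bigL R ^+ 2.
exists (1 + 16 * K0) => [|u hu hd]; first by rewrite /K0; lra.
have hQ := cosh_quot_holo hu (double_sqr1 hd).
pose N z := (2^-1 - nrm z) ^+ 2 * nrm (cosh_quot u z).
have N0 z : 0 <= N z by rewrite mulr_ge0 ?sqr_ge0 ?nrm_ge0.
have main z : nrm z <= 2^-1 -> N z <= K0.
  move=> hz; rewrite leNgt; apply/negP => Nz.
  have [B hB] : exists B, forall z, nrm (z - 0) <= 2^-1 -> N z <= B.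
    apply: bounded_disc => w hw.
    have hw1 : nrm (w - 0) < 1 by lra.
    have cQ := cder_cont (holoD hQ hw1).
    exists (nrm (cosh_quot u w) + 1).
    apply: near_imp (cQ 1 ltr01) => v hv; rewrite subr0 => v2.
    have h1 : nrm (cosh_quot u v) <= nrm (cosh_quot u w) + 1.
      by have := nrm_triB (cosh_quot u v) (cosh_quot u w); lra.
    rewrite /N; apply: le_trans h1; rewrite ler_piMl ?nrm_ge0 // expr2.
    by have := nrm_ge0 v; nra.
  pose S := [set N z | z in [set z | nrm z <= 2^-1]].
  have supS : has_sup S.
    split; first by exists (N z), z.
    by exists B => _ [w hw <-]; apply: hB; rewrite subr0.
  pose s := sup S.
  have hs w : nrm w <= 2^-1 -> N w <= s.
    by move=> hw; apply: ub_le_sup; [case: supS|exists w].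
  have s0 : 0 < s / 2 by have := hs z hz; rewrite /K0 in Nz; lra.
  have [_ [z0 hz0 <-]] := sup_adherent s0 supS; rewrite -/s => Nz0.
  rewrite /= in hz0.
  have z0lt : nrm z0 < 2^-1.
    rewrite lt_neqAle hz0 andbT; apply/eqP => e; move: Nz0.
    by rewrite /N e subrr expr0n /= mul0r; lra.
  (* Within [d] of [z0] the distance to the circle of radius [1 / 2] is still at least [d]. Hence
     [d^2 * |Q w| <= N w <= s < 2 * N z0 = 8 * d^2 * |Q z0|], the factor [8] of [cosh_quot_center];
     its conclusion then gives [s < 8 * bigL^2]. *)
  pose d := (2^-1 - nrm z0) / 2; have d0 : 0 < d by rewrite /d; lra.
  have sub w : nrm (w - z0) < d -> nrm w < 1 /\ d <= 2^-1 - nrm w.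
    by move=> hw; have := nrmD (w - z0) z0; rewrite subrK; rewrite /d in d0 hw *; lra.
  have hud : holo z0 d u.
    by move=> w /sub[h _]; apply: hu; rewrite subr0.
  have hdd : double_at_integers z0 d u.
    by move=> w n /sub[h _]; apply: hd; rewrite subr0.
  have := cosh_quot_center d0 hud hdd.
  have Nd : N z0 = 4 * (d ^+ 2 * nrm (cosh_quot u z0)) by rewrite /N /d; field.
  have := hs z hz; rewrite /K0 in Nz => sz H.
  suff : d ^+ 2 * nrm (cosh_quot u z0) <= bigL R ^+ 2 by lra.
  apply: H => w hw; have [w1 wd] := sub w hw.
  have d2 : 0 < d ^+ 2 by rewrite exprn_gt0.
  rewrite -(ler_pM2l d2); apply: le_trans (_ : N w <= _).
    rewrite /N ler_wpM2r ?nrm_ge0 // ler_sqr ?nnegrE //; lra.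
  have : N w <= s by apply: hs; lra.
  lra.
move=> z hz; have z2 : nrm z <= 2^-1 by lra.
have z1 : nrm (z - 0) < 1 by rewrite subr0; lra.
(* For [|z| <= 1 / 4] the weight is at least [1 / 16]. *)
have q16 : nrm (cosh_quot u z) <= 16 * K0.
  have := main z z2; rewrite /N => h.
  have h2 : (4^-1) ^+ 2 <= (2^-1 - nrm z) ^+ 2.
    by rewrite ler_sqr ?nnegrE; lra.
  have := ler_wpM2r (nrm_ge0 (cosh_quot u z)) h2.
  have -> : (4^-1) ^+ 2 = 16^-1 :> R by field.
  lra.
have un := nrm_ge0 (u z).
have K0p : 0 < K0 by rewrite /K0; lra.
rewrite -ler_sqr ?nnegrE ?nrm_ge0 ?mulr_ge0; [|lra..].
rewrite -nrmX (cosh_quotE hd z1) nrmM exprMn.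
have h1 : nrm (u z ^+ 2 - 1) <= (1 + nrm (u z)) ^+ 2.
  apply: le_trans (nrmB _ _) _; rewrite nrmX nrm1; nra.
have h2 : 16 * K0 <= (1 + 16 * K0) ^+ 2 by nra.
rewrite mulrC; apply: ler_pM; rewrite ?nrm_ge0 //; lra.
Qed.

(** Let [s] be the supremum of [|u|] on the disc of radius [c = 1 / (4 * K)]. The derivative bound
    gives [s <= |u 0| + (1 + s) / 4], which is solved for [s]; this takes the place of integrating a
    differential inequality. *)
Lemma growth : exists2 c : R, 0 < c <= 4^-1 & forall u : C -> C, holo 0 1 u ->
  double_at_integers 0 1 u -> forall z, nrm z <= c -> nrm (u z) <= 2 * nrm (u 0) + 1.
Proof.
have [K K1 hK] := landau.
have c0 : 0 < (4 * K)^-1 by rewrite invr_gt0; lra.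
have c4 : (4 * K)^-1 <= 4^-1 by rewrite lef_pV2 ?posrE; lra.
exists (4 * K)^-1 => [|u hu hd]; first by rewrite c0.
set c := (4 * K)^-1 in c0 c4 *.
have Kc : K * c = 4^-1 by rewrite /c; field; rewrite gt_eqF //; lra.
have [B hB] : exists B, forall z, nrm (z - 0) <= c -> nrm (u z) <= B.
  apply: bounded_disc => w hw; have hw1 : nrm (w - 0) < 1 by lra.
  exists (nrm (u w) + 1).
  apply: near_imp (cder_cont (holoD hu hw1) ltr01) => v hv _.
  by have := nrm_triB (u v) (u w); lra.
pose S := [set nrm (u z) | z in [set z | nrm z <= c]].
have supS : has_sup S.
  split; first by exists (nrm (u 0)), 0 => //=; rewrite nrm0 ltW.
  by exists B => _ [w hw <-]; apply: hB; rewrite subr0.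
have hs w : nrm w <= c -> nrm (u w) <= sup S.
  by move=> hw; apply: ub_le_sup; [case: supS|exists w].
have step w : nrm w <= c -> nrm (u w) <= nrm (u 0) + 4^-1 * (1 + sup S).
  move=> hw; have seg (t : R) : 0 <= t <= 1 -> nrm (0 + t%:K * (w - 0)) <= c.
    move=> /andP[t0 t1]; rewrite add0r subr0 nrmM nrmK ger0_norm //.
    by apply: le_trans hw; rewrite ler_piMl ?nrm_ge0.
  have := @cder_nrm_le R u (D u) 0 w (K * (1 + sup S)).
  rewrite !subr0 => H; have := nrm_triB (u w) (u 0).
  have : nrm (u w - u 0) <= K * (1 + sup S) * nrm w.
    apply: H => t ht; have := seg t ht; rewrite subr0 => st.
      by apply: holoD hu _; rewrite subr0; lra.
    apply: le_trans (hK u hu hd _ _) _; first lra.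
    by rewrite ler_wpM2l ?lerD2l ?hs //; lra.
  have s0 : 0 <= sup S by apply: le_trans (nrm_ge0 (u 0)) (hs 0 _); rewrite nrm0 ltW.
  have : K * (1 + sup S) * nrm w <= K * (1 + sup S) * c.
    by rewrite ler_wpM2l // mulr_ge0; lra.
  have -> : K * (1 + sup S) * c = 4^-1 * (1 + sup S) by rewrite -Kc; ring.
  lra.
have sS : sup S <= nrm (u 0) + 4^-1 * (1 + sup S).
  apply: ge_sup; first by case: supS.
  by move=> _ [w hw <-]; apply: step.
move=> z /hs; have := nrm_ge0 (u 0); lra.
Qed.

Definition omits_doubles (p : C) (r : R) f :=
  forall z, nrm (z - p) < r -> f z != 0 /\ (f z = 1 -> D f z = 0).

(** [growth] is applied to [u = log f / (2 i pi)], rescaled by [1 / 4] because the logarithm is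
    built on the smaller disc. The condition [1 <= |f 0|] makes [ln |f 0|] nonnegative, so
    [ln M + pi] bounds the logarithm at the centre. *)
Lemma schottky_above : exists2 c : R, 0 < c <= 1 & forall M : R, exists M' : R,
  forall f, holo 0 1 f -> omits_doubles 0 1 f -> 1 <= nrm (f 0) <= M ->
  forall z, nrm z <= c -> nrm (f z) <= M'.
Proof.
have [c /andP[c0 c4] hc] := growth.
exists (c / 4) => [|M]; first lra.
have pi0 := pi_gt0 R.
exists (expR (2 * (ln M + pi) + 2 * pi)) => f hf hfd /andP[f1 fM] z hz.
have r4 : 0 < 4^-1 :> R by lra.
have E4 : 4 * 4^-1 = 1 :> R by field.
have Z1 : nrm (0 - 0 : C) < 1 by rewrite subrr nrm0.
have [l0 el0 [rel0 iml0]] := Clog_exists (hfd 0 Z1).1.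
have [|||l [l00 hl]] := @log_disc R 0 4^-1 f l0 r4.
- by rewrite E4.
- by rewrite E4 => w /hfd[].
- exact: el0.
pose k : C := (2 * pi)%:K * 'i%C.
have nk : nrm k = 2 * pi by rewrite nrmM nrmi mulr1 nrmK gtr0_norm //; lra.
have k0 : k != 0 by rewrite -nrm_gt0 nk; lra.
pose u w := k^-1 * l (0 + 4^-1 * w).
have in4 (w : C) : nrm (w - 0) < 1 -> nrm (0 + 4^-1 * w - 0) < 4^-1.
  by rewrite subr0 add0r subr0 nrmM nrmV nrm_nat => h; lra.
have lt41 : 4^-1 < 1 :> R by lra.
have du w : nrm (w - 0) < 1 ->
    cder u w (k^-1 * (4^-1 * (D f (0 + 4^-1 * w) / f (0 + 4^-1 * w)))).
  by move=> /in4/hl[h _]; apply/cderZ/cder_rescale.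
have hu : holo 0 1 u by move=> w /du h; eexists; apply: h.
have hd : double_at_integers 0 1 u.
  move=> w n hw uw; rewrite (DE (du w hw)).
  have [_ lw] := hl _ (in4 w hw); have hw1 := lt_trans (in4 w hw) lt41.
  have -> : D f (0 + 4^-1 * w) = 0; last by rewrite mul0r !mulr0.
  apply: (hfd _ hw1).2; rewrite -lw.
  have -> : l (0 + 4^-1 * w) = u w * k by rewrite /u mulrAC mulVf // mul1r.
  case: uw => ->; first exact: Cexp_2pi_nat.
  by rewrite mulNr CexpN Cexp_2pi_nat invr1.
have zE : z = 0 + 4^-1 * (4 * z) by rewrite add0r mulKf // pnatr_eq0.
have z4 : nrm (4 * z) <= c by rewrite nrmM nrm_nat; lra.
have hw1 : nrm (4 * z - 0) < 1 by rewrite subr0; lra.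
have [_ lw] := hl _ (in4 _ hw1).
rewrite zE -lw nrm_Cexp ler_expR.
apply: le_trans (ler_norm _) _; apply: le_trans (Re_le_nrm _) _.
have -> : l (0 + 4^-1 * (4 * z)) = u (4 * z) * k by rewrite /u mulrAC mulVf // mul1r.
rewrite nrmM nk.
have h1 := hc u hu hd _ z4.
have u0 : nrm (u 0) <= (2 * pi)^-1 * (ln M + pi).
  rewrite /u mulr0 addr0 l00 nrmM nrmV nk ler_wpM2l ?invr_ge0 //; first lra.
  apply: le_trans (nrm_le_ReIm _) _; apply: lerD => //.
  by rewrite rel0 ger0_norm ?ln_ge0 // ler_ln ?posrE //; lra.
have p2 : 0 < 2 * pi :> R by lra.
have := ler_wpM2r (ltW p2) h1.
have := ler_wpM2r (ltW p2) u0.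
rewrite [(2 * pi)^-1 * _]mulrC -mulrA mulVf ?gt_eqF // mulr1; lra.
Qed.

(** If [|f|] avoided [1] on the segment, the truth value of [|f| < 1] would be locally constant
    there, hence constant by bisection. *)
Lemma ivt_nrm f z : (forall t : R, 0 <= t <= 1 -> cont f (t%:K * z)) ->
  nrm (f 0) < 1 -> 1 < nrm (f z) -> exists2 t : R, 0 <= t <= 1 & nrm (f (t%:K * z)) = 1.
Proof.
move=> cf f0 fz; apply: contrapT => no.
have ne (t : R) : 0 <= t <= 1 -> nrm (f (t%:K * z)) != 1.
  by move=> ht; apply/eqP => e; apply: no; exists t.
pose s (t : R) := nrm (f (t%:K * z)) < 1.
have : s 0 = s 1; last by rewrite /s mul0r f0 mul1r ltNge (ltW fz).
apply: (@bisection1 R (fun x y => s x = s y)) => //.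
  by move=> x y _ -> ->.
move=> p hp; have e0 : 0 < `|nrm (f (p%:K * z)) - 1|.
  by rewrite normr_gt0 subr_eq0 ne.
have [d d0 hd] := cf p hp _ e0.
have l0 : 0 < nrm z + 1 by have := nrm_ge0 z; lra.
exists (d / (nrm z + 1)) => [|x y x0 xp py y1 yx]; first by rewrite divr_gt0.
have loc t : `|t - p| <= y - x -> s t = s p.
  move=> ht; have : nrm (f (t%:K * z) - f (p%:K * z)) < `|nrm (f (p%:K * z)) - 1|.
    apply: hd; rewrite -mulrBl -rmorphB nrmM nrmK.
    move: yx; rewrite ltr_pdivlMr // => yx.
    apply: le_lt_trans yx; apply: ler_pM; rewrite ?nrm_ge0 //; lra.
  have := nrm_triB (f (t%:K * z)) (f (p%:K * z)); have := nrm_triB (f (p%:K * z)) (f (t%:K * z)).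
  rewrite [nrm (f (p%:K * z) - _)]nrmBC /s.
  case: (ltP (nrm (f (p%:K * z))) 1) => h.
    by rewrite ltr0_norm ?subr_lt0 // => *; apply/idP; lra.
  by rewrite ger0_norm ?subr_ge0 // => *; apply/negbTE; rewrite -leNgt; lra.
by rewrite !loc // ler_norml; lra.
Qed.

(** If [|f 0| < 1 < |f z|], some point [p] between [0] and [z] has [|f p| = 1]. The function
    [f (p + w / 2)] satisfies the same hypotheses and is covered by [schottky_above] with the bound
    [1] at the centre. *)
Theorem schottky : exists2 c : R, 0 < c & forall M : R, exists M' : R,
  forall f, holo 0 1 f -> omits_doubles 0 1 f -> nrm (f 0) <= M ->
  forall z, nrm z <= c -> nrm (f z) <= M'.
Proof.
have [c /andP[c0 c1] hc] := schottky_above.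
exists (c / 4) => [|M]; first lra.
have [M1 h1] := hc 1; have [M2 h2] := hc M.
exists (Num.max 1 (Num.max M1 M2)) => f hf hfd fM z hz.
have [f1|f1] := leP 1 (nrm (f 0)).
  rewrite !le_max (h2 f) ?orbT // ?f1 //; lra.
have [fz|fz] := leP (nrm (f z)) 1; first by rewrite !le_max fz.
have seg (t : R) : 0 <= t <= 1 -> nrm (t%:K * z) <= 4^-1.
  move=> /andP[t0 t1]; rewrite nrmM nrmK ger0_norm //.
  by apply: le_trans (_ : nrm z <= _); [rewrite ler_piMl ?nrm_ge0|lra].
have [t ht ft] : exists2 t : R, 0 <= t <= 1 & nrm (f (t%:K * z)) = 1.
  apply: ivt_nrm => // t /seg ht.
  by apply: cder_cont (holoD hf _); rewrite subr0; lra.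
have zt := seg t ht.
pose p := t%:K * z.
have inD (w : C) : nrm (w - 0) < 1 -> nrm (p + 2^-1 * w - 0) < 1.
  rewrite !subr0 => hw; apply: le_lt_trans (nrmD _ _) _.
  rewrite -/p in zt; have -> : nrm (2^-1 * w) = 2^-1 * nrm w by rewrite nrmM nrmV nrm_nat.
  lra.
have dg w : nrm (w - 0) < 1 -> cder (fun w => f (p + 2^-1 * w)) w (2^-1 * D f (p + 2^-1 * w)).
  by move=> /inD hw; apply/cder_rescale/holoD; [exact: hf|].
have hg : holo 0 1 (fun w => f (p + 2^-1 * w)) by move=> w /dg h; eexists; apply: h.
have hgd : omits_doubles 0 1 (fun w => f (p + 2^-1 * w)).
  move=> w hw; have [a b] := hfd _ (inD w hw); split=> // /b e.
  by rewrite (DE (dg w hw)) e mulr0.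
rewrite !le_max; apply/orP; right; apply/orP; left.
have -> : f z = f (p + 2^-1 * (2 * (z - p))).
  by rewrite mulKf ?pnatr_eq0 // addrC subrK.
apply: h1 hg hgd _ _ _; first by rewrite mulr0 addr0 ft lexx.
have -> : z - p = (1 - t)%:K * z by rewrite /p rmorphB rmorph1; ring.
rewrite nrmM nrm_nat nrmM nrmK ger0_norm; last lra.
have : (1 - t) * nrm z <= nrm z by rewrite ler_piMl ?nrm_ge0 //; lra.
lra.
Qed.

End LandauSchottky.

(** * Homogeneous expansions in several variables *)

Section PolynomialInterpolation.
Variable R : realType.
Local Notation C := R[i].

(** Infinitely many distinct points of the unit disc: they interpolate in every degree, and a
    polynomial vanishing at all of them is zero. *)
Definition node (k : nat) : C := k.+1%:R^-1.

Lemma node_inj : injective node.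
Proof. by move=> k l /invr_inj/eqP; rewrite eqr_nat => /eqP[]. Qed.

Lemma nrm_node k : nrm (node k) <= 1.
Proof. by rewrite nrmV nrm_nat invf_le1 ?ltr0n // ler1n. Qed.

Lemma lagrange_basis d : exists L : 'I_d.+1 -> {poly C},
  [/\ forall k l : 'I_d.+1, (L k).[node l] = (k == l)%:R,
      forall k, (size (L k) <= d.+1)%N &
      forall p : {poly C}, (size p <= d.+1)%N -> forall s, p.[s] = \sum_(k < d.+1) p.[node k] * (L k).[s]].
Proof.
exists (fun k => tnth (lagrange d.+1 node) k : {poly C}); split.
- by move=> k l; apply: (lagrange_sample (ltn0Sn d) node_inj).
- by move=> k; rewrite (size_lagrange_ (ltn0Sn d) node_inj).
move=> p sp s; rewrite {1}(lagrange_gen (ltn0Sn d) node_inj sp) horner_sum.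
by apply: eq_bigr => k _; rewrite hornerM hornerC.
Qed.

Variable n : nat.
Local Notation point := (pt R n).

Definition upd (w : point) (j : 'I_n) (s : C) : point := fun j' => if j' == j then s else w j'.

Lemma supn_ge0 (w : point) : 0 <= supn w.
Proof.
rewrite /supn; elim/big_rec: _ => // j x _ x0.
by rewrite le_max x0 orbT.
Qed.

Lemma le_supn (w : point) j : nrm (w j) <= supn w.
Proof. by rewrite /supn (bigD1 j) //= le_max lexx. Qed.

Lemma supn_le (w : point) (M : R) : 0 <= M -> (forall j, nrm (w j) <= M) -> supn w <= M.
Proof.
by move=> M0 h; rewrite /supn; elim/big_rec: _ => // j x _ xM; rewrite ge_max h.
Qed.

Lemma supn_lt (w : point) (M : R) : 0 < M -> (forall j, nrm (w j) < M) -> supn w < M.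
Proof.
by move=> M0 h; rewrite /supn; elim/big_rec: _ => // j x _ xM; rewrite gt_max h.
Qed.

Lemma supn_scale (t : C) (w : point) : supn (fun j => t * w j) <= nrm t * supn w.
Proof.
apply: supn_le => [|j]; first by rewrite mulr_ge0 ?nrm_ge0 ?supn_ge0.
by rewrite nrmM ler_wpM2l ?nrm_ge0 ?le_supn.
Qed.

Lemma supn_upd (w : point) j s (M : R) : supn w <= M -> nrm s <= M -> supn (upd w j s) <= M.
Proof.
move=> wM sM; apply: supn_le; first exact: le_trans (nrm_ge0 s) sM.
move=> j'; rewrite /upd; case: eqP => // _; exact: le_trans (le_supn _ _) wM.
Qed.

(* A function agreeing with its interpolant of degree [<= d] in each variable separately
   agrees with its grid interpolant: the difference vanishes at the grid points, hence,
   one coordinate at a time, everywhere. *)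
Lemma separately_polynomial d (E : point -> C) :
  (forall (L : 'I_d.+1 -> {poly C}),
     (forall p : {poly C}, (size p <= d.+1)%N -> forall s, p.[s] = \sum_(k < d.+1) p.[node k] * (L k).[s]) ->
     forall w j, supn w <= 1 -> E w = \sum_(k < d.+1) E (upd w j (node k)) * (L k).[w j]) ->
  exists c : {ffun 'I_n -> 'I_d.+1} -> C, forall w, supn w <= 1 ->
    E w = \sum_(k : {ffun 'I_n -> 'I_d.+1}) c k * \prod_(j < n) w j ^+ k j.
Proof.
move=> slice; have [L [Lx sL Lp]] := lagrange_basis d.
have {}slice := slice L Lp.
pose P (w : point) := \sum_(k : {ffun 'I_n -> 'I_d.+1})
  E (fun j => node (k j)) * \prod_(j < n) (L (k j)).[w j].
have sliceP w j : P w = \sum_(l < d.+1) P (upd w j (node l)) * (L l).[w j].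
  rewrite /P; under [RHS]eq_bigr => l _ do rewrite mulr_suml.
  rewrite exchange_big /=; apply: eq_bigr => k _.
  rewrite [RHS](bigD1 (k j)) //= [X in _ + X]big1 => [|l lk].
    rewrite addr0 -mulrA; congr (_ * _).
    rewrite (bigD1 j) //= [in RHS](bigD1 j) //= /upd eqxx Lx eqxx mul1r mulrC.
    by congr (_ * _); apply: eq_bigr => j' /negPf ->.
  rewrite [X in _ * X * _](bigD1 j) //= /upd eqxx Lx eq_sym (negPf lk).
  by rewrite mul0r mulr0 mul0r.
have gridP (w : point) : (forall j, exists l : 'I_d.+1, w j = node l) -> E w = P w.
  move=> /choice[k hk]; pose k0 := [ffun j => k j].
  have wE : w = fun j => node (k0 j) by apply/funext => j; rewrite hk ffunE.
  rewrite /P (bigD1 k0) //= [X in _ + X]big1 => [|k' kk'].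
    rewrite addr0 big1 ?mulr1 -?wE // => j _.
    by rewrite wE Lx eqxx.
  have [j kj] : exists j, k' j != k0 j.
    apply/existsP; apply: contraNT kk' => /existsPn h; apply/eqP/ffunP => j.
    by have := h j; rewrite negbK => /eqP.
  by rewrite (bigD1 j) //= {1}wE Lx (negPf kj) mul0r mulr0.
have EP w : supn w <= 1 -> E w = P w.
  pose bad (w : point) := [set j | ~~ [exists l : 'I_d.+1, w j == node l]]%SET.
  move: {2}(#|bad w|).+1 (ltnSn #|bad w|) => m; elim: m w => // m IH w.
  rewrite ltnS => bm w1.
  have [b0|[j bj]] := set_0Vmem (bad w).
    apply: gridP => j; have : j \notin bad w by rewrite b0 inE.
    by rewrite inE negbK => /existsP[l /eqP]; exists l.
  rewrite (slice w j w1) (sliceP w j); apply: eq_bigr => k _; congr (_ * _).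
  apply: IH; last by rewrite supn_upd // nrm_node.
  apply: leq_trans bm; apply: proper_card; apply/properP; split.
    apply/fintype.subsetP => j'; rewrite !inE /upd; case: eqP => // _ /negP[].
    by apply/existsP; exists k.
  exists j => //; rewrite inE negbK; apply/existsP; exists k.
  by rewrite /upd eqxx.
exists (fun l : {ffun 'I_n -> 'I_d.+1} => \sum_(k : {ffun 'I_n -> 'I_d.+1})
  E (fun j => node (k j)) * \prod_(j < n) (L (k j))`_(l j)) => w w1.
rewrite (EP w w1) /P; under [RHS]eq_bigr => l _ do rewrite mulr_suml.
rewrite exchange_big /=; apply: eq_bigr => k _.
under eq_bigr => j _ do rewrite (horner_coef_wide _ (sL (k j))).
rewrite bigA_distr_bigA mulr_sumr; apply: eq_bigr => l _.
by rewrite -mulrA -big_split.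
Qed.

(** For fixed [w], restricting the polynomial to the multiples [t * w] gives a polynomial in [t]
    equal to [t^d * E w] at every node, hence identically. Comparing coefficients of [t^d] keeps the
    monomials of total degree [d] only. *)
Lemma homogeneous_part d (E : point -> C) (c : {ffun 'I_n -> 'I_d.+1} -> C) :
  (forall w, supn w <= 1 -> E w = \sum_(k : {ffun 'I_n -> 'I_d.+1}) c k * \prod_(j < n) w j ^+ k j) ->
  (forall w (m : nat), supn w <= 1 -> E (fun j => node m * w j) = node m ^+ d * E w) ->
  exists c' : ('I_n -> nat) -> C, forall w, supn w <= 1 -> E w = hpart c' d w.
Proof.
move=> hE hom.
exists (fun k => c [ffun j => inord (k j)]) => w w1.
pose deg (k : {ffun 'I_n -> 'I_d.+1}) := (\sum_(j < n) (k j : nat))%N.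
pose m (k : {ffun 'I_n -> 'I_d.+1}) := c k * \prod_(j < n) w j ^+ k j.
pose p : {poly C} := \sum_(k : {ffun 'I_n -> 'I_d.+1}) (m k)%:P * 'X^(deg k) - (E w)%:P * 'X^d.
have proot l : root p (node l).
  have nw : supn (fun j => node l * w j) <= 1.
    apply: le_trans (supn_scale _ _) _; rewrite -[leRHS]mulr1.
    by apply: ler_pM; rewrite ?nrm_ge0 ?supn_ge0 ?nrm_node.
  rewrite rootE hornerD hornerN horner_sum hornerM hornerC hornerXn mulrC -hom // hE //.
  rewrite subr_eq0; apply/eqP/eq_bigr => k _; rewrite hornerM hornerC hornerXn /m -mulrA.
  congr (_ * _); under [RHS]eq_bigr => j _ do rewrite exprMn.
  by rewrite big_split /= -expr_sum mulrC.
have p0 : p = 0.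
  apply: (@roots_geq_poly_eq0 _ p [seq node l | l <- iota 0 (size p)]).
  - by apply/allP => _ /mapP[l _ ->].
  - by rewrite map_inj_uniq ?iota_uniq //; apply: node_inj.
  - by rewrite size_map size_iota.
have := congr1 (fun q : {poly C} => q`_d) p0.
rewrite /p coefB coef_sum coef0 coefCM coefXn eqxx mulr1 => /subr0_eq <-.
rewrite /hpart [RHS]big_mkcond; apply: eq_bigr => k _.
rewrite coefCM coefXn /m eq_sym -/(deg k); case: ifP => _; last by rewrite mulr0.
rewrite mulr1; congr (c _ * _); apply/ffunP => j; rewrite ffunE.
by apply: val_inj; rewrite /= inordK.
Qed.

Lemma hpart_scale (c : ('I_n -> nat) -> C) d (t : C) (w : point) :
  hpart c d (fun j => t * w j) = t ^+ d * hpart c d w.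
Proof.
rewrite /hpart mulr_sumr; apply: eq_bigr => k /eqP kd; rewrite mulrCA; congr (_ * _).
under eq_bigr => j _ do rewrite exprMn.
by rewrite big_split /= -expr_sum kd.
Qed.

Lemma hpart_coef_scale (c : ('I_n -> nat) -> C) d (t : C) (w : point) :
  hpart (fun k => c k * t ^+ (\sum_(j < n) k j)) d w = t ^+ d * hpart c d w.
Proof.
by rewrite /hpart mulr_sumr; apply: eq_bigr => k /eqP kd; rewrite kd; ring.
Qed.

Lemma hpart0 (c : ('I_n -> nat) -> C) (w v : point) : hpart c 0 w = hpart c 0 v.
Proof.
rewrite /hpart; apply: eq_bigr => k _; congr (_ * _).
by apply: eq_bigr => j _; rewrite ord1 !expr0.
Qed.

Lemma hpart_ext (c c' : ('I_n -> nat) -> C) d (w : point) :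
  (forall k : 'I_n -> nat, (\sum_(j < n) k j)%N = d -> c k = c' k) -> hpart c d w = hpart c' d w.
Proof. by move=> h; rewrite /hpart; apply: eq_bigr => k /eqP kd; rewrite h. Qed.

End PolynomialInterpolation.

(** * Taylor expansion along rays and its homogeneous parts *)

Section HomogeneousExpansion.
Variables (R : realType) (n : nat).
Local Notation C := R[i].
Local Notation point := (pt R n).

Definition grad (f : point -> C) (p : point) (c : 'I_n -> C) :=
  forall e : R, 0 < e -> exists2 d : R, 0 < d & forall h : point, supn h < d ->
    nrm (f (ptadd p h) - f p - \sum_(j < n) c j * h j) <= e * supn h.

Lemma cder_line (f : point -> C) (p v : point) t c :
  grad f (fun j => p j + t * v j) c ->
  cder (fun s => f (fun j => p j + s * v j)) t (\sum_(j < n) c j * v j).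
Proof.
move=> hf; apply/cderP => e e0.
have l0 : 0 < supn v + 1 by have := supn_ge0 v; lra.
have [d d0 hd] := hf _ (divr_gt0 e0 l0).
exists (d / (supn v + 1)) => [|s]; first by rewrite divr_gt0.
rewrite ltr_pdivlMr // => hs.
have sv : supn (fun j => (s - t) * v j) <= nrm (s - t) * supn v by apply: supn_scale.
have hv : nrm (s - t) * supn v <= nrm (s - t) * (supn v + 1).
  by rewrite ler_wpM2l ?nrm_ge0 //; lra.
have := hd (fun j => (s - t) * v j); move=> /(_ ltac:(lra)).
have -> : ptadd (fun j => p j + t * v j) (fun j => (s - t) * v j) = fun j => p j + s * v j.
  by apply/funext => j; rewrite /ptadd; ring.
have -> : \sum_(j < n) c j * ((s - t) * v j) = (\sum_(j < n) c j * v j) * (s - t).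
  by rewrite mulr_suml; apply: eq_bigr => j _; ring.
move=> h; apply: le_trans h _.
have E : e / (supn v + 1) * (nrm (s - t) * (supn v + 1)) = e * nrm (s - t).
  by field; rewrite gt_eqF.
rewrite -E ler_wpM2l ?divr_ge0 ?(ltW e0) ?(ltW l0) //; lra.
Qed.

Lemma ex_cder_sum I (r : seq I) (P : pred I) (F : I -> C -> C) z :
  (forall i, exists c, cder (F i) z c) -> exists c, cder (fun s => \sum_(i <- r | P i) F i s) z c.
Proof.
move=> h; elim: r => [|i r [c IH]].
  by exists 0; apply: cder_near (cder_cst 0 z); exists 1 => // w _; rewrite big_nil.
have [c' hc'] := h i; case Pi : (P i).
  by eexists; apply: cder_near (cderDD hc' IH); exists 1 => // w _; rewrite big_cons Pi.
by eexists; apply: cder_near IH; exists 1 => // w _; rewrite big_cons Pi.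
Qed.

Lemma ex_cder_prod I (r : seq I) (P : pred I) (F : I -> C -> C) z :
  (forall i, exists c, cder (F i) z c) -> exists c, cder (fun s => \prod_(i <- r | P i) F i s) z c.
Proof.
move=> h; elim: r => [|i r [c IH]].
  by exists 0; apply: cder_near (cder_cst 1 z); exists 1 => // w _; rewrite big_nil.
have [c' hc'] := h i; case Pi : (P i).
  by eexists; apply: cder_near (cderM hc' IH); exists 1 => // w _; rewrite big_cons Pi.
by eexists; apply: cder_near IH; exists 1 => // w _; rewrite big_cons Pi.
Qed.

Lemma ex_cder_hpart (c : ('I_n -> nat) -> C) k (p v : point) z :
  exists d, cder (fun s => hpart c k (fun j => p j + s * v j)) z d.
Proof.
apply: ex_cder_sum => l.
have [d hd] : exists d, cder (fun s => \prod_(j < n) (p j + s * v j) ^+ l j) z d.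
  apply: ex_cder_prod => j; eexists.
  apply: (@cder_comp _ (fun s => p j + s * v j) (fun x => x ^+ l j)); last exact: cderXn.
  by apply: cder_near (cder_affine (p j) (v j) z); exists 1 => // w _; rewrite mulrC.
by eexists; apply: cderZ hd.
Qed.

(** The interpolation formula survives uniform limits: an error [e] in the approximation causes a
    defect of at most [e * (1 + sum of |L_k s|)]. *)
Lemma approx_interpolation d (E : C -> C) (L : 'I_d.+1 -> {poly C}) :
  (forall p : {poly C}, (size p <= d.+1)%N ->
     forall s, p.[s] = \sum_(k < d.+1) p.[node R k] * (L k).[s]) ->
  (forall e : R, 0 < e -> exists2 p : {poly C}, (size p <= d.+1)%N &
     forall s, nrm s <= 1 -> nrm (E s - p.[s]) <= e) ->
  forall s, nrm s <= 1 -> E s = \sum_(k < d.+1) E (node R k) * (L k).[s].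
Proof.
move=> Lp app s s1; apply/subr0_eq/nrm_small => e e0.
pose K := 1 + \sum_(k < d.+1) nrm ((L k).[s]).
have K0 : 0 < K by rewrite /K ltr_wpDr // sumr_ge0 // => k _; apply: nrm_ge0.
have [p sp hp] := app _ (divr_gt0 e0 K0).
have -> : E s - \sum_(k < d.+1) E (node R k) * (L k).[s] =
   (E s - p.[s]) - \sum_(k < d.+1) (E (node R k) - p.[node R k]) * (L k).[s].
  have -> : \sum_(k < d.+1) (E (node R k) - p.[node R k]) * (L k).[s] =
     \sum_(k < d.+1) E (node R k) * (L k).[s] - p.[s].
    by rewrite (Lp p sp s) -sumrB; apply: eq_bigr => k _; rewrite mulrBl.
  ring.
apply: le_trans (nrmB _ _) _.
have -> : e = e / K * 1 + e / K * \sum_(k < d.+1) nrm ((L k).[s]).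
  by rewrite -mulrDr -/K divfK // gt_eqF.
apply: lerD; first by rewrite mulr1 hp.
apply: le_trans (nrm_sum _) _; rewrite mulr_sumr; apply: ler_sum => k _.
by rewrite nrmM ler_wpM2r ?nrm_ge0 ?hp ?nrm_node.
Qed.

Section BoundedFunction.
Variables (G : point -> C) (M : R).
Hypothesis dG : forall w, supn w < 20 -> exists c, grad G w c.
Hypothesis GM : forall w, supn w < 20 -> nrm (G w) <= M.

Let ray (w : point) (t : C) := G (fun j => t * w j).
Let is_taylor (w : point) (a : nat -> C) := [/\ a 0%N = G (fun=> 0), a 1%N = D (ray w) 0 &
  forall t, nrm t <= 2 -> forall N, nrm (ray w t - \sum_(k < N) a k * t ^+ k) <= 4 * M * (nrm t / 4) ^+ N].

(** For [supn w <= 1] the ray stays in the domain when [|t| < 16], so [taylor'] applies with [r = 4]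
    and the expansion holds for [|t| <= 2]; at [t = 1] its ratio is [1 / 4]. *)
Lemma ray_taylor w : supn w <= 1 -> exists a, is_taylor w a.
Proof.
move=> w1.
have sup_ray t : nrm (t - 0) < 4 * 4 -> supn (fun j => t * w j) < 20.
  rewrite subr0 => ht; apply: le_lt_trans (supn_scale _ _) _.
  have := nrm_ge0 t; have : nrm t * supn w <= nrm t * 1 by rewrite ler_wpM2l ?nrm_ge0.
  lra.
have [|t ht|t ht|a [a0 a1 _ ha]] := @taylor' R 0 4 (ray w) M; first lra.
- have [c hc] := dG (sup_ray t ht); exists (\sum_(j < n) c j * w j).
  have : grad G (fun j => 0 + t * w j) c.
    by rewrite (_ : (fun j => 0 + t * w j) = fun j => t * w j) //; apply/funext => j; rewrite add0r.
  move/cder_line; apply: cder_near; exists 1 => // s _.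
  by congr G; apply/funext => j; rewrite add0r.
- exact: GM (sup_ray t ht).
exists a; split=> //.
  by rewrite a0 /ray; congr G; apply/funext => j; rewrite mul0r.
move=> t ht N; have := ha t; rewrite subr0 => h; apply: h; lra.
Qed.

Lemma M_ge0 : 0 <= M.
Proof.
apply: le_trans (nrm_ge0 _) (GM (w := fun=> 0) _).
by apply: supn_lt => [|j]; rewrite ?nrm0; lra.
Qed.

(** Uniqueness of Taylor coefficients: the expansions along [w] and along a multiple of [w] describe
    the same function of [t]. Once the lower coefficients agree, the difference in degree [i] is
    [O (t)], and [t] is taken small. *)
Lemma taylor_coef_homogeneous (a : point -> nat -> C) :
  (forall w, supn w <= 1 -> is_taylor w (a w)) ->
  forall i w m, supn w <= 1 -> a (fun j => node R m * w j) i = node R m ^+ i * a w i.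
Proof.
move=> ha; have M0 := M_ge0; elim/ltn_ind => i IH w m w1.
set x := node R m; have x1 : nrm x <= 1 by apply: nrm_node.
have xw1 : supn (fun j => x * w j) <= 1.
  apply: le_trans (supn_scale _ _) _; rewrite -[leRHS]mulr1.
  by apply: ler_pM; rewrite ?nrm_ge0 ?supn_ge0.
have [_ _ h1] := ha _ xw1; have [_ _ h2] := ha _ w1.
apply/subr0_eq/nrm_small => e e0.
pose t : R := Num.min 1 (e / (2 * M + 1)).
have t0 : 0 < t by rewrite lt_min ltr01 divr_gt0 //; lra.
have [t1 te] : t <= 1 /\ 2 * M * t <= e.
  have : t <= t by []; rewrite {2}/t le_min => /andP[-> h]; split=> //.
  move: h; rewrite ler_pdivlMr; last lra.
  have : 0 <= t by lra.
  lra.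
have nt : nrm (t%:K : C) = t by rewrite nrmK gtr0_norm.
have := h1 t%:K; rewrite nt => /(_ ltac:(lra) i.+1); rewrite big_ord_recr /=.
have := h2 (x * t%:K); rewrite nrmM nt.
have xt : nrm x * t <= t by rewrite ler_piMl // ltW.
move=> /(_ ltac:(lra) i.+1); rewrite big_ord_recr /=.
have -> : ray (fun j => x * w j) t%:K = ray w (x * t%:K).
  by rewrite /ray; congr G; apply/funext => j; ring.
have -> : \sum_(k < i) a (fun j => x * w j) k * t%:K ^+ k = \sum_(k < i) a w k * (x * t%:K) ^+ k.
  by apply: eq_bigr => k _; rewrite IH // exprMn -/x; ring.
set g := ray w _; set S := \sum_(k < i) _ => k1 k2.
have ti : 0 < t ^+ i by rewrite exprn_gt0.
have k3 : nrm (a (fun j => x * w j) i - x ^+ i * a w i) * t ^+ i <= 8 * M * (t / 4) ^+ i.+1.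
  rewrite -{1}nt -nrmX -nrmM.
  have -> : (a (fun j => x * w j) i - x ^+ i * a w i) * t%:K ^+ i =
     (g - (S + a w i * (x * t%:K) ^+ i)) - (g - (S + a (fun j => x * w j) i * t%:K ^+ i)).
    by rewrite exprMn; ring.
  apply: le_trans (nrmB _ _) _.
  have : 4 * M * (nrm x * t / 4) ^+ i.+1 <= 4 * M * (t / 4) ^+ i.+1.
    rewrite ler_wpM2l ?lerXn2r ?nnegrE ?divr_ge0 ?mulr_ge0 ?nrm_ge0 ?ler_pM2r ?invr_gt0 //; lra.
  lra.
rewrite -(ler_pM2r ti); apply: le_trans k3 _.
have f4 : (4^-1) ^+ i <= 1 :> R by rewrite exprn_ile1 //; lra.
have -> : 8 * M * (t / 4) ^+ i.+1 = 2 * M * t * (t ^+ i * 4^-1 ^+ i).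
  by rewrite exprS expr_div_n exprVn; field.
apply: ler_pM => //; rewrite ?mulr_ge0 ?exprn_ge0 ?(ltW t0) //.
by rewrite ler_piMr // ltW.
Qed.

(* With [t = 1 / l], the function [T] below is holomorphic of growth [l ^ i] on a disc of
   radius [l] in the [j]-th variable, so its Taylor polynomial of degree [i] is within [O(1 / l)]. *)
Lemma taylor_coef_slice (a : point -> nat -> C) i (c : nat -> ('I_n -> nat) -> C) w j :
  (forall w, supn w <= 1 -> is_taylor w (a w)) ->
  (forall k, (k < i)%N -> forall w, supn w <= 1 -> a w k = hpart (c k) k w) ->
  supn w <= 1 -> forall e : R, 0 < e -> exists2 p : {poly C}, (size p <= i.+1)%N &
     forall s, nrm s <= 1 -> nrm (a (upd w j s) i - p.[s]) <= e.
Proof.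
move=> ha hc w1 e e0; have M0 := M_ge0.
(* [T] is within [4 * M / l] of the coefficient and within [64 * M / l] of its Taylor polynomial,
   hence [68]. The [8] puts the unit disc inside the half disc where the Taylor estimate holds. *)
pose l : R := 8 + 68 * M / e.
have l8 : 8 <= l by rewrite /l lerDl divr_ge0 ?(ltW e0) //; lra.
have lM : 68 * M / l <= e.
  rewrite ler_pdivrMr; last lra.
  by rewrite /l mulrDr [e * (_ / e)]mulrC divfK ?gt_eqF //; lra.
clearbody l; have l0 : 0 < l by lra.
have li : 0 < l ^+ i by rewrite exprn_gt0.
pose t : C := l^-1%:K.
have nt : nrm t = l^-1 by rewrite nrmK gtr0_norm // invr_gt0.
have tl : l^-1 <= 8^-1 by rewrite lef_pV2 ?posrE //; lra.
have t0 : t != 0 by rewrite -nrm_gt0 nt invr_gt0.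
pose T (v : point) := t ^- i * (G (fun j => t * v j) - \sum_(k < i) hpart (c k) k v * t ^+ k).
pose v0 : point := upd w j 0; pose v1 : point := fun j' => if j' == j then 1 else 0.
have updE s : upd w j s = fun j' => v0 j' + s * v1 j'.
  by apply/funext => j'; rewrite /v0 /v1 /upd; case: eqP => _; ring.
have supl s : nrm s < l -> supn (upd w j s) <= l by move=> hs; apply: supn_upd; lra.
have supt s : nrm s < l -> supn (fun j' => t * upd w j s j') <= 1.
  move=> hs; apply: le_trans (supn_scale _ _) _; rewrite nt ler_pdivrMl // mulr1.
  exact: supl.
have TB s : nrm s < l -> nrm (T (upd w j s)) <= 4 * M * (l / 4) ^+ i.
  move=> hs; have [_ _ h] := ha _ (supt s hs).
  have := h 1; rewrite nrm1 => /(_ ltac:(lra) i).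
  rewrite /ray; have -> : (fun j' => 1 * (t * upd w j s j')) = fun j' => t * upd w j s j'.
    by apply/funext => j'; rewrite mul1r.
  have -> : \sum_(k < i) a (fun j' => t * upd w j s j') k * 1 ^+ k =
      \sum_(k < i) hpart (c k) k (upd w j s) * t ^+ k.
    by apply: eq_bigr => k _; rewrite hc ?supt // hpart_scale expr1n mulr1 mulrC.
  move=> hT; rewrite /T nrmM nrmV nrmX nt exprVn invrK.
  apply: le_trans (ler_wpM2l (ltW li) hT) _.
  by rewrite le_eqVlt; apply/orP; left; apply/eqP; rewrite !expr_div_n expr1n; ring.
have TE s : nrm s <= 1 -> nrm (a (upd w j s) i - T (upd w j s)) <= 4 * M / l.
  move=> hs; have sw : supn (upd w j s) <= 1 by apply: supn_upd.
  have [_ _ h] := ha _ sw.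
  have := h t; rewrite nt => /(_ ltac:(lra) i.+1); rewrite big_ord_recr /=.
  have -> : \sum_(k < i) a (upd w j s) k * t ^+ k =
      \sum_(k < i) hpart (c k) k (upd w j s) * t ^+ k.
    by apply: eq_bigr => k _; rewrite hc.
  rewrite /ray; set g := G _; set S := \sum_(k < i) _ => hT.
  have ti0 : t ^+ i != 0 by rewrite expf_neq0.
  have -> : a (upd w j s) i - T (upd w j s) = - (t ^- i * (g - (S + a (upd w j s) i * t ^+ i))).
    by rewrite /T -/g -/S; field.
  rewrite nrmN nrmM nrmV nrmX nt exprVn invrK.
  apply: le_trans (ler_wpM2l (ltW li) hT) _.
  have -> : l ^+ i * (4 * M * (l^-1 / 4) ^+ i.+1) = M / l * 4^-1 ^+ i.
    by rewrite exprS expr_div_n !exprVn; field; rewrite !gt_eqF.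
  have f4 : 4^-1 ^+ i <= 1 :> R by rewrite exprn_ile1 //; lra.
  have Ml : 0 <= M / l by rewrite divr_ge0 // ltW.
  by have := ler_wpM2l Ml f4; lra.
have Thol : holo 0 (4 * (l / 4)) (fun s => T (upd w j s)).
  have -> : 4 * (l / 4) = l by field.
  move=> s; rewrite subr0 => hs.
  have [c1 h1] : exists c1, cder (fun s => G (fun j' => t * upd w j s j')) s c1.
    have [|c2 hc2] := @dG (fun j' => t * upd w j s j'); first by have := supt s hs; lra.
    have E x : (fun j' => t * upd w j x j') = fun j' => t * v0 j' + x * (t * v1 j').
      by rewrite updE; apply/funext => j'; ring.
    rewrite E in hc2; eexists; apply: cder_near (cder_line hc2).
    by exists 1 => // x _; rewrite E.
  have [c2 h2] : exists c2, cder (fun s => \sum_(k < i) hpart (c k) k (upd w j s) * t ^+ k) s c2.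
    apply: ex_cder_sum => k; have [c3 h3] := ex_cder_hpart (c k) k v0 v1 s.
    eexists; apply: cder_near (cderM h3 (cder_cst (t ^+ k) s)).
    by exists 1 => // x _; rewrite updE.
  by eexists; apply: cderZ; apply: cderB h1 h2.
have r0 : 0 < l / 4 by lra.
have [|b [_ _ _ hb]] := taylor' r0 Thol (M := 4 * M * (l / 4) ^+ i).
  by move=> s; rewrite subr0 => hs; apply: TB; lra.
exists (\poly_(k < i.+1) b k); first exact: size_poly.
move=> s s1; rewrite horner_poly.
have := hb s; rewrite subr0 => /(_ ltac:(lra) i.+1) hbs.
have Ts := TE s s1.
apply: le_trans (nrm_tri3 (T (upd w j s)) _ _) _.
have : 4 * (4 * M * (l / 4) ^+ i) * (nrm s / (l / 4)) ^+ i.+1 <= 64 * M / l.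
  have -> : 4 * (4 * M * (l / 4) ^+ i) * (nrm s / (l / 4)) ^+ i.+1 =
     64 * M / l * nrm s ^+ i.+1.
    rewrite exprS [X in _ = _ * X]exprS !expr_div_n; field.
    by rewrite !gt_eqF // exprn_gt0.
  rewrite ler_piMr ?exprn_ile1 ?nrm_ge0 // divr_ge0 ?(ltW l0) //; lra.
have E68 : 68 * M / l = 4 * M / l + 64 * M / l by field; rewrite gt_eqF.
rewrite E68 in lM; lra.
Qed.

Theorem homogeneous_expansion : exists c : ('I_n -> nat) -> C, forall w, supn w <= 1 ->
  [/\ hpart c 0 w = G (fun=> 0), hpart c 1 w = D (fun t => G (fun j => t * w j)) 0 &
      forall N, nrm (G w - \sum_(k < N) hpart c k w) <= 4 * M * 4^-1 ^+ N].
Proof.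
have exa w : exists b, supn w <= 1 -> is_taylor w b.
  have [w1|w1] := pselect (supn w <= 1); last by exists (fun=> 0).
  by have [b hb] := ray_taylor w1; exists b.
have [a ha] := choice exa.
have hom := taylor_coef_homogeneous ha.
have poly i : exists c, forall w, supn w <= 1 -> a w i = hpart c i w.
  elim/ltn_ind: i => i IH.
  have exc k : exists b, (k < i)%N -> forall w, supn w <= 1 -> a w k = hpart b k w.
    have [/IH[b hb]|ki] := boolP (k < i)%N; first by exists b.
    by exists (fun=> 0).
  have [c hc] := choice exc.
  have [c1 hc1] : exists c : {ffun 'I_n -> 'I_i.+1} -> C, forall w, supn w <= 1 ->
      a w i = \sum_(k : {ffun 'I_n -> 'I_i.+1}) c k * \prod_(j < n) w j ^+ k j.
    apply: (@separately_polynomial R n i (fun w => a w i)) => L Lp w j w1.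
    have <- : upd w j (w j) = w by apply/funext => j'; rewrite /upd; case: eqP => // ->.
    have wj : nrm (w j) <= 1 by apply: le_trans (le_supn w j) w1.
    rewrite {1}(approx_interpolation Lp (@taylor_coef_slice a i c w j ha hc w1) wj).
    apply: eq_bigr => k _; congr (a _ i * _); last by rewrite /upd eqxx.
    by apply/funext => j'; rewrite /upd; case: eqP.
  exact: homogeneous_part hc1 (hom i).
have [c hc] := choice poly.
(* The families obtained degree by degree merge into one: a multi-index reads its coefficient in the
   family of its own total degree. *)
exists (fun k => c (\sum_(j < n) k j)%N k) => w w1.
have hE d : hpart (fun k => c (\sum_(j < n) k j)%N k) d w = a w d.
  by rewrite hc //; apply: hpart_ext => k ->.
have [a0 a1 h] := ha w w1; split; rewrite ?hE // => N.
have := h 1; rewrite nrm1 => /(_ ltac:(lra) N).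
rewrite /ray; have -> : (fun j => 1 * w j) = w by apply/funext => j; rewrite mul1r.
rewrite mul1r; congr (nrm (_ - _) <= _).
by apply: eq_bigr => k _; rewrite hE expr1n mulr1.
Qed.

End BoundedFunction.

End HomogeneousExpansion.

(** * Normal families *)

Section NormalFamilies.
Variables (R : realType) (n : nat).
Local Notation C := R[i].
Local Notation point := (pt R n).

Lemma grad_affine (f : point -> C) (p w : point) (s b : C) c :
  grad f (fun j => p j + s * w j) c ->
  grad (fun w => f (fun j => p j + s * w j) - b) w (fun j => s * c j).
Proof.
move=> hf e e0; have l0 : 0 < nrm s + 1 by have := nrm_ge0 s; lra.
have [d d0 hd] := hf _ (divr_gt0 e0 l0).
exists (d / (nrm s + 1)) => [|h]; first by rewrite divr_gt0.
rewrite ltr_pdivlMr // => hs.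
have sv : supn (fun j => s * h j) <= nrm s * supn h by apply: supn_scale.
have h0 := supn_ge0 h.
have hv : nrm s * supn h <= supn h * (nrm s + 1) by rewrite mulrC ler_wpM2l //; lra.
have := hd (fun j => s * h j); move=> /(_ ltac:(lra)).
have -> : ptadd (fun j => p j + s * w j) (fun j => s * h j) = fun j => p j + s * ptadd w h j.
  by apply/funext => j; rewrite /ptadd; ring.
have -> : \sum_(j < n) c j * (s * h j) = \sum_(j < n) s * c j * h j.
  by apply: eq_bigr => j _; ring.
set A := f _; set B := f _ => H.
have -> : A - b - (B - b) = A - B by ring.
apply: le_trans H _.
have -> : e * supn h = e / (nrm s + 1) * (supn h * (nrm s + 1)).
  by field; rewrite gt_eqF.
by rewrite ler_wpM2l ?divr_ge0 ?(ltW e0) ?(ltW l0) //; lra.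
Qed.

(** The hypothesis speaks only of multiplicities that are attained. If some [c j] were nonzero, the
    homogeneous expansion built here would have multiplicity exactly one, and one is not at least
    two. *)
Lemma critical_at_double (U : set point) (f : point -> C) (al : point) (b : C) c :
  is_open U -> holomorphic U f -> U al -> f al = b ->
  (forall k, zero_mult (fun z => f z - b) al k -> (2 <= k)%N) ->
  grad f al c -> forall j, c j = 0.
Proof.
move=> oU hf Ual fb hk gc j0; apply/eqP; apply: contraT => cj0.
suff : zero_mult (fun z => f z - b) al 1 by move/hk.
have [r0 r00 hr] := oU al Ual.
have [d d0 hd] := gc 1 ltr01.
pose s := Num.min r0 d / 20.
have s0 : 0 < s by rewrite divr_gt0 // lt_min r00 d0.
have [sr sd] : 20 * s <= r0 /\ 20 * s <= d.
  have -> : 20 * s = Num.min r0 d by rewrite /s; field.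
  by rewrite ge_min lexx; split=> //; rewrite ge_min lexx orbT.
clearbody s.
pose S : C := s%:K.
have nS : nrm S = s by rewrite nrmK gtr0_norm.
have S0 : S != 0 by rewrite -nrm_gt0 nS.
pose G (w : point) := f (fun j => al j + S * w j) - b.
have supS (w : point) : supn w < 20 -> supn (fun j => S * w j) < 20 * s.
  by move=> hw; apply: le_lt_trans (supn_scale _ _) _; rewrite nS mulrC ltr_pM2r.
have dG (w : point) : supn w < 20 -> exists c, grad G w c.
  move=> hw; have [|c' hc'] := hf (fun j => al j + S * w j).
    apply: hr => j; rewrite addrC addKr.
    by apply: le_lt_trans (le_supn (fun j => S * w j) j) _; have := supS w hw; lra.
  by exists (fun j => S * c' j); apply: grad_affine.
(* Differentiability at [al] with error constant [1] already bounds [f - b] on the polydisc of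
   radius [d], by the linear part plus [d]. *)
pose M := \sum_(j < n) nrm (c j) * d + d.
have GM (w : point) : supn w < 20 -> nrm (G w) <= M.
  move=> hw; have h1 : supn (fun j => S * w j) < d by have := supS w hw; lra.
  have := hd _ h1; rewrite mul1r -/(G w) fb => h2.
  have -> : G w = (G w - \sum_(j < n) c j * (S * w j)) + \sum_(j < n) c j * (S * w j) by rewrite subrK.
  rewrite addrC; apply: le_trans (nrmD _ _) _; apply: lerD; last by rewrite /G; lra.
  apply: le_trans (nrm_sum _) _; apply: ler_sum => j _.
  rewrite nrmM ler_wpM2l ?nrm_ge0 //.
  by have := le_supn (fun j => S * w j) j; lra.
have [a ha] := homogeneous_expansion dG GM.
exists (fun k => a k * S^-1 ^+ (\sum_(j < n) k j)); split.
- exists s => // w ws e e0.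
  pose w' : point := fun j => S^-1 * w j.
  have w1 : supn w' <= 1.
    apply: le_trans (supn_scale _ _) _; rewrite nrmV nS.
    by rewrite ler_pdivrMl // mulr1 ltW.
  have [_ _ h] := ha w' w1.
  have [N0 hN0] := @geo_small R 4^-1 (4 * M) e ltac:(lra) ltac:(lra) e0.
  exists N0 => N /hN0; apply: le_lt_trans.
  have -> : f (ptadd al w) - b = G w'.
    by congr (f _ - b); apply/funext => j; rewrite /w' mulVKf.
  rewrite nrmBC; have -> : \sum_(i < N) hpart (fun k => a k * S^-1 ^+ (\sum_(j < n) k j)) i w =
     \sum_(i < N) hpart a i w'.
    by apply: eq_bigr => i _; rewrite hpart_coef_scale hpart_scale.
  exact: h.
- move=> i; rewrite ltnS leqn0 => /eqP -> w.
  have z1 : supn ((fun=> 0) : point) <= 1 by apply: supn_le => // j; rewrite nrm0.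
  have [h _ _] := ha _ z1.
  rewrite hpart_coef_scale expr0 mul1r (hpart0 _ _ (fun=> 0)) h /G.
  have -> : (fun j : 'I_n => al j + S * 0) = al by apply/funext => j; rewrite mulr0 addr0.
  by rewrite fb subrr.
(* On the unit vector of index [j0] the part of degree one is the derivative of [f] along that axis,
   namely [c j0]. *)
pose w : point := fun j => if j == j0 then 1 else 0.
move=> /(_ w).
have w1 : supn w <= 1.
  by apply: supn_le => // j; rewrite /w; case: eqP; rewrite ?nrm1 ?nrm0.
have [_ h _] := ha w w1; rewrite hpart_coef_scale h expr1 => /eqP.
rewrite mulf_eq0 invr_eq0 (negPf S0) /=.
suff -> : D (fun t => G (fun j => t * w j)) 0 = S * c j0.
  by rewrite mulf_eq0 (negPf S0) (negPf cj0).
apply: DE.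
have gc' : grad f (fun j => al j + 0 * (S * w j)) c.
  by rewrite (_ : (fun j => _) = al) //; apply/funext => j; rewrite mul0r addr0.
have := cderB (cder_line gc') (cder_cst b 0).
rewrite subr0 (bigD1 j0) //= big1 ?addr0 => [|j /negPf jj0]; last by rewrite /w jj0 !mulr0.
rewrite /w eqxx mulr1 mulrC; apply: cder_near; exists 1 => // t _.
by congr (f _ - b); apply/funext => j; rewrite mulrCA.
Qed.

(** * Schottky bounds on complex lines and polydiscs *)

Section Family.
Variables (U : set point) (F : set (point -> C)) (a b : C).
Hypotheses (oU : is_open U) (ab : a != b).
Hypothesis hF : forall f, F f -> holomorphic U f.
Hypothesis hab : forall f, F f -> (forall z, U z -> f z != a) /\
  (forall al, U al -> f al = b -> forall k, zero_mult (fun z => f z - b) al k -> (2 <= k)%N).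

(** The normalization [(f - a) / (b - a)] omits [0], and its derivative along the line vanishes
    where it equals [1], because the whole gradient does. The bound depends neither on [f] nor on
    the line. *)
Lemma ray_schottky : exists2 c : R, 0 < c <= 1 & forall M : R, exists M' : R,
  forall f (w v : point), F f -> (forall t : C, nrm t < 1 -> U (fun j => w j + t * v j)) ->
  nrm (f w) <= M -> forall t : C, nrm t <= c -> nrm (f (fun j => w j + t * v j)) <= M'.
Proof.
have [c c0 hc] := schottky R.
exists (Num.min c 1) => [|M]; first by rewrite lt_min c0 ltr01 ge_min lexx orbT.
have ba : b - a != 0 by rewrite subr_eq0 eq_sym.
have nba : 0 < nrm (b - a) by rewrite nrm_gt0.
have [M' hM'] := hc ((M + nrm a) / nrm (b - a)).
exists (M' * nrm (b - a) + nrm a) => f w v Ff hU fM t; rewrite le_min => /andP[tc _].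
pose g (s : C) := (b - a)^-1 * (f (fun j => w j + s * v j) - a).
have [fa fb] := hab Ff.
have dg s : nrm s < 1 -> exists2 e, grad f (fun j => w j + s * v j) e &
    cder g s ((b - a)^-1 * (\sum_(j < n) e j * v j)).
  move=> hs; have [e he] := hF Ff (hU s hs); exists e => //; apply: cderZ.
  by rewrite -[X in cder _ _ X]subr0; apply: cderB (cder_line he) (cder_cst a s).
have hg : holo 0 1 g by move=> s; rewrite subr0 => /dg[e _ h]; eexists; apply: h.
have od : omits_doubles 0 1 g.
  move=> s; rewrite subr0 => hs; split.
    by rewrite mulf_neq0 ?invr_eq0 // subr_eq0 fa //; apply: hU.
  move=> gs; have [e he dge] := dg s hs; rewrite (DE dge).
  have fsb : f (fun j => w j + s * v j) = b.
    by apply: (addIr (- a)); rewrite -[RHS]mulr1 -gs mulVKf.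
  have e0 := critical_at_double oU (hF Ff) (hU s hs) fsb (fb _ (hU s hs) fsb) he.
  by rewrite big1 ?mulr0 // => j _; rewrite e0 mul0r.
have w0 : (fun j => w j + 0 * v j) = w by apply/funext => j; rewrite mul0r addr0.
have g0 : nrm (g 0) <= (M + nrm a) / nrm (b - a).
  rewrite /g w0 nrmM nrmV mulrC ler_pM2r ?invr_gt0 //.
  by apply: le_trans (nrmB _ _) _; lra.
have := hM' g hg od g0 t tc.
have fE : f (fun j => w j + t * v j) = g t * (b - a) + a by rewrite /g mulrC mulVKf // subrK.
move=> h; rewrite fE; apply: le_trans (nrmD _ _) _.
by rewrite nrmM lerD2r ler_pM2r.
Qed.

(** The line through [w] and [z] with direction [v = (z - w) / c] has [|v j| <= r / 2], so it stays
    in the polydisc for [|t| < 1] and reaches [z] at [t = c]. As [z] and [w] are interchangeable,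
    boundedness and divergence to infinity both spread from any point of the small polydisc to the
    others. *)
Lemma harnack : exists2 c : R, 0 < c <= 4^-1 & forall M : R, exists M' : R,
  forall (p : point) (r : R), 0 < r -> polydisc p r `<=` U -> forall f, F f ->
  forall z w, polydisc p (c * r) z -> polydisc p (c * r) w -> nrm (f w) <= M -> nrm (f z) <= M'.
Proof.
have [c /andP[c0 c1] hc] := ray_schottky.
exists (c / 4) => [|M]; first lra.
have [M' hM'] := hc M; exists M' => p r r0 hU f Ff z w hz hw fM.
have cK : c%:K != 0 :> C by rewrite -nrm_gt0 nrmK normr_gt0 gt_eqF.
pose v : point := fun j => c%:K^-1 * (z j - w j).
have cr : c / 4 * r <= r / 4.
  have : c * r <= 1 * r by rewrite ler_wpM2r // ltW.
  lra.
have hv j : nrm (v j) <= r / 2.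
  rewrite nrmM nrmV nrmK gtr0_norm // ler_pdivrMl //.
  have := nrm_tri3 (p j) (z j) (w j); have := hz j; have := hw j.
  by rewrite [nrm (p j - _)]nrmBC; lra.
have -> : z = fun j => w j + c%:K * v j.
  by apply/funext => j; rewrite /v mulVKf // addrC subrK.
apply: hM' => //; last by rewrite nrmK gtr0_norm.
move=> t ht; apply: hU => j.
have -> : w j + t * v j - p j = (w j - p j) + t * v j by ring.
apply: le_lt_trans (nrmD _ _) _; rewrite nrmM.
have : nrm t * nrm (v j) <= 1 * (r / 2) by apply: ler_pM; rewrite ?nrm_ge0 ?(ltW ht) ?hv.
by have := hw j; lra.
Qed.

End Family.

(** On the line from [w] towards [z], parametrized so that [z] is at [x = 2 * d / s], Cauchy's
    estimate on discs of radius [1 / 4] bounds the derivative by [32 * M]; multiplying by [x] gives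
    the claim. *)
Lemma lipschitz_polydisc (U : set point) (f : point -> C) (p : point) (s M d : R) z w :
  holomorphic U f -> 0 < s -> polydisc p s `<=` U -> (forall q, polydisc p s q -> nrm (f q) <= M) ->
  polydisc p (s / 4) z -> polydisc p (s / 4) w -> 0 < d -> 2 * d <= s ->
  (forall j, nrm (z j - w j) <= d) -> nrm (f z - f w) <= 64 * M * d / s.
Proof.
move=> hf s0 hU hM hz hw d0 ds hd.
pose x : R := 2 * d / s.
have x0 : 0 < x by rewrite divr_gt0 // mulr_gt0.
have x1 : x <= 1 by rewrite ler_pdivrMr // mul1r.
have xK : x%:K != 0 :> C by rewrite -nrm_gt0 nrmK normr_gt0 gt_eqF.
pose v : point := fun j => x%:K^-1 * (z j - w j).
have hv j : nrm (v j) <= s / 2.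
  rewrite nrmM nrmV nrmK (gtr0_norm x0) ler_pdivrMl //.
  by apply: le_trans (hd j) _; rewrite /x le_eqVlt; apply/orP; left; apply/eqP; field; rewrite gt_eqF.
pose g (t : C) := f (fun j => w j + t * v j).
have inp t : nrm t < 3 / 2 -> polydisc p s (fun j => w j + t * v j).
  move=> ht j; have -> : w j + t * v j - p j = (w j - p j) + t * v j by ring.
  apply: le_lt_trans (nrmD _ _) _; rewrite nrmM.
  have : nrm t * nrm (v j) <= 3 / 2 * (s / 2) by apply: ler_pM; rewrite ?nrm_ge0 ?(ltW ht) ?hv.
  by have := hw j; lra.
have hg : holo 0 (3 / 2) g.
  move=> t; rewrite subr0 => ht; have [e he] := hf _ (hU _ (inp t ht)).
  by eexists; apply: cder_line he.
have h32 (t : C) : nrm (t - 0) < 5 / 4 -> nrm (D g t) <= 32 * M.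
  rewrite subr0 => ht.
  have q0 : 0 < 4^-1 :> R by lra.
  have hgt : holo t 4^-1 g by apply: (holo_sub hg); rewrite subr0; lra.
  have := cauchy_estimate q0 hgt (M := M); rewrite invrK => H.
  apply: le_trans (H _) _; last lra.
  move=> u hu; apply: hM; apply: inp.
  by have := nrmD (u - t) t; rewrite subrK; lra.
have := @disc_lipschitz R 0 (5 / 4) g (D g) (32 * M) 0 x%:K.
rewrite !subr0 nrm0 nrmK gtr0_norm // => H.
have gz : g x%:K = f z by congr f; apply/funext => j; rewrite /v mulVKf // addrC subrK.
have gw : g 0 = f w by congr f; apply/funext => j; rewrite mul0r addr0.
rewrite gz gw in H.
apply: le_trans (H _ _ _ _) _.
- move=> t ht; apply: holoD hg _; move: ht; rewrite subr0; lra.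
- exact: h32.
- lra.
- lra.
by rewrite /x le_eqVlt; apply/orP; left; apply/eqP; ring.
Qed.

(** * Compactness of locally bounded sequences *)

Section UltraLimit.
Variable W : set_system nat.
Hypothesis uW : UltraFilter W.

(** The limit is the supremum of the levels below which the sequence does not fall on a set of [W];
    for a level above it, the ultrafilter must contain the complementary set. *)
Lemma ultra_real_limit (x : nat -> R) (K : R) : (forall m, `|x m| <= K) ->
  exists l, forall e : R, 0 < e -> W [set m | `|x m - l| < e].
Proof.
move=> xK; have pW : ProperFilter W := ultra_proper.
pose S := [set y | W [set m | y <= x m]].
have lo m : - K <= x m by have := xK m; rewrite ler_norml => /andP[].
have hi m : x m <= K by have := xK m; rewrite ler_norml => /andP[].
have supS : has_sup S.
  split; first by exists (- K); apply: filterS (filterT) => m _; exact: lo.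
  exists K => y /filter_ex[m /= ym]; exact: le_trans ym (hi m).
exists (sup S) => e e0.
have [y Sy hy] := sup_adherent e0 supS.
have h1 : W [set m | x m < sup S + e].
  have [h|h] := in_ultra_setVsetC [set m | sup S + e <= x m] uW.
    have : sup S + e <= sup S by apply: ub_le_sup => //; case: supS.
    lra.
  by apply: filterS h => m /= /negP; rewrite -ltNge.
apply: filterS (filterI Sy h1) => m [/= k1 k2].
by rewrite ltr_norml; lra.
Qed.

Lemma ultra_limit (x : nat -> C) (K : R) : (forall m, nrm (x m) <= K) ->
  exists l, forall e : R, 0 < e -> W [set m | nrm (x m - l) < e].
Proof.
move=> xK; have pW : ProperFilter W := ultra_proper.
have [l1 h1] := ultra_real_limit (fun m => le_trans (Re_le_nrm (x m)) (xK m)).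
have [l2 h2] := ultra_real_limit (fun m => le_trans (Im_le_nrm (x m)) (xK m)).
exists (Complex l1 l2) => e e0; have e2 : 0 < e / 2 by lra.
apply: filterS (filterI (h1 _ e2) (h2 _ e2)) => m [/= k1 k2].
apply: le_lt_trans (nrm_le_ReIm _) _; rewrite !raddfB /=; lra.
Qed.

End UltraLimit.

(** The condition may change with the stage [k]: this gives the diagonal choice in [montel] and, for
    a constant condition, an ordinary subsequence. *)
Lemma extraction (P : nat -> nat -> Prop) :
  (forall k N, exists2 m, (N <= m)%N & P k m) ->
  exists phi : nat -> nat, (forall k, (phi k < phi k.+1)%N) /\ forall k, P k (phi k).
Proof.
move=> h.
have ex (kN : nat * nat) : exists m, (kN.2 <= m)%N /\ P kN.1 m.
  by have [m h1 h2] := h kN.1 kN.2; exists m.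
have [f hf] := choice ex.
pose phi := fix phi k := if k is k'.+1 then f (k, (phi k').+1) else f (0%N, 0%N).
exists phi; split=> [k|[|k]] /=; first by case: (hf (k.+1, (phi k).+1)).
  by case: (hf (0%N, 0%N)).
by case: (hf (k.+1, (phi k).+1)).
Qed.

(** Points of spacing [1 / (k + 1)] covering [[-(k + 1), k + 1]], so the grids become both finer and
    wider while each stays finite. *)
Definition grid_size (k : nat) : nat := (2 * k.+1 ^ 2).+1.

Definition grid_coord (k i : nat) : R := i%:R / k.+1%:R - k.+1%:R.

Definition grid_point (k : nat) (i : {ffun 'I_n -> 'I_(grid_size k) * 'I_(grid_size k)}) : point :=
  fun j => Complex (grid_coord k (i j).1) (grid_coord k (i j).2).

Lemma grid_coord_near k (x : R) : `|x| <= k.+1%:R ->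
  exists i : 'I_(grid_size k), `|x - grid_coord k i| <= k.+1%:R^-1.
Proof.
rewrite ler_norml => /andP[x1 x2]; set K : R := k.+1%:R in x1 x2 *.
have K0 : 0 < K by rewrite ltr0n.
pose y := (x + K) * K.
have y0 : 0 <= y by rewrite mulr_ge0 ?(ltW K0) //; lra.
have /andP[i1 i2] := truncn_itv y0.
have lt : (Num.truncn y < grid_size k)%N.
  rewrite ltnS -(ler_nat R); apply: le_trans i1 _.
  rewrite natrM natrX -/K /y expr2 mulrA ler_wpM2r ?(ltW K0) //; lra.
exists (Ordinal lt) => /=; rewrite /grid_coord -/K.
rewrite -(ler_pM2r K0) mulVf ?gt_eqF //.
have nK (A : R) : `|A| * K = `|A * K| by rewrite normrM (gtr0_norm K0).
rewrite nK.
have -> : (x - ((Num.truncn y)%:R / K - K)) * K = y - (Num.truncn y)%:R.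
  by rewrite /y; field; rewrite gt_eqF.
by move: i2; rewrite -natr1 => i2; rewrite ger0_norm; lra.
Qed.

Lemma grid_near k (z : point) : supn z <= k.+1%:R ->
  exists i : {ffun 'I_n -> 'I_(grid_size k) * 'I_(grid_size k)},
    forall j, nrm (z j - grid_point i j) <= 2 / k.+1%:R.
Proof.
move=> hz.
have ex j : exists i : 'I_(grid_size k) * 'I_(grid_size k),
    nrm (z j - Complex (grid_coord k i.1) (grid_coord k i.2)) <= 2 / k.+1%:R.
  have zj := le_trans (le_supn z j) hz.
  have [i1 h1] := grid_coord_near (le_trans (Re_le_nrm (z j)) zj).
  have [i2 h2] := grid_coord_near (le_trans (Im_le_nrm (z j)) zj).
  have ReB (x : C) (p q : R) : complex.Re (x - Complex p q) = complex.Re x - p by case: x.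
  have ImB (x : C) (p q : R) : complex.Im (x - Complex p q) = complex.Im x - q by case: x.
  exists (i1, i2); apply: le_trans (nrm_le_ReIm _) _; rewrite ReB ImB.
  have -> : 2 / k.+1%:R = k.+1%:R^-1 + k.+1%:R^-1 :> R by ring.
  exact: lerD.
have [i hi] := choice ex.
by exists [ffun j => i j] => j; rewrite /grid_point ffunE.
Qed.

(* A locally bounded sequence: its limit along an ultrafilter is defined everywhere, and
   equicontinuity reduces uniform closeness to closeness on finite grids. *)
Lemma montel (U : set point) (v : nat -> point -> C) :
  (forall m, holomorphic U (v m)) ->
  (forall p, U p -> exists s K, [/\ 0 < s, polydisc p s `<=` U &
     forall m z, polydisc p s z -> nrm (v m z) <= K]) ->
  exists phi : nat -> nat, (forall m, (phi m < phi m.+1)%N) /\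
    exists g, cvg_loc_unif U (fun m => v (phi m)) g.
Proof.
move=> hv hb.
have [W [uW evW]] := ultraFilterLemma eventually_filter.
have pW : ProperFilter W := ultra_proper.
have exg z : exists l, U z -> forall e : R, 0 < e -> W [set m | nrm (v m z - l) < e].
  have [Uz|nUz] := pselect (U z); last by exists 0.
  have [s [K [s0 _ hK]]] := hb z Uz.
  have zz : polydisc z s z by move=> j; rewrite subrr nrm0.
  by have [l hl] := ultra_limit uW (fun m => hK m z zz); exists l.
have [g hg] := choice exg.
pose P k m := forall i : {ffun 'I_n -> 'I_(grid_size k) * 'I_(grid_size k)},
  U (grid_point i) -> nrm (v m (grid_point i) - g (grid_point i)) <= k.+1%:R^-1.
(* [W] contains every tail, and the finitely many conditions of stage [k] hold together on a set of
   [W]; the two sets meet. *)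
have exP k N : exists2 m, (N <= m)%N & P k m.
  have WN : W [set m | (N <= m)%N] by apply: evW; exists N.
  have WP : W [set m | P k m].
    apply: filter_forall => i.
    have [Ui|nUi] := pselect (U (grid_point i)).
      have k0 : 0 < k.+1%:R^-1 :> R by rewrite invr_gt0 ltr0n.
      by apply: filterS (hg _ Ui _ k0) => m /= /ltW.
    by apply: filterS filterT => m _ /nUi.
  by have [m [h1 h2]] := filter_ex (filterI WN WP); exists m.
have [phi [phi_inc hphi]] := extraction exP.
exists phi; split=> //; exists g => p Up.
have [s [K [s0 hU hK]]] := hb p Up.
have K0 : 0 <= K.
  by apply: le_trans (nrm_ge0 _) (hK 0%N p _) => j; rewrite subrr nrm0.
exists (s / 8) => [|e e0]; first lra.
(* Lower bounds for [k + 1]: [supn p + s] puts [z] in the range of the grid, [16 / s] makes the mesh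
   at most [s / 8], and the last term brings the total error below [e]. *)
pose B := supn p + s + 16 / s + (256 * K / s + 2) / e.
have p0 := supn_ge0 p.
have B1 : 0 <= 16 / s by rewrite divr_ge0 // ltW.
have B2 : 0 <= 256 * K / s by rewrite divr_ge0 ?mulr_ge0 ?(ltW s0).
have B3 : 0 <= (256 * K / s + 2) / e by rewrite divr_ge0 ?addr_ge0 ?(ltW e0).
exists (Num.truncn B).+1 => k kB z Uz hz.
have kR : B < k.+1%:R.
  by apply: lt_le_trans (truncnS_gt B) _; rewrite ler_nat (leq_trans kB).
set L : R := k.+1%:R in kR *; have L0 : 0 < L by rewrite ltr0n.
rewrite /B in kR.
have zL : supn z <= L.
  apply: supn_le => [|j]; first exact: ltW.
  have := hz j; have := nrmD (z j - p j) (p j); rewrite subrK; have := le_supn p j; lra.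
have [i hi] := grid_near zL.
set x := grid_point i in hi; pose d := 2 / L.
have d0 : 0 < d by rewrite divr_gt0.
have ds : d <= s / 8.
  have h : 16 / s <= L by lra.
  by rewrite /d ler_pdivrMr //; move: h; rewrite ler_pdivrMr //; lra.
have hx : polydisc p (s / 4) x.
  move=> j; have := hi j; have := hz j; have := nrm_tri3 (z j) (x j) (p j).
  by rewrite [nrm (x j - z j)]nrmBC -/L -/d; lra.
have hz' : polydisc p (s / 4) z by move=> j; have := hz j; lra.
have Ux : U x by apply: hU => j; have := hx j; lra.
have lip m : nrm (v m z - v m x) <= 64 * K * d / s.
  by apply: (lipschitz_polydisc (hv m) s0 hU (hK m) hz' hx d0) => //; lra.
(* The common Lipschitz bound passes to [g], through one index at which [v m] is close to [g] at
   both points. *)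
have lipg : nrm (g x - g z) <= 64 * K * d / s.
  apply/ler_addgt0Pr => e1 e10; have e2 : 0 < e1 / 2 by lra.
  have [m [/= h1 h2]] := filter_ex (filterI (hg x Ux _ e2) (hg z Uz _ e2)).
  have -> : g x - g z = (v m z - g z) - (v m x - g x) - (v m z - v m x) by ring.
  apply: le_trans (nrmB _ _) _; have := nrmB (v m z - g z) (v m x - g x).
  have := lip m; lra.
have hk := hphi k i Ux; rewrite -/x -/L in hk.
apply: le_lt_trans (nrm_tri3 (v (phi k) x) _ _) _; cbv beta.
have := nrm_tri3 (g x) (v (phi k) x) (g z); have := lip (phi k).
have fin : 64 * K * d / s + 64 * K * d / s + L^-1 < e.
  have -> : 64 * K * d / s + 64 * K * d / s + L^-1 = (256 * K / s + 1) / L.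
    by rewrite /d; field; rewrite !gt_eqF.
  rewrite ltr_pdivrMr // [ltRHS]mulrC -ltr_pdivrMr //.
  have : (256 * K / s + 1) / e <= (256 * K / s + 2) / e.
    by rewrite ler_pM2r ?invr_gt0 //; lra.
  lra.
move=> t1 t2; apply: le_lt_trans (lerD t1 (le_trans t2 (lerD hk lipg))) _.
by rewrite [L^-1 + _]addrC addrA.
Qed.

End NormalFamilies.

(** * Connectedness and the choice between convergence and divergence *)

Theorem theorem8 (R : realType) (n : nat) (D : set (pt R n))
    (F : set (pt R n -> R[i])) (a b : R[i]) :
  is_domain D -> a != b ->
  (forall f, F f -> holomorphic D f) ->
  (forall f, F f ->
     (forall z, D z -> f z != a) /\
     (forall al, D al -> f al = b ->
        forall k, zero_mult (fun z => f z - b) al k -> (2 <= k)%N)) ->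
  normal_in D F.
Proof.
move=> [oD [p0 Dp0] conn] ab hF hab u Fu.
have [c /andP[c0 c4] hc] := harnack oD ab hF hab.
have ball p : D p -> exists r, [/\ 0 < r, polydisc p r `<=` D, polydisc p (c * r) p &
    polydisc p (c * r) `<=` D].
  move=> Dp; have [r r0 hr] := oD p Dp; exists r; split=> //.
    by move=> j; rewrite subrr nrm0 mulr_gt0.
  move=> z hz; apply: hr => j; apply: lt_le_trans (hz j) _.
  by rewrite ler_piMl ?(ltW r0) //; lra.
(* A property exchanged both ways between the centre and the points of the small polydiscs holds on
   an open set whose complement in [D] is open too, so connectedness spreads it from [p0] to [D]. *)
have clopen (P : set (pt R n)) : D p0 -> P p0 ->
    (forall p r, D p -> 0 < r -> polydisc p r `<=` D -> forall q, polydisc p (c * r) q ->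
       (P p -> P q) /\ (P q -> P p)) -> forall p, D p -> P p.
  move=> _ Pp0 hP.
  have oU (Q : set (pt R n)) : (forall p r, D p -> 0 < r -> polydisc p r `<=` D ->
     forall q, polydisc p (c * r) q -> Q p -> Q q) -> is_open [set p | D p /\ Q p].
    move=> hQ p [Dp Qp]; have [r [r0 hr _ hcr]] := ball p Dp.
    exists (c * r); first by rewrite mulr_gt0.
    by move=> q hq; split; [exact: hcr|apply: (hQ p r)].
  have [||||h|h] := conn [set p | D p /\ P p] [set p | D p /\ ~ P p].
  - by apply: oU => p r Dp r0 hr q hq; have [] := hP p r Dp r0 hr q hq.
  - by apply: oU => p r Dp r0 hr q hq nP Pq; apply: nP; have [_] := hP p r Dp r0 hr q hq; apply.
  - by move=> p Dp; have [Pp|nPp] := pselect (P p); [left|right].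
  - by apply/seteqP; split=> // p [[_ [_ Pp]] [_ nPp]].
  - by move=> p /h[].
  by have [_] := h p0 Dp0.
have [big|nbig] := pselect (forall K : R, exists N, forall m, (N <= m)%N -> K < nrm (u m p0)).
  exists id; split=> [m|]; first exact: ltnSn.
  right; pose P : set (pt R n) := [set p | forall K : R, exists N, forall m, (N <= m)%N -> K < nrm (u m p)].
  have Pall : forall p, D p -> P p.
    apply: clopen => // p r Dp r0 hr q hq.
    have pp : polydisc p (c * r) p by move=> j; rewrite subrr nrm0 mulr_gt0.
    have tr x y : polydisc p (c * r) x -> polydisc p (c * r) y -> P x -> P y.
      move=> hx hy Px K; have [K' hK'] := hc K; have [N hN] := Px K'.
      exists N => m Nm; rewrite ltNge; apply/negP => h.
      (* Read contrapositively, [harnack] says that values above [K'] at one point force values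
         above [K] at the other. *)
      have := hK' p r r0 hr (u m) (Fu m) x y hx hy h.
      by rewrite leNgt hN.
    by split; apply: tr.
  move=> p Dp; have [r [r0 hr pp hcr]] := ball p Dp.
  exists (c * r) => [|M]; first by rewrite mulr_gt0.
  have [M' hM'] := hc M; have [N hN] := Pall p Dp M'.
  exists N => m Nm z Dz hz; rewrite ltNge; apply/negP => h.
  by have := hM' p r r0 hr (u m) (Fu m) p z pp hz h; rewrite leNgt hN.
have [K hK] : exists K : R, forall N, exists2 m, (N <= m)%N & nrm (u m p0) <= K.
  move/existsNP: nbig => [K hK]; exists K => N.
  move/forallNP: hK => /(_ N)/existsNP[m /not_implyP[Nm /negP]].
  by rewrite -leNgt; exists m.
have [psi [psi_inc hpsi]] := extraction (P := fun _ m => nrm (u m p0) <= K) (fun _ => hK).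
(* Boundedness at [p0] spreads to pointwise boundedness on [D]; one more use of [harnack] makes it
   locally uniform, as [montel] requires. *)
have bnd p : D p -> exists K, forall m, nrm (u (psi m) p) <= K.
  apply: (clopen [set p | exists K, forall m, nrm (u (psi m) p) <= K]) => //; first by exists K.
  move=> {}p r Dp r0 hr q hq.
  have pp : polydisc p (c * r) p by move=> j; rewrite subrr nrm0 mulr_gt0.
  have tr x y : polydisc p (c * r) x -> polydisc p (c * r) y ->
      (exists K, forall m, nrm (u (psi m) x) <= K) -> exists K, forall m, nrm (u (psi m) y) <= K.
    move=> hx hy [K1 h1]; have [K2 h2] := hc K1; exists K2 => m.
    exact: h2 r0 hr _ (Fu _) _ _ hy hx (h1 m).
  by split; apply: tr.
have [|p Dp|phi [phi_inc [g hg]]] := @montel R n D (fun m => u (psi m)).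
- by move=> m; apply: hF.
- have [r [r0 hr pp hcr]] := ball p Dp; have [K1 h1] := bnd p Dp; have [K2 h2] := hc K1.
  exists (c * r), K2; split=> [||m z hz] //; first by rewrite mulr_gt0.
  exact: h2 r0 hr _ (Fu _) _ _ hz pp (h1 m).
exists (fun m => psi (phi m)); split; last by left; exists g.
have mono x y : (x < y)%N -> (psi x < psi y)%N.
  elim: y => // y IH; rewrite ltnS leq_eqVlt => /orP[/eqP ->|/IH h]; first exact: psi_inc.
  exact: ltn_trans h (psi_inc y).
by move=> m; apply: mono.
Qed.
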